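(* Let $c=0$, $\eta=0$, let $\phi:M^2\to N^3(0)$ be an oriented isometric immersion into a flat space form, and let $\mathscr B_0:=D^2+|A|^2-H^2$. Every monic scalar--chiral factorization of $\mathscr B_0$ has the form $$\mathscr B_0=(D-p+q\,\omega)(D+p+q\,\omega)$$ with $$\operatorname{grad}p=J\operatorname{grad}q,\qquad p^2+q^2=H^2-|A|^2 .$$ In a conformal coordinate $z=x+iy$ satisfying $J\partial_x=\partial_y$, the functions $r:=p-iq$ and $t:=p+iq$ are respectively holomorphic and antiholomorphic and satisfy $rt=H^2-|A|^2$. On a simply connected region where $A\neq0$, such a factorization exists if and only if $$\Delta\log(|A|^2-H^2)=0 .$$ On a connected planar region (where $A=0$), one of $r,t$ vanishes identically while the other is an arbitrary holomorphic (if it is $r$) or antiholomorphic (if it is $t$) function.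
   Context: $N^3(0)$ is an oriented flat Riemannian three-dimensional space form; $M^2$ is an oriented surface immersed with unit normal $\xi$ and induced metric $g$. The shape operator is $\nabla^N_X\xi=-A(X)$, $H=\frac12\operatorname{tr}A$, $|A|^2=\operatorname{tr}(A^2)$, $\Delta=\operatorname{div}\operatorname{grad}$ for $g$. $\Sigma M$ is the complex spinor bundle of a spin structure on $M$; Clifford multiplication satisfies $X\cdot Y+Y\cdot X=-2g(X,Y)$. $\omega=e_1\cdot e_2$ for a positively oriented orthonormal frame, acting by Clifford multiplication, and $D\Psi=e_1\cdot\nabla_{e_1}\Psi+e_2\cdot\nabla_{e_2}\Psi$. $J$ is rotation by $+\pi/2$ on $TM$; for complex-valued functions $\operatorname{grad}$ and $J$ are extended complex-linearly. A monic scalar--chiral factorization of $\mathscr B_0$ on an open set is an operator identity $\mathscr B_0=(D+a+b\,\omega)(D+p+q\,\omega)$ on sections of $\Sigma M$ there, with $a,b,p,q$ smooth complex-valued functions on that set. *)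

(* Defs.v *)
From HB Require Import structures.
From mathcomp Require Import all_boot all_order all_algebra.
From mathcomp Require Import complex.
From mathcomp Require Import all_classical all_reals all_analysis.

Set Implicit Arguments.
Unset Strict Implicit.
Unset Printing Implicit Defensive.

Import Order.TTheory GRing.Theory Num.Theory.
Import numFieldNormedType.Exports.

Local Open Scope classical_set_scope.
Local Open Scope ring_scope.
Local Open Scope complex_scope.

Local Notation cRe := (@complex.Re _).
Local Notation cIm := (@complex.Im _).

(* Geometry is written in classical tensor notation: a tensor field is the
   family of its component functions in the charts of the atlas, together with
   its transformation law.  Tangent vectors are row vectors and a linear map is
   the matrix acting on row vectors from the right, as for [jacobian]. *)

Section Smoothness.
Variables (R : realType) (n : nat).
Implicit Types (f : 'rV[R]_n -> R) (O : set 'rV[R]_n).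

Definition bvec (i : 'I_n) : 'rV[R]_n := delta_mx 0 i.

Definition partial (i : 'I_n) f : 'rV[R]_n -> R := fun x => 'D_(bvec i) f x.

(* C^infinity on an open set: all iterated partial derivatives exist and are
   differentiable (hence continuous) at every point. *)
Definition smooth_on O f :=
  forall (s : seq 'I_n) x, O x -> differentiable (foldr partial f s) x.

End Smoothness.

Section Manifold.
Variables (R : realType) (n : nat) (M : topologicalType).

(* [coord] and [coordV] are total functions; only their values on [dom] and on
   [coord @` dom] are meaningful. *)
Record chart := Chart {
  dom : set M;
  coord : M -> 'rV[R]_n;
  coordV : 'rV[R]_n -> M;
  dom_open : open dom;
  image_open : open (coord @` dom);
  coordK : forall m, dom m -> coordV (coord m) = m;
  coord_continuous : forall m, dom m -> {for m, continuous coord};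
  coordV_continuous : forall x, (coord @` dom) x -> {for x, continuous coordV}
}.

Definition transition (c c' : chart) : 'rV[R]_n -> 'rV[R]_n :=
  coord c' \o coordV c.

Definition oriented_compatible (c c' : chart) :=
  let O := coord c @` (dom c `&` dom c') in
  (forall j, smooth_on O (fun x => transition c c' x 0 j)) /\
  (forall x, O x -> 0 < \det (jacobian (transition c c') x)).

(* A smooth structure with an orientation: a maximal oriented atlas. *)
Record oriented_manifold := OrientedManifold {
  atlas : set chart;
  atlas_cover : forall m, exists2 c, atlas c & dom c m;
  atlas_compatible :
    forall c c', atlas c -> atlas c' -> oriented_compatible c c';
  atlas_maximal : forall c,
    (forall c', atlas c' ->
      oriented_compatible c c' /\ oriented_compatible c' c) -> atlas c;
  manifold_hausdorff : hausdorff_space M;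
  manifold_second_countable : @second_countable M
}.

(* Derivative of a function in the direction of the tangent vector with
   components [v] in the chart [c]. *)
Definition dchart (c : chart) (v : 'rV[R]_n) (f : M -> R) (m : M) : R :=
  'D_v (f \o coordV c) (coord c m).

Definition cdchart (c : chart) (v : 'rV[R]_n) (f : M -> R[i]) (m : M) : R[i] :=
  dchart c v (cRe \o f) m +i* dchart c v (cIm \o f) m.

Variable X : oriented_manifold.

Definition smooth_fun (U : set M) (f : M -> R) :=
  forall c, atlas X c -> smooth_on (coord c @` (dom c `&` U)) (f \o coordV c).

Definition csmooth_fun (U : set M) (f : M -> R[i]) :=
  smooth_fun U (cRe \o f) /\ smooth_fun U (cIm \o f).

Record riemannian_metric := RiemannianMetric {
  gmx : chart -> M -> 'M[R]_n;
  gmx_sym : forall c m, atlas X c -> dom c m -> (gmx c m)^T = gmx c m;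
  gmx_pos : forall c m (v : 'rV[R]_n), atlas X c -> dom c m -> v != 0 ->
    0 < (v *m gmx c m *m v^T) 0 0;
  gmx_smooth : forall c i j, atlas X c ->
    smooth_on (coord c @` dom c) (fun x => gmx c (coordV c x) i j);
  gmx_change : forall c c' m, atlas X c -> atlas X c' -> dom c m -> dom c' m ->
    gmx c m = jacobian (transition c c') (coord c m) *m gmx c' m
                *m (jacobian (transition c c') (coord c m))^T
}.

Variable g : riemannian_metric.

(* Locally isometric to Euclidean space. *)
Definition flat :=
  forall m, exists c, [/\ atlas X c, dom c m &
    forall m', dom c m' -> gmx g c m' = 1%:M].

(* Christoffel symbol Gamma^k_ij of the Levi-Civita connection. *)
Definition christoffel (c : chart) (m : M) (i j k : 'I_n) : R :=
  2^-1 * \sum_(l < n) invmx (gmx g c m) k l *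
    (dchart c (bvec R i) (fun m' => gmx g c m' j l) m
     + dchart c (bvec R j) (fun m' => gmx g c m' i l) m
     - dchart c (bvec R l) (fun m' => gmx g c m' i j) m).

Definition christoffel_term (c : chart) (m : M) (v w : 'rV[R]_n) : 'rV[R]_n :=
  \row_k \sum_(i < n) \sum_(j < n) v 0 i * w 0 j * christoffel c m i j k.

Definition nabla (c : chart) (v : 'rV[R]_n) (Y : M -> 'rV[R]_n) (m : M)
    : 'rV[R]_n :=
  \row_k dchart c v (fun m' => Y m' 0 k) m + christoffel_term c m v (Y m).

Definition grad (c : chart) (f : M -> R) (m : M) : 'rV[R]_n :=
  (\row_i dchart c (bvec R i) f m) *m invmx (gmx g c m).

Definition cgrad (c : chart) (f : M -> R[i]) (m : M) : 'rV[R[i]]_n :=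
  map_mx (real_complex R) (grad c (cRe \o f) m)
  + 'i%C *: map_mx (real_complex R) (grad c (cIm \o f) m).

Definition divergence (c : chart) (Y : M -> 'rV[R]_n) (m : M) : R :=
  \sum_(i < n) nabla c (bvec R i) Y m 0 i.

Definition laplacian (c : chart) (f : M -> R) (m : M) : R :=
  divergence c (grad c f) m.

End Manifold.

Section Topology.
Variables (R : realType) (M : topologicalType).
Implicit Types (U : set M) (u : R -> M).

Local Notation unit_itv := ([set` `[0%R, 1%R]] : set R).

Definition path_in U u :=
  {within unit_itv, continuous u} /\ (forall s, unit_itv s -> U (u s)).

Definition simply_connected U :=
  (forall x y, U x -> U y -> exists u, [/\ path_in U u, u 0 = x & u 1 = y]) /\
  (forall u, path_in U u -> u 0 = u 1 ->
    exists F : R * R -> M,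
      [/\ {within unit_itv `*` unit_itv, continuous F},
          forall st, (unit_itv `*` unit_itv) st -> U (F st),
          forall t, unit_itv t -> F (0, t) = u t,
          forall t, unit_itv t -> F (1, t) = u 0 &
          forall s, unit_itv s -> F (s, 0) = u 0 /\ F (s, 1) = u 0]).

End Topology.

Section Surface.
Variables (R : realType) (M : topologicalType).
Variables (X : oriented_manifold R 2 M) (g : riemannian_metric X).

(* Rotation by +pi/2 in the chart [c]:
     J d_x = (- g_12 d_x + g_11 d_y) / sqrt (det g),
     J d_y = (- g_22 d_x + g_12 d_y) / sqrt (det g). *)
Definition Jmx (c : chart R 2 M) (m : M) : 'M[R]_2 :=
  (Num.sqrt (\det (gmx g c m)))^-1 *:
    (gmx g c m *m (delta_mx 0 1 - delta_mx 1 0)).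

Definition conformal (c : chart R 2 M) :=
  atlas X c /\
  forall m, dom c m ->
    (exists2 lam : R, 0 < lam & gmx g c m = lam%:M) /\
    bvec R 0 *m Jmx c m = bvec R 1.

Definition rV_of_complex (z : R[i]) : 'rV[R]_2 :=
  \row_i (if i == 0 then cRe z else cIm z).

Definition complex_of_rV (x : 'rV[R]_2) : R[i] := x 0 0 +i* x 0 1.

(* Smooth, and complex differentiable as a function of z = x + iy in every
   conformal coordinate.  ([R[i]] is normed over itself, so [derivable _ _ 1]
   is the existence of the limit of the complex difference quotient.) *)
Definition holomorphic_on (U : set M) (f : M -> R[i]) :=
  csmooth_fun X U f /\
  forall c m, conformal c -> dom c m -> U m ->
    derivable (f \o coordV c \o rV_of_complex : R[i]^o -> R[i]^o)
      (complex_of_rV (coord c m)) 1.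

Definition antiholomorphic_on (U : set M) (f : M -> R[i]) :=
  holomorphic_on U (fun m => (f m)^*).

End Surface.

Section Immersion.
Variables (R : realType) (M N : topologicalType).
Variables (X : oriented_manifold R 2 M) (Y : oriented_manifold R 3 N).
Variables (g : riemannian_metric X) (h : riemannian_metric Y).
Variable phi : M -> N.

Definition local_rep (c : chart R 2 M) (c' : chart R 3 N)
    : 'rV[R]_2 -> 'rV[R]_3 :=
  coord c' \o phi \o coordV c.

Definition dmap (c : chart R 2 M) (c' : chart R 3 N) (m : M) : 'M[R]_(2, 3) :=
  jacobian (local_rep c c') (coord c m).

Record isometric_immersion : Prop := IsometricImmersion {
  immersion_continuous : continuous phi;
  immersion_smooth : forall c c' j, atlas X c -> atlas Y c' ->
    smooth_on (coord c @` (dom c `&` phi @^-1` dom c'))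
      (fun x => local_rep c c' x 0 j);
  immersion_injective : forall c c' m, atlas X c -> atlas Y c' ->
    dom c m -> dom c' (phi m) -> row_free (dmap c c' m);
  immersion_isometric : forall c c' m, atlas X c -> atlas Y c' ->
    dom c m -> dom c' (phi m) ->
    gmx g c m = dmap c c' m *m gmx h c' (phi m) *m (dmap c c' m)^T
}.

(* [xi c' m] are the components of the normal at [m] in the chart [c'] of the
   ambient manifold. *)
Record unit_normal (xi : chart R 3 N -> M -> 'rV[R]_3) : Prop := UnitNormal {
  normal_change : forall c c' m, atlas Y c -> atlas Y c' ->
    dom c (phi m) -> dom c' (phi m) ->
    xi c' m = xi c m *m jacobian (transition c c') (coord c (phi m));
  normal_smooth : forall c' j, atlas Y c' ->
    smooth_fun X (phi @^-1` dom c') (fun m => xi c' m 0 j);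
  normal_unit : forall c' m, atlas Y c' -> dom c' (phi m) ->
    xi c' m *m gmx h c' (phi m) *m (xi c' m)^T = 1%:M;
  normal_orthogonal : forall c c' m, atlas X c -> atlas Y c' ->
    dom c m -> dom c' (phi m) ->
    dmap c c' m *m gmx h c' (phi m) *m (xi c' m)^T = 0
}.

(* Covariant derivative of a vector field along [phi] (components [xi] in the
   chart [c']) for the Levi-Civita connection of the ambient manifold. *)
Definition nabla_along (c : chart R 2 M) (c' : chart R 3 N) (v : 'rV[R]_2)
    (xi : M -> 'rV[R]_3) (m : M) : 'rV[R]_3 :=
  \row_k dchart c v (fun m' => xi m' 0 k) m
  + christoffel_term h c' (phi m) (v *m dmap c c' m) (xi m).

Definition shape_operator (xi : chart R 3 N -> M -> 'rV[R]_3)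
    (A : chart R 2 M -> M -> 'M[R]_2) :=
  forall c c' m v, atlas X c -> atlas Y c' -> dom c m -> dom c' (phi m) ->
    nabla_along c c' v (xi c') m = - (v *m A c m *m dmap c c' m).

End Immersion.

Section ShapeInvariants.
Variables (R : realType) (M : topologicalType).
Variable A : chart R 2 M -> M -> 'M[R]_2.

Definition mean_curvature (c : chart R 2 M) (m : M) : R := \tr (A c m) / 2.

Definition shape_sqnorm (c : chart R 2 M) (m : M) : R :=
  \tr (A c m *m A c m).

End ShapeInvariants.

Section Spin.
Variables (R : realType) (M : topologicalType).
Variables (X : oriented_manifold R 2 M) (g : riemannian_metric X).

(* The complex spin representation of the Clifford algebra Cl_2 on C^2:
   gam1^2 = gam2^2 = -1 and gam1 gam2 = - gam2 gam1. *)
Definition gam1 : 'M[R[i]]_2 := delta_mx 1 0 - delta_mx 0 1.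
Definition gam2 : 'M[R[i]]_2 := 'i%C *: (delta_mx 0 1 + delta_mx 1 0).
Definition omega : 'M[R[i]]_2 := gam1 *m gam2.

(* The element x + y e_1 e_2 (x^2 + y^2 = 1) of Spin(2) is encoded by the unit
   complex number s = x + iy; products correspond, and the double covering onto
   SO(2) is s |-> s^2. *)
Definition spin_rep (s : R[i]) : 'M[R[i]]_2 :=
  ((cRe s)%:C)%:M + (cIm s)%:C *: omega.

Definition rotation (u : R[i]) : 'M[R]_2 :=
  cRe u *: 1%:M + cIm u *: (delta_mx 0 1 - delta_mx 1 0).

(* A spin structure, as a Cech cocycle: an open cover [scov] with positively
   oriented orthonormal frames (the rows of [frame k c m] are the components of
   e_1, e_2 in the chart [c]), and lifts [lift k l] to Spin(2) of the SO(2)-valued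
   transition functions of these frames. *)
Record spin_structure := SpinStructure {
  sidx : Type;
  scov : sidx -> set M;
  frame : sidx -> chart R 2 M -> M -> 'M[R]_2;
  lift : sidx -> sidx -> M -> R[i];
  scov_open : forall k, open (scov k);
  scov_cover : forall m, exists k, scov k m;
  frame_change : forall k c c' m, atlas X c -> atlas X c' ->
    scov k m -> dom c m -> dom c' m ->
    frame k c' m = frame k c m *m jacobian (transition c c') (coord c m);
  frame_smooth : forall k c i j, atlas X c ->
    smooth_on (coord c @` (dom c `&` scov k))
      (fun x => frame k c (coordV c x) i j);
  frame_orthonormal : forall k c m, atlas X c -> scov k m -> dom c m ->
    frame k c m *m gmx g c m *m (frame k c m)^T = 1%:M;
  frame_oriented : forall k c m, atlas X c -> scov k m -> dom c m ->
    0 < \det (frame k c m);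
  lift_smooth : forall k l, csmooth_fun X (scov k `&` scov l) (lift k l);
  lift_unit : forall k l m, scov k m -> scov l m -> `|lift k l m| = 1;
  lift_cover : forall k l c m, atlas X c -> scov k m -> scov l m -> dom c m ->
    frame l c m = rotation (lift k l m ^+ 2) *m frame k c m;
  lift_cocycle : forall k l j m, scov k m -> scov l m -> scov j m ->
    lift k l m * lift l j m = lift k j m
}.

Variable S : spin_structure.

(* Smooth sections over [U] of the spinor bundle associated with [S] by
   [spin_rep]: [psi k] is the component in the spin frame over [scov k]. *)
Definition spinor_section (U : set M) (psi : sidx S -> M -> 'cV[R[i]]_2) :=
  (forall k a, csmooth_fun X (scov k `&` U) (fun m => psi k m a 0)) /\
  (forall k l m, scov k m -> scov l m -> U m ->
     psi k m = spin_rep (lift k l m) *m psi l m).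

Section InFrame.
Variables (k : sidx S) (c : chart R 2 M).
Implicit Types (psi : M -> 'cV[R[i]]_2) (m : M).

(* Spin connection: nabla_v psi = d psi(v) + 1/2 g(nabla_v e_1, e_2) e_1 e_2 psi *)
Definition spin_nabla (v : 'rV[R]_2) psi m : 'cV[R[i]]_2 :=
  let w := (nabla g c v (fun m' => row 0 (frame k c m')) m *m gmx g c m
              *m (row 1 (frame k c m))^T) 0 0 in
  \col_a cdchart c v (fun m' => psi m' a 0) m + (w / 2)%:C *: (omega *m psi m).

Definition dirac psi m : 'cV[R[i]]_2 :=
  gam1 *m spin_nabla (row 0 (frame k c m)) psi m
  + gam2 *m spin_nabla (row 1 (frame k c m)) psi m.

(* D + a + b omega *)
Definition dirac_plus (a b : M -> R[i]) psi m : 'cV[R[i]]_2 :=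
  dirac psi m + a m *: psi m + b m *: (omega *m psi m).

(* B_0 = D^2 + |A|^2 - H^2 *)
Definition B0 (A : chart R 2 M -> M -> 'M[R]_2) psi m : 'cV[R[i]]_2 :=
  dirac (dirac psi) m
  + (shape_sqnorm A c m - mean_curvature A c m ^+ 2)%:C *: psi m.

End InFrame.

(* B_0 = (D + a + b omega) (D + p + q omega) on sections over [U]. *)
Definition factorization (A : chart R 2 M -> M -> 'M[R]_2) (U : set M)
    (a b p q : M -> R[i]) :=
  [/\ csmooth_fun X U a, csmooth_fun X U b, csmooth_fun X U p,
      csmooth_fun X U q &
      forall psi, spinor_section U psi ->
      forall k c m, atlas X c -> scov k m -> dom c m -> U m ->
        B0 k c A (psi k) m = dirac_plus k c a b (dirac_plus k c p q (psi k)) m].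

End Spin.

(* Main.v *)
Require Import Defs.
From HB Require Import structures.
From mathcomp Require Import all_boot all_order all_algebra.
From mathcomp Require Import complex.
From mathcomp Require Import all_classical all_reals all_analysis.
From mathcomp Require Import ring lra.

Set Implicit Arguments.
Unset Strict Implicit.
Unset Printing Implicit Defensive.

Import Order.TTheory GRing.Theory Num.Theory.
Import numFieldNormedType.Exports.

Local Open Scope classical_set_scope.
Local Open Scope ring_scope.

(* Since e_1, e_2 anticommute with omega,
     (D + a + b omega)(D + p + q omega)
       = D^2 + ((a + p) + (b - q) omega) D + grad p + (grad q) omega
         + (a p - b q) + (a q + b p) omega,
   where grad acts by Clifford multiplication.  Spinors supported near a point
   with prescribed value and derivative there show that this is B_0 exactly when
   a = -p, b = q, grad p = J grad q and p^2 + q^2 = -F, F = |A|^2 - H^2; the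
   gradient equation is the Cauchy-Riemann system for p - i q and the conjugate
   of p + i q.

   If A does not vanish then F > 0, because A is self-adjoint.  Given p and q,
   the rotated gradient of log F is the closed form
   2 (p dq - q dp) / (p^2 + q^2), so log F is harmonic.  Conversely let theta be
   a conjugate of the harmonic function u = log F, which exists on a simply
   connected region by continuing local primitives along paths; then
   p = i e^(u/2) sin (theta/2), q = i e^(u/2) cos (theta/2) is a solution.

   If A = 0 then (p - i q)(p + i q) = 0 and the identity theorem applies.  Here
   conformal charts exist because the normal is locally constant in a flat chart
   of the ambient space, so projecting along it gives an isometry onto a plane. *)

(** * Differential calculus on row vectors *)

(** [D^2] stands unexpanded on both sides of the factorization and cancels, so curvature never
    enters; only coefficients of order one and zero are compared. Tensors being families of chart
    components, each equation is checked in one convenient chart or orthonormal frame and then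
    transported; the identity A^T K A = det(A) K for the quarter turn K is what makes J independent
    of the chart. The shape operator is given without smoothness, symmetry or transformation law;
    all three are extracted from the Weingarten equation. When F > 0, p and q cannot both be real,
    which explains the factor i in the explicit solution. Continuation along paths compares
    increments of local primitives, never their values, so constants of integration need no
    bookkeeping. Holomorphy is tested only in conformal charts, so the way back from a holomorphic
    function to grad p = J grad q needs such charts to exist; this occurs only in the planar case.
    Unique continuation is obtained without contour integrals: the function |F|^2 / |z - c|^(2n) is
    subharmonic, and a real maximum principle suffices. *)

Section Differentiability.
Variable R : realType.

(** The little-o characterization in epsilon form. It is the tool for exhibiting a differential by
    hand: for local inverses, for functions with continuous partial derivatives, and for the flat
    function at 0. *)
Lemma differentiable_approx (V W : normedModType R) (f : V -> W)
    (L : {linear V -> W}) (x : V) :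
  continuous L ->
  (forall e, 0 < e -> \forall h \near (0 : V),
     `|f (h + x) - f x - L h| <= e * `|h|) ->
  differentiable f x /\ 'd f x = L :> (V -> W).
Proof.
move=> cL H.
have E : f \o shift x = cst (f x) + L +o_ (0 : V) id.
  apply/eqaddoP => e e0; near=> h.
  have -> : (f \o shift x - (cst (f x) + L)) h = f (h + x) - f x - L h.
    by rewrite /= !fctE /= opprD addrA.
  by near: h; exact: H.
have dE := diff_unique cL E; split => //.
by apply/diff_locallyP; rewrite dE.
Unshelve. all: by end_near. Qed.

Lemma differentiable_approxE (V W : normedModType R) (f : V -> W) (x : V) :
  differentiable f x -> forall e, 0 < e -> \forall h \near (0 : V),
     `|f (h + x) - f x - 'd f x h| <= e * `|h|.
Proof.
move=> /diff_locallyP [_ /eqaddoP H] e e0; have := H e e0.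
apply: filterS => h; congr (`| _ | <= _).
by rewrite /= !fctE /= opprD addrA.
Qed.

Lemma near_eq_differentiable (V W : normedModType R) (f g : V -> W) (x : V) :
  (\near x, f x = g x) -> differentiable f x -> differentiable g x.
Proof.
move=> fg df; apply: (@differentiable_approx V W g ('d f x) x _ _).1.
  exact: diff_continuous.
move=> e e0; have H := differentiable_approxE df e0.
near=> h; rewrite -(nbhs_singleton fg).
have <- : f (h + x) = g (h + x).
  near: h; move: fg; rewrite (near_shift 0); apply: filterS => h /=.
  by rewrite subr0.
by near: h.
Unshelve. all: by end_near. Qed.

Lemma differentiable_rowP (V : normedModType R) n (f : V -> 'rV[R]_n) (x : V) :
  (forall j, differentiable (fun y => f y 0 j) x) -> differentiable f x.
Proof.
move=> df; have -> : f = \sum_(j < n) (fun y => f y 0 j *: delta_mx 0 j : 'rV[R]_n).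
  apply/funext => y; rewrite fct_sumE; rewrite {1}(row_sum_delta (f y)).
  by [].
by apply: differentiable_sum => j; apply: differentiableZl.
Qed.

Lemma derive_row (V : normedModType R) n (f : V -> 'rV[R]_n) (x : V) v :
  differentiable f x -> 'D_v f x = \row_j 'D_v (fun y => f y 0 j) x.
Proof.
move=> df; rewrite derive_mx; last exact: diff_derivable.
by apply/rowP => j; rewrite !mxE.
Qed.

Lemma derive_partialE n (f : 'rV[R]_n -> R) x v : differentiable f x ->
  'D_v f x = \sum_i v 0 i * partial i f x.
Proof.
move=> df; rewrite deriveE // {1}(row_sum_delta v) linear_sum.
by apply: eq_bigr => i _; rewrite linearZ /= /partial deriveE.
Qed.

Lemma derive_comp (V W U : normedModType R) (f : V -> W) (h : W -> U) x v :
  differentiable f x -> differentiable h (f x) ->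
  'D_v (h \o f) x = 'D_('D_v f x) h (f x).
Proof.
move=> df dh; have dc : differentiable (h \o f) x by exact: differentiable_comp.
by rewrite (deriveE _ dc) diff_comp // (deriveE _ df) (deriveE _ dh).
Qed.

Lemma partial_comp m n (T : 'rV[R]_m -> 'rV[R]_n) (h : 'rV[R]_n -> R) x i :
  differentiable T x -> differentiable h (T x) ->
  partial i (h \o T) x =
  \sum_j partial j h (T x) * partial i (fun y => T y 0 j) x.
Proof.
move=> dT dh; rewrite /partial derive_comp // derive_partialE //.
by apply: eq_bigr => j _; rewrite derive_row // mxE mulrC.
Qed.

Lemma jacobianE m n (T : 'rV[R]_m -> 'rV[R]_n) x i j : differentiable T x ->
  jacobian T x i j = partial i (fun y => T y 0 j) x.
Proof.
by move=> dT; rewrite /jacobian /lin1_mx mxE /partial -deriveE // derive_row // mxE.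
Qed.

Lemma jacobian_comp m n p (T : 'rV[R]_m -> 'rV[R]_n) (S : 'rV[R]_n -> 'rV[R]_p) x :
  differentiable T x -> differentiable S (T x) ->
  jacobian (S \o T) x = jacobian T x *m jacobian S (T x).
Proof.
move=> dT dS; apply/row_matrixP => i; rewrite !rowE mulmxA.
have dc : differentiable (S \o T) x by exact: differentiable_comp.
rewrite -(deriveEjacobian _ dT) -(deriveEjacobian _ dS) -(deriveEjacobian _ dc).
exact: derive_comp.
Qed.

Lemma row_jacobian m n (T : 'rV[R]_m -> 'rV[R]_n) x i : differentiable T x ->
  row i (jacobian T x) = 'D_(bvec R i) T x.
Proof. by move=> dT; rewrite rowE -deriveEjacobian. Qed.

Lemma near_eq_jacobian m n (T S : 'rV[R]_m -> 'rV[R]_n) x :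
  differentiable T x -> (\near x, T x = S x) -> jacobian T x = jacobian S x.
Proof.
move=> dT TS; have dS := near_eq_differentiable TS dT.
apply/row_matrixP => i.
apply: (etrans (row_jacobian i dT)); apply: (etrans _ (esym (row_jacobian i dS))).
exact: near_eq_derive.
Qed.

End Differentiability.

(** * Smooth functions and their closure properties *)

Section Smooth.
Variable R : realType.
Implicit Types n : nat.

Lemma smooth_on_sub n (O O' : set 'rV[R]_n) f :
  O' `<=` O -> smooth_on O f -> smooth_on O' f.
Proof. by move=> OO' sf s x /OO'; exact: sf. Qed.

Lemma smooth_onU n (O O' : set 'rV[R]_n) f :
  smooth_on O f -> smooth_on O' f -> smooth_on (O `|` O') f.
Proof. by move=> sf sf' s x []; [exact: sf|exact: sf']. Qed.

Lemma smooth_on_differentiable n (O : set 'rV[R]_n) f x :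
  smooth_on O f -> O x -> differentiable f x.
Proof. by move=> sf Ox; exact: (sf [::]). Qed.

Lemma smooth_on_partial n (O : set 'rV[R]_n) f i :
  smooth_on O f -> smooth_on O (partial i f).
Proof. by move=> sf s x Ox; rewrite -foldr_rcons; exact: sf. Qed.

Lemma smooth_on_of_partial n (O : set 'rV[R]_n) f :
  (forall x, O x -> differentiable f x) ->
  (forall i, smooth_on O (partial i f)) -> smooth_on O f.
Proof.
move=> df sf s x Ox; case/lastP: s => [|s i]; first exact: df.
by rewrite foldr_rcons; exact: sf.
Qed.

(* Coinduction: a class of differentiable functions stable, up to equality on
   the open set, under partial derivatives consists of smooth functions. *)
Lemma smooth_on_class n (O : set 'rV[R]_n) (P : ('rV[R]_n -> R) -> Prop) :
  open O ->
  (forall f x, P f -> O x -> differentiable f x) ->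
  (forall f i, P f ->
     exists2 g, P g & forall x, O x -> partial i f x = g x) ->
  forall f g, P f -> (forall x, O x -> f x = g x) -> smooth_on O g.
Proof.
move=> oO Pd Pp f g Pf fg s.
have nearO (h k : 'rV[R]_n -> R) x : O x -> (forall x, O x -> h x = k x) ->
    \near x, h x = k x.
  move=> Ox hk; near=> y; apply: hk; near: y; exact: open_nbhs_nbhs.
suff [h Ph hg] : exists2 h, P h & forall x, O x -> h x = foldr (@partial R n) g s x.
  by move=> x Ox; apply: (near_eq_differentiable (nearO _ _ x Ox hg)); exact: Pd.
elim: s => [|i s [h Ph hE]]; first by exists f.
have [k Pk kE] := Pp h i Ph; exists k => // x Ox.
by rewrite -kE //= /partial; apply: near_eq_derive; exact: nearO.
Unshelve. all: by end_near. Qed.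

Lemma smooth_on_cst n (O : set 'rV[R]_n) (a : R) : smooth_on O (fun=> a).
Proof.
move=> s x Ox; suff [b ->] : exists b, foldr (@partial R n) (fun=> a) s = cst b.
  exact: differentiable_cst.
elim: s => [|i s [b /= ->]]; first by exists a.
by exists 0; apply/funext => y; rewrite /partial derive_cst.
Qed.

(** A partial derivative of a composition is a sum of products of compositions, so stability under
    sums, products and compositions cannot be established one operation at a time. Closing under all
    three at once gives a class to which [smooth_on_class] applies. *)
Inductive smooth_expr n (O : set 'rV[R]_n) : ('rV[R]_n -> R) -> Prop :=
| smooth_expr_of f : smooth_on O f -> smooth_expr O f
| smooth_expr_add f g : smooth_expr O f -> smooth_expr O g ->
    smooth_expr O (f + g)
| smooth_expr_mul f g : smooth_expr O f -> smooth_expr O g ->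
    smooth_expr O (f * g)
| smooth_expr_comp m (O' : set 'rV[R]_m) (T : 'rV[R]_n -> 'rV[R]_m) h :
    (forall j, smooth_expr O (fun x => T x 0 j)) ->
    (forall x, O x -> O' (T x)) -> smooth_on O' h ->
    smooth_expr O (h \o T).

Lemma smooth_expr_differentiable n (O : set 'rV[R]_n) f x :
  smooth_expr O f -> O x -> differentiable f x.
Proof.
move=> + Ox; elim=> [{}f sf|{}f g _ df _ dg|{}f g _ df _ dg|m O' T h _ dT OO' sh].
- exact: smooth_on_differentiable sf Ox.
- exact: differentiableD.
- exact: differentiableM.
- apply: differentiable_comp; first exact: differentiable_rowP.
  exact: (smooth_on_differentiable sh (OO' _ Ox)).
Qed.

Lemma smooth_expr_partial n (O : set 'rV[R]_n) f i : open O ->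
  smooth_expr O f ->
  exists2 g, smooth_expr O g & forall x, O x -> partial i f x = g x.
Proof.
move=> oO; elim=> [{}f sf|{}f g|{}f g|m O' T h sT dT OO' sh].
- by exists (partial i f) => //; exact/smooth_expr_of/smooth_on_partial.
- move=> sf [f' sf' ff'] sg [g' sg' gg']; exists (f' + g').
    exact: smooth_expr_add.
  move=> x Ox; rewrite /partial deriveD; last 2 first.
    exact/diff_derivable/(smooth_expr_differentiable sf).
    exact/diff_derivable/(smooth_expr_differentiable sg).
  by rewrite [LHS](congr2 +%R (ff' x Ox) (gg' x Ox)).
- move=> sf [f' sf' ff'] sg [g' sg' gg']; exists (f * g' + g * f').
    by apply: smooth_expr_add; exact: smooth_expr_mul.
  move=> x Ox; rewrite /partial deriveM; last 2 first.
    exact/diff_derivable/(smooth_expr_differentiable sf).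
    exact/diff_derivable/(smooth_expr_differentiable sg).
  by move: (ff' x Ox) (gg' x Ox); rewrite /partial => -> ->.
(* The induction hypothesis gives a derivative for each coordinate separately; choice collects them
   into a family, needed to write the chain rule as one sum. *)
- pose T' := fun j => projT1 (cid2 (dT j)).
  have T'1 j : smooth_expr O (T' j) by rewrite /T'; case: cid2.
  have T'2 j x : O x -> partial i (fun y => T y 0 j) x = T' j x.
    by rewrite /T'; case: cid2 => ? ? /= H; exact: H.
  exists (\sum_j (partial j h \o T) * T' j).
    elim/big_rec: _ => [|j y _ sy].
      by apply: smooth_expr_of; exact: smooth_on_cst.
    apply: smooth_expr_add => //; apply: smooth_expr_mul => //.
    by apply: (smooth_expr_comp (O' := O')) => //; exact: smooth_on_partial.
  move=> x Ox; rewrite partial_comp; last 2 first.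
    by apply: differentiable_rowP => j; exact: smooth_expr_differentiable (sT j) Ox.
    exact: (smooth_on_differentiable sh (OO' _ Ox)).
  by rewrite fct_sumE; apply: eq_bigr => j _; rewrite T'2.
Qed.

End Smooth.

Section SmoothClosure.
Variable R : realType.
Implicit Types n : nat.

Lemma smooth_expr_smooth n (O : set 'rV[R]_n) f :
  open O -> smooth_expr O f -> smooth_on O f.
Proof.
move=> oO sf; apply: (smooth_on_class oO _ _ sf) => // {f sf}.
- by move=> f x sf; exact: smooth_expr_differentiable.
- by move=> f i sf; exact: smooth_expr_partial.
Qed.

Lemma eq_smooth_on n (O : set 'rV[R]_n) f g : open O ->
  (forall x, O x -> f x = g x) -> smooth_on O f -> smooth_on O g.
Proof.
move=> oO fg /smooth_expr_of sf; apply: (smooth_on_class oO _ _ sf) => //.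
- by move=> h x sh; exact: smooth_expr_differentiable.
- by move=> h i sh; exact: smooth_expr_partial.
Qed.

Lemma derive_coord n (x v : 'rV[R]_n) j :
  'D_v (fun x : 'rV[R]_n => x 0 j) x = v 0 j.
Proof.
have dx : differentiable (@id 'rV[R]_n) x by [].
by have /rowP/(_ j) := derive_row v dx; rewrite derive_id !mxE.
Qed.

Lemma partial_coord n (x : 'rV[R]_n) i j :
  partial i (fun x : 'rV[R]_n => x 0 j) x = (i == j)%:R.
Proof. by rewrite /partial derive_coord mxE eqxx eq_sym. Qed.

Lemma smooth_on_coord n (O : set 'rV[R]_n) j : smooth_on O (fun x => x 0 j).
Proof.
apply: smooth_on_of_partial => [x _|i]; first exact: differentiable_coord.
have -> : partial i (fun x : 'rV[R]_n => x 0 j) = cst ((i == j)%:R).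
  by apply/funext => x; rewrite partial_coord.
exact: smooth_on_cst.
Qed.

Section Operations.
Variables (n : nat) (O : set 'rV[R]_n).
Hypothesis oO : open O.

Lemma smooth_onD f g : smooth_on O f -> smooth_on O g ->
  smooth_on O (fun x => f x + g x).
Proof.
by move=> sf sg; apply: smooth_expr_smooth => //;
   apply: smooth_expr_add; exact: smooth_expr_of.
Qed.

Lemma smooth_onM f g : smooth_on O f -> smooth_on O g ->
  smooth_on O (fun x => f x * g x).
Proof.
by move=> sf sg; apply: smooth_expr_smooth => //;
   apply: smooth_expr_mul; exact: smooth_expr_of.
Qed.

Lemma smooth_onN f : smooth_on O f -> smooth_on O (fun x => - f x).
Proof.
move=> sf; apply: (@eq_smooth_on _ _ (fun x => -1 * f x)) => //.
  by move=> x _; rewrite mulN1r.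
by apply: smooth_onM => //; exact: smooth_on_cst.
Qed.

Lemma smooth_onB f g : smooth_on O f -> smooth_on O g ->
  smooth_on O (fun x => f x - g x).
Proof. by move=> sf sg; apply: smooth_onD => //; exact: smooth_onN. Qed.

Lemma smooth_on_sum (I : Type) (r : seq I) (P : pred I) (f : I -> 'rV[R]_n -> R) :
  (forall i, smooth_on O (f i)) ->
  smooth_on O (fun x => \sum_(i <- r | P i) f i x).
Proof.
move=> sf; elim: r => [|i r IH].
  apply: (@eq_smooth_on _ _ (fun=> 0)) (smooth_on_cst _) => // x _.
  by rewrite big_nil.
apply: (@eq_smooth_on _ _ (fun x => (if P i then f i x else 0) +
    \sum_(i <- r | P i) f i x)) => // [x _|].
  by rewrite big_cons; case: ifP; rewrite ?add0r.
apply: smooth_onD IH; case: (P i) => //; exact: smooth_on_cst.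
Qed.

Lemma smooth_on_comp m (O' : set 'rV[R]_m) (T : 'rV[R]_n -> 'rV[R]_m) h :
  (forall j, smooth_on O (fun x => T x 0 j)) ->
  (forall x, O x -> O' (T x)) -> smooth_on O' h ->
  smooth_on O (fun x => h (T x)).
Proof.
move=> sT OO' sh; apply: smooth_expr_smooth => //.
by apply: (smooth_expr_comp (O' := O')) => // j; exact: smooth_expr_of.
Qed.

(** A one-variable function is read as a function on row vectors of length 1, where
    [smooth_on_class] and [smooth_on_comp] apply. [P] is a class of functions stable under
    differentiation on [D]. *)
Lemma smooth_on_unary (P : (R -> R) -> Prop) (D : set R) (h : R -> R) f :
  open D ->
  (forall h x, P h -> D x -> derivable h x 1) ->
  (forall h, P h -> exists2 k, P k & forall x, D x -> derive1 h x = k x) ->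
  P h -> smooth_on O f -> (forall x, O x -> D (f x)) ->
  smooth_on O (fun x => h (f x)).
Proof.
move=> oD Pd Pp Ph sf OD.
pose c (y : 'rV[R]_1) := y 0 0.
have dc y : differentiable c y by exact: differentiable_coord.
have cc : continuous c by move=> y; exact: differentiable_continuous.
have oD' : open (c @^-1` D) by apply: open_comp.
have sh : smooth_on (c @^-1` D) (h \o c).
  apply: (@smooth_on_class _ _ (c @^-1` D)
    (fun k => exists2 l, P l & k = l \o c)) (h \o c) (h \o c) _ _ => //.
  - move=> _ y [l Pl ->] Dy; apply: differentiable_comp => //.
    by apply/derivable1_diffP; exact: Pd.
  - move=> _ i [l Pl ->]; have [l' Pl' ll'] := Pp l Pl.
    exists (l' \o c); first by exists l'.
    move=> y Dy; rewrite /partial derive_comp //; last first.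
      by apply/derivable1_diffP; exact: Pd.
    by rewrite /c derive_coord mxE !ord1 !eqxx -derive1E ll'.
  - by exists h.
apply: (@eq_smooth_on _ _ (fun x => (h \o c) (\row_(j < 1) f x))) => //.
  by move=> x _; rewrite /c /= mxE.
apply: smooth_on_comp sh => [j|x Ox]; last by rewrite /c /= mxE; exact: OD.
by apply: eq_smooth_on sf => // x _; rewrite mxE.
Qed.

End Operations.
End SmoothClosure.

Section ElementaryFunctions.
Variable R : realType.
Variables (n : nat) (O : set 'rV[R]_n).
Hypothesis oO : open O.

Lemma smooth_onV f : smooth_on O f -> (forall x, O x -> f x != 0) ->
  smooth_on O (fun x => (f x)^-1).
Proof.
move=> sf f0.
(* Multiples of negative powers are stable under differentiation: c x^(-m) has derivative -c m
   x^(-m-1). *)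
pose P (h : R -> R) := exists c m, h = fun x => c * x^-1 ^+ m.
have dV m (x : R) : x != 0 -> is_derive x 1 (fun x : R => x^-1 ^+ m) (- m%:R * x^-1 ^+ m.+1).
  move=> x0; have dI : is_derive x 1 (fun x : R => x^-1) (- x ^- 2).
    apply: DeriveDef; first exact: derivableV.
    by rewrite deriveV // derive_id; exact: mulr1.
  have -> : (fun x : R => x^-1 ^+ m) = (fun x : R => x^-1) ^+ m.
    by apply/funext => y; rewrite exprfctE.
  have := is_deriveX m dI; congr is_derive.
  rewrite /GRing.scale /= -exprVn; case: m => [|m]; first by rewrite !(mulr0n, mul0r, oppr0).
  by rewrite /= !exprS expr0; ring.
apply: (@smooth_on_unary _ _ _ oO P [set x | x != 0] (fun x => x^-1)) => //.
- move=> _ x [c [m ->]] /= x0; apply: derivableM => //.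
  by have := dV m x x0; case.
- move=> _ [c [m ->]]; exists (fun x => (- c * m%:R) * x^-1 ^+ m.+1); first by do 2 eexists.
  move=> x x0; have := is_deriveM (is_derive_cst c x 1) (dV m x x0) => D.
  rewrite derive1E (@derive_val _ _ _ _ _ _ _ D).
  by rewrite scaler0 addr0 /GRing.scale /= /cst; ring.
- by exists 1, 1%N; apply/funext => x; rewrite mul1r expr1.
Qed.

Lemma smooth_on_expR f : smooth_on O f -> smooth_on O (fun x => expR (f x)).
Proof.
move=> sf; apply: (@smooth_on_unary _ _ _ oO (fun h => h = expR) setT) => //.
- exact: openT.
- by move=> _ x -> _.
- by move=> _ ->; exists expR => // x _; rewrite derive1E; exact: (@derive_val _ _ _ _ _ _ _ (is_derive_expR x)).
Qed.

(** The partial derivatives are those of [f] divided by [f], already known to be smooth, so no class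
    stable under differentiation has to contain the logarithm itself. *)
Lemma smooth_on_ln f : smooth_on O f -> (forall x, O x -> 0 < f x) ->
  smooth_on O (fun x => ln (f x)).
Proof.
move=> sf f0; apply: smooth_on_of_partial => [x Ox|i].
  apply: (@differentiable_comp _ _ _ _ f (@ln R)).
    exact: smooth_on_differentiable sf Ox.
  by apply/derivable1_diffP; have [] := is_derive1_ln (f0 x Ox).
apply: (@eq_smooth_on _ _ _ (fun x => (f x)^-1 * partial i f x)) => // [x Ox|].
  have df := smooth_on_differentiable sf Ox.
  have dl := is_derive1_ln (f0 x Ox).
  have dl' : differentiable (@ln R) (f x) by apply/derivable1_diffP; case: dl.
  rewrite /partial (derive_comp (f := f) (h := @ln R)) //.
  rewrite (deriveE _ dl') -[X in 'd _ _ X]mulr1 linearZ /= -deriveE //.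
  by rewrite (@derive_val _ _ _ _ _ _ _ dl) mulrC.
apply: smooth_onM => //; last exact: smooth_on_partial.
by apply: smooth_onV => // x Ox; rewrite gt_eqF // f0.
Qed.

Lemma smooth_on_sqrt f : smooth_on O f -> (forall x, O x -> 0 < f x) ->
  smooth_on O (fun x => Num.sqrt (f x)).
Proof.
move=> sf f0; apply: (@eq_smooth_on _ _ _ (fun x => expR (2^-1 * ln (f x)))) => //.
  by move=> x Ox; rewrite -powR12_sqrt ?ltW ?f0 // /powR gt_eqF ?f0.
apply/smooth_on_expR/smooth_onM => //; first exact: smooth_on_cst.
exact: smooth_on_ln.
Qed.

Let trig (h : R -> R) := exists a b, h = fun x => a * sin x + b * cos x.

Let smooth_on_trig h f : trig h -> smooth_on O f -> smooth_on O (fun x => h (f x)).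
Proof.
move=> th sf; have dt a b (x : R) :
    is_derive x 1 (fun x => a * sin x + b * cos x) (a * cos x - b * sin x).
  apply: (is_derive_eq (is_deriveD (is_deriveM (is_derive_cst a x 1) (is_derive_sin x))
    (is_deriveM (is_derive_cst b x 1) (is_derive_cos x)))).
  by rewrite !scaler0 !addr0 /GRing.scale /= /cst; ring.
apply: (@smooth_on_unary _ _ _ oO trig setT h) => //.
- exact: openT.
- by move=> _ x [a [b ->]] _; have [] := dt a b x.
- move=> _ [a [b ->]]; exists (fun x => - b * sin x + a * cos x); first by do 2 eexists.
  move=> x _; rewrite derive1E (@derive_val _ _ _ _ _ _ _ (dt a b x)).
  by rewrite mulNr addrC.
Qed.

Lemma smooth_on_sin f : smooth_on O f -> smooth_on O (fun x => sin (f x)).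
Proof.
apply: smooth_on_trig; exists 1, 0; apply/funext => x.
by rewrite mul1r mul0r addr0.
Qed.

Lemma smooth_on_cos f : smooth_on O f -> smooth_on O (fun x => cos (f x)).
Proof.
apply: smooth_on_trig; exists 0, 1; apply/funext => x.
by rewrite mul1r mul0r add0r.
Qed.

End ElementaryFunctions.

Lemma ler_norm_coord (R : realType) n (x : 'rV[R]_n) i : `|x 0 i| <= `|x|.
Proof.
rewrite [leRHS]/Num.Def.normr/= mx_normrE.
by apply: le_trans (le_bigmax _ _ (0, i)).
Qed.

(** * Mean value theorem and continuously differentiable functions *)

Section MeanValue.
Variables (R : realType) (n : nat).
Implicit Types (x v : 'rV[R]_n) (f : 'rV[R]_n -> R).

Lemma is_derive_line f x v (t : R) : derivable f (t *: v + x) v ->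
  is_derive t 1 (fun s => f (s *: v + x)) ('D_v f (t *: v + x)).
Proof.
move=> df; have E : (fun h : R => h^-1 *: (((fun s => f (s *: v + x)) \o shift t) (h *: 1) -
    f (t *: v + x))) = (fun h => h^-1 *: ((f \o shift (t *: v + x)) (h *: v) - f (t *: v + x))).
  apply/funext => h; congr (_ *: (_ - _)).
  by rewrite /= scalerDl addrA -[h *: 1]/(h * 1) mulr1.
by apply: DeriveDef; [rewrite /derivable E|rewrite /derive E].
Qed.

Lemma mean_value_oo f x v :
  (forall t : R, t \in `[0, 1] -> derivable f (t *: v + x) v) ->
  exists2 t : R, t \in `]0, 1[ & f (v + x) - f x = 'D_v f (t *: v + x).
Proof.
move=> df.
have H (t : R) : t \in `]0, 1[ -> is_derive t 1 (fun s => f (s *: v + x)) ('D_v f (t *: v + x)).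
  by move=> t01; apply: is_derive_line; apply: df; exact: subset_itv_oo_cc.
have c : {within `[0, 1], continuous (fun s : R => f (s *: v + x))}.
  apply: derivable_within_continuous => t t01.
  by have [] := is_derive_line (df t t01).
have [t t01 E] := MVT (@ltr01 R) H c.
by exists t => //; move: E; rewrite scale1r scale0r add0r subr0 mulr1.
Qed.

Lemma mean_value f x v :
  (forall t : R, t \in `[0, 1] -> derivable f (t *: v + x) v) ->
  exists2 t : R, t \in `[0, 1] & f (v + x) - f x = 'D_v f (t *: v + x).
Proof.
by move=> /mean_value_oo[t t01 E]; exists t => //; exact: subset_itv_oo_cc.
Qed.

(** The mean value theorem on the segment from x to h + x replaces the increment by a directional
    derivative at an intermediate point, where the coefficients [a i] are close to their values at
    x. *)
Lemma differentiable_of_derive f (a : 'I_n -> 'rV[R]_n -> R) x :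
  (\forall y \near x, forall v, derivable f y v /\ 'D_v f y = \sum_i v 0 i * a i y) ->
  (forall i, {for x, continuous (a i)}) -> differentiable f x.
Proof.
move=> H ca.
pose L v := \sum_i v 0 i * a i x.
have linL : linear L.
  move=> k u w; rewrite /L scaler_sumr -big_split; apply: eq_bigr => i _.
  by rewrite !mxE mulrDl /GRing.scale /= mulrA.
pose L' := HB.pack L (GRing.isLinear.Build _ _ _ _ L linL) : {linear 'rV[R]_n -> R}.
have cL : continuous L'.
  move=> v; apply: (@differentiable_continuous _ _ _ v L).
  rewrite (_ : L = \sum_i (fun v : 'rV[R]_n => v 0 i * a i x)); last first.
    by apply/funext => w; rewrite fct_sumE.
  by apply: differentiable_sum => i; apply: differentiableM => //; exact: differentiable_coord.
apply: (@differentiable_approx _ _ _ f L' x cL _).1 => e e0.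
(* The error is a sum of n terms, each at most e' times the norm of h. Dividing by n + 1 also covers
   n = 0. *)
pose e' := e / n.+1%:R; have e'0 : 0 < e' by rewrite divr_gt0.
have Ha : \forall y \near x, forall i, `|a i y - a i x| < e'.
  near=> y; move=> i; move: i; near: y; apply: filter_forall => i; have /cvgrPdist_lt/(_ _ e'0) := ca i.
  by apply: filterS => y; rewrite distrC.
have /nbhs_ballP[r /= r0 Hr] : \forall y \near x, (forall v, derivable f y v /\
   'D_v f y = \sum_i v 0 i * a i y) /\ (forall i, `|a i y - a i x| < e').
  by near=> y; split; near: y.
apply/nbhs_ballP; exists r => //= h hb; have hr : `|h| < r by move: hb; rewrite -ball_normE /= sub0r normrN.
have B (t : R) : t \in `[0, 1] -> ball x r (t *: h + x).
  move=> t01; rewrite -ball_normE /= opprD addrC subrK normrN normrZ.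
  rewrite (le_lt_trans _ hr) // ler_piMl // ger0_norm ?(itvP t01) //.
have [t t01 E] : exists2 t : R, t \in `[0, 1] & f (h + x) - f x = 'D_h f (t *: h + x).
  by apply: mean_value => s s01; have [/(_ h) []] := Hr _ (B s s01).
have [Hd Hc] := Hr _ (B t t01).
rewrite E (Hd h).2 /= /L -sumrB.
apply: (le_trans (ler_norm_sum _ _ _)).
apply: (@le_trans _ _ (\sum_(i < n) e' * `|h|)).
  apply: ler_sum => i _; rewrite -mulrBr normrM mulrC.
  by apply: ler_pM => //; [exact/ltW/Hc|exact: ler_norm_coord].
rewrite sumr_const card_ord -mulr_natl mulrA ler_wpM2r //.
by rewrite /e' mulrCA ler_piMr ?ltW // ltr_pdivrMr // mul1r ltr_nat.
Unshelve. all: by end_near. Qed.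

End MeanValue.

(** * Symmetry of second derivatives *)

Section Schwarz.
Variables (R : realType) (n : nat).
Implicit Types (x u v : 'rV[R]_n) (f : 'rV[R]_n -> R).

Lemma derive_translate f w x v :
  'D_v (fun y => f (w + y)) x = 'D_v f (w + x) /\
  (derivable f (w + x) v -> derivable (fun y => f (w + y)) x v).
Proof.
have E : (fun h : R => h^-1 *: (((fun y => f (w + y)) \o shift x) (h *: v) - f (w + x))) =
    (fun h => h^-1 *: ((f \o shift (w + x)) (h *: v) - f (w + x))).
  by apply/funext => h; rewrite /= addrCA.
by rewrite /derive /derivable E.
Qed.

Lemma derive_dirZ f x v (a : R) : differentiable f x ->
  'D_(a *: v) f x = a * 'D_v f x.
Proof.
move=> df; rewrite !derive_partialE // big_distrr /=; apply: eq_bigr => i _.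
by rewrite mxE mulrA.
Qed.

(** One mean value step, applied to the difference of [f] and its translate by t v along t u, leaves
    a difference of two values of ['D_u f]. Both are compared with the differential of ['D_u f] at
    x, and the contributions in direction u cancel. *)
Lemma second_difference f x u v :
  (\near x, differentiable f x) -> differentiable ('D_u f) x ->
  forall e : R, 0 < e -> \forall t \near (0 : R)^'+,
    `|f (t *: u + t *: v + x) - f (t *: u + x) - f (t *: v + x) + f x
      - t ^+ 2 * 'D_v ('D_u f) x| <= e * t ^+ 2.
Proof.
move=> df dF e e0.
(* The two displacements have norms at most t(|u| + |v|) and t|u|; their sum is below t C, and the 1
   keeps C positive. *)
pose C := `|u| + `|v| + `|u| + 1.
have C0 : 0 < C by rewrite ltr_pwDr // !addr_ge0.
have /nbhs_ballP[d /= d0 Hd] := differentiable_approxE dF (divr_gt0 e0 C0).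
move/nbhs_ballP : df => [d' /= d'0 df].
near=> t.
have t0 : 0 < t by near: t; exact: nbhs_right_gt.
have small (s : R) w : 0 <= s <= 1 -> (`|w| <= `|u|) -> ball 0 (Num.min d d') (s *: (t *: w)) /\
    ball 0 (Num.min d d') (s *: (t *: w) + t *: v).
  move=> /andP[s0 s1] wu; have H : t * C < Num.min d d'.
    rewrite -ltr_pdivlMr //; near: t; apply: nbhs_right_lt.
    by rewrite divr_gt0 // lt_min d0.
  rewrite -!ball_normE /= !sub0r !normrN; split; apply: le_lt_trans H.
    rewrite !normrZ !ger0_norm ?(ltW t0) // mulrCA ler_pM2l //.
    rewrite /C -!addrA -[X in X <= _]addr0 lerD ?addr_ge0 //.
    by rewrite (le_trans _ wu) // ler_piMl.
  rewrite (le_trans (ler_normD _ _)) // !normrZ !ger0_norm ?(ltW t0) //.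
  rewrite mulrCA -mulrDr ler_pM2l // /C -addrA -[X in X <= _]addr0 lerD ?addr_ge0 //.
  by rewrite lerD // (le_trans _ wu) // ler_piMl.
have dat (y : 'rV[R]_n) : ball 0 (Num.min d d') y -> differentiable f (y + x).
  move=> yb; apply: df; move: yb; rewrite -!ball_normE /= sub0r normrN opprD addrC subrK.
  by rewrite normrN lt_min => /andP[].
have near0 (y : 'rV[R]_n) : ball 0 (Num.min d d') y ->
    `|'D_u f (y + x) - 'D_u f x - 'd ('D_u f) x y| <= e / C * `|y|.
  move=> yb; apply: Hd; move: yb; rewrite -!ball_normE /= lt_min.
  by move=> /andP[].
pose g (y : 'rV[R]_n) := f (t *: v + y) - f y.
have Dg (s : R) : s \in `[0, 1] -> derivable g (s *: (t *: u) + x) (t *: u) /\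
   'D_(t *: u) g (s *: (t *: u) + x) =
   t * ('D_u f (s *: (t *: u) + t *: v + x) - 'D_u f (s *: (t *: u) + x)).
  move=> s01; have s01' : 0 <= s <= 1 by rewrite !(itvP s01).
  have [b1 b2] := small s u s01' (lexx _).
  have d1 := dat _ b1; have d2 := dat _ b2.
  have E : t *: v + (s *: (t *: u) + x) = s *: (t *: u) + t *: v + x.
    by rewrite addrA [t *: v + _]addrC.
  rewrite -E in d2 *; have [D3 d3] := derive_translate f (t *: v) (s *: (t *: u) + x) (t *: u).
  have {}d3 := d3 (diff_derivable d2).
  have d4 : derivable f _ (t *: u) := diff_derivable d1.
  split; first exact: derivableB d3 d4.
  rewrite (deriveB d3 d4) D3 (derive_dirZ u t d2) (derive_dirZ u t d1).
  by rewrite mulrBr.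
have [s s01 Es] := @mean_value _ _ g x (t *: u) (fun s s01 => (Dg s s01).1).
have s01' : 0 <= s <= 1 by rewrite !(itvP s01).
have [b1 b2] := small s u s01' (lexx _).
have -> : f (t *: u + t *: v + x) - f (t *: u + x) - f (t *: v + x) + f x =
    g (t *: u + x) - g x.
  rewrite /g [t *: v + (_ + _)]addrA [t *: v + t *: u]addrC; ring.
rewrite Es (Dg s s01).2 expr2 -mulrA -mulrBr normrM gtr0_norm //.
rewrite [e * _]mulrCA ler_pM2l //.
have n1 := near0 _ b1; have n2 := near0 _ b2.
rewrite (deriveE v dF).
set A := 'D_u f (_ + _ + x) in n2 *; set B := 'D_u f (_ + x) in n1 *.
have -> : A - B - t * 'd ('D_u f) x v =
  (A - 'D_u f x - 'd ('D_u f) x (s *: (t *: u) + t *: v)) -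
  (B - 'D_u f x - 'd ('D_u f) x (s *: (t *: u))).
  have -> : t * 'd ('D_u f) x v = 'd ('D_u f) x (t *: v) by rewrite linearZ.
  by rewrite linearD /=; ring.
apply: (le_trans (ler_normB _ _)); apply: (le_trans (lerD n2 n1)).
rewrite -mulrDr -mulrA ler_pM2l // ler_pdivrMl // mulrC.
have -> : t * C = t * `|u| + t * `|v| + t * `|u| + t by rewrite /C !mulrDr mulr1.
rewrite -[leLHS]addr0 lerD ?(ltW t0) // lerD //.
  rewrite (le_trans (ler_normD _ _)) // !normrZ !ger0_norm ?(itvP s01) ?(ltW t0) // lerD //.
  by rewrite ler_piMl ?(itvP s01) // mulr_ge0 ?(ltW t0).
rewrite !normrZ !ger0_norm ?(itvP s01) ?(ltW t0) //.
by rewrite ler_piMl ?(itvP s01) // mulr_ge0 ?(ltW t0).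
Unshelve. all: by end_near. Qed.

(** The second difference is symmetric in u and v, and each order of differentiation is its limit
    after division by t^2. Continuity of second derivatives is not assumed. *)
Lemma derive_commute f x u v : (\near x, differentiable f x) ->
  differentiable ('D_u f) x -> differentiable ('D_v f) x ->
  'D_v ('D_u f) x = 'D_u ('D_v f) x.
Proof.
move=> df du dv; apply/eqP; rewrite -subr_eq0 -normr_eq0; apply/eqP.
apply/le_anti; rewrite normr_ge0 andbT; apply/ler_addgt0Pr => e e0; rewrite add0r.
have e20 : 0 < e / 2 by rewrite divr_gt0.
have Hu := second_difference v df du e20; have Hv := second_difference u df dv e20.
have [t [t0 [tu tv]]] := filter_ex (filterI (nbhs_right_gt (0 : R)) (filterI Hu Hv)).
rewrite /= in t0.
rewrite [t *: v + t *: u]addrC in tv.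
move: ('D_v ('D_u f) x) ('D_u ('D_v f) x) tu tv => p q.
move: (f (_ + _ + x)) (f (t *: u + x)) (f (t *: v + x)) => A B C tu tv.
have t20 : 0 < t ^+ 2 by rewrite exprn_gt0.
rewrite -(ler_pM2l t20) -[X in X * `|_|](@ger0_norm _ (t ^+ 2)) ?sqr_ge0 //.
rewrite -normrM mulrBr.
have -> : t ^+ 2 * p - t ^+ 2 * q =
    (A - C - B + f x - t ^+ 2 * q) - (A - B - C + f x - t ^+ 2 * p) by ring.
apply: (le_trans (ler_normB _ _)); apply: (le_trans (lerD tv tu)).
by rewrite -mulrDl -splitr mulrC.
Unshelve. all: by end_near. Qed.

Lemma partial_commute (O : set 'rV[R]_n) f x i j : open O -> smooth_on O f -> O x ->
  partial i (partial j f) x = partial j (partial i f) x.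
Proof.
move=> oO sf Ox; apply: derive_commute.
- by near=> y; apply: (smooth_on_differentiable sf); near: y; exact: open_nbhs_nbhs.
- exact: (smooth_on_differentiable (smooth_on_partial _ sf)).
- exact: (smooth_on_differentiable (smooth_on_partial _ sf)).
Unshelve. all: by end_near. Qed.

Lemma ball_segment (x y : 'rV[R]_n) (r t : R) : ball x r y -> t \in `[0, 1] ->
  ball x r (t *: (y - x) + x).
Proof.
rewrite -!ball_normE /= => xy t01.
rewrite opprD addrC subrK normrN normrZ (le_lt_trans _ xy) //.
by rewrite [`|x - y|]distrC ler_piMl // ger0_norm ?(itvP t01).
Qed.

Lemma derive0_ball_cst f x r : (forall y, ball x r y -> differentiable f y) ->
  (forall y i, ball x r y -> partial i f y = 0) ->
  forall y, ball x r y -> f y = f x.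
Proof.
move=> df pf y yb; apply/eqP; rewrite -subr_eq0.
have [t t01] : exists2 t : R, t \in `[0, 1] &
    f (y - x + x) - f x = 'D_(y - x) f (t *: (y - x) + x).
  apply: mean_value => t t01; apply: diff_derivable; apply: df.
  exact: ball_segment.
rewrite subrK => ->; rewrite derive_partialE; last exact/df/ball_segment.
by rewrite big1 // => i _; rewrite pf ?mulr0 //; exact: ball_segment.
Qed.

End Schwarz.

(** * The Poincare lemma *)

Section ClosedBall.
Variables (R : realType) (n : nat).
Implicit Types x y : 'rV[R]_n.

Lemma norm_row_le x (r : R) : 0 <= r -> (`|x| <= r) = [forall i, `|x 0 i| <= r].
Proof.
move=> r0; apply/idP/forallP => [xr i|xr].
  exact: le_trans (ler_norm_coord _ _) xr.
rewrite [leLHS]/Num.Def.normr/= mx_normrE; apply: bigmax_le => // -[i j] _ /=.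
by rewrite (ord1 i).
Qed.

Lemma closed_cube_compact x (r : R) : 0 <= r -> compact [set y | `|y - x| <= r].
Proof.
move=> r0; have := @rV_compact R n (fun i => `[x 0 i - r, x 0 i + r]%classic)
  (fun i => @segment_compact _ _ _).
congr compact; apply/seteqP; split => y /=.
  move=> H; rewrite norm_row_le //; apply/forallP => i.
  by have := H i; rewrite !mxE /= in_itv /= ler_distl.
rewrite norm_row_le // => /forallP H i.
by have := H i; rewrite !mxE /= in_itv /= ler_distl.
Qed.

Lemma continuous_closed_cube_bounded (f : 'rV[R]_n -> R) x (r : R) : 0 <= r ->
  (forall y, `|y - x| <= r -> {for y, continuous f}) ->
  exists C, forall y, `|y - x| <= r -> `|f y| <= C.
Proof.
move=> r0 cf.
have [||| c _ Hc] := @EVT_max_rV R n (fun y => `|f y|) [set y | `|y - x| <= r].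
- by exists x; rewrite /= subrr normr0.
- exact: closed_cube_compact.
- apply: continuous_in_subspaceT => y; rewrite inE => yr.
  by apply: continuous_comp; [exact: cf|exact: norm_continuous].
by exists `|f c| => y yr; apply: Hc; rewrite inE.
Qed.

End ClosedBall.

Lemma derive_cmul (R : realType) (V : normedModType R) (f : V -> R) (c : R) x v :
  derivable f x v -> 'D_v (fun y => c * f y) x = c * 'D_v f x.
Proof.
move=> df; have D := is_deriveM (is_derive_cst c x v) (derivableP df).
by rewrite (@derive_val _ _ _ _ _ _ _ D) scaler0 addr0.
Qed.

Section Poincare.
Variables (R : realType) (n : nat).
Local Notation mu := (@lebesgue_measure R).
Variables (x0 : 'rV[R]_n) (r : R).
Hypothesis r0 : 0 < r.
Local Notation B := (ball x0 r).
Implicit Types (x v y w : 'rV[R]_n) (f : 'rV[R]_n -> R).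

Let oB : open B. Proof. exact: ball_open. Qed.

Lemma derive_homothety f (t : R) y v :
  'D_v (fun y => f (t *: (y - x0) + x0)) y = 'D_(t *: v) f (t *: (y - x0) + x0) /\
  (derivable f (t *: (y - x0) + x0) (t *: v) ->
   derivable (fun y => f (t *: (y - x0) + x0)) y v).
Proof.
have E : (fun h : R => h^-1 *: (((fun y => f (t *: (y - x0) + x0)) \o shift y) (h *: v)
     - f (t *: (y - x0) + x0))) =
    (fun h => h^-1 *: ((f \o shift (t *: (y - x0) + x0)) (h *: (t *: v))
     - f (t *: (y - x0) + x0))).
  apply/funext => h; congr (_ *: (f _ - _)); rewrite /=.
  by rewrite -[h *: v + y - x0]addrA scalerDr !scalerA [t * h]mulrC addrA.
by rewrite /derive /derivable E.
Qed.

Variable a : 'I_n -> 'rV[R]_n -> R.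
Hypothesis sa : forall i, smooth_on B (a i).
Hypothesis closed_a : forall i j x, B x -> partial i (a j) x = partial j (a i) x.

Let da i y : B y -> differentiable (a i) y.
Proof. exact: smooth_on_differentiable. Qed.

Let b v y := \sum_i v 0 i * a i y.

Let sb v : smooth_on B (b v).
Proof.
by apply: smooth_on_sum => // i; apply: smooth_onM => //; exact: smooth_on_cst.
Qed.

Let db v y : B y -> differentiable (b v) y.
Proof. exact: smooth_on_differentiable. Qed.

Let derive_b v w y : B y -> 'D_w (b v) y = \sum_i v 0 i * 'D_w (a i) y.
Proof.
move=> By; rewrite derive_partialE; last exact: db.
transitivity (\sum_j \sum_i w 0 j * (v 0 i * partial j (a i) y)); last first.
  rewrite exchange_big /=; apply: eq_bigr => i _.
  rewrite (derive_partialE _ (da i By)) big_distrr /=; apply: eq_bigr => j _; ring.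
apply: eq_bigr => j _; rewrite -big_distrr /=; congr (_ * _).
rewrite /partial (_ : b v = \sum_i (fun y => v 0 i * a i y)); last first.
  by apply/funext => z; rewrite fct_sumE.
rewrite derive_sum => [|i]; last first.
  by apply: derivableM; [exact: derivable_cst|exact/diff_derivable/da].
by apply: eq_bigr => i _; rewrite derive_cmul //; exact/diff_derivable/da.
Qed.

Let derive_bC v w y : B y -> 'D_w (b v) y = 'D_v (b w) y.
Proof.
move=> By; rewrite !derive_b //.
under eq_bigr do rewrite (derive_partialE _ (da _ By)) big_distrr.
under [RHS]eq_bigr do rewrite (derive_partialE _ (da _ By)) big_distrr.
rewrite exchange_big /=; apply: eq_bigr => i _; apply: eq_bigr => j _.
by rewrite closed_a //; ring.
Qed.

(** Integrand of the radial primitive: the 1-form at the point x0 + t(y - x0), evaluated on y -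
    x0. *)
Let g (t : R) y := b (y - x0) (t *: (y - x0) + x0).

Let derive_g (t : R) y v : B (t *: (y - x0) + x0) ->
  is_derive y v (g t) (b v (t *: (y - x0) + x0)
     + t * 'D_(y - x0) (b v) (t *: (y - x0) + x0)).
Proof.
set p := t *: _ + _ => Bp.
have E : g t = \sum_i (fun y => (y - x0) 0 i) * (fun y => a i (t *: (y - x0) + x0)).
  by apply/funext => z; rewrite fct_sumE.
have D i : is_derive y v ((fun y => (y - x0) 0 i) * (fun y => a i (t *: (y - x0) + x0)))
    ((y - x0) 0 i * (t * 'D_v (a i) p) + a i p * v 0 i).
  have [D1 D2] := derive_homothety (a i) t y v.
  have D3 : is_derive y v (fun y => a i (t *: (y - x0) + x0)) (t * 'D_v (a i) p).
    apply: DeriveDef; first by apply: D2; exact/diff_derivable/da.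
    by rewrite D1 derive_dirZ //; exact: da.
  have D4 : is_derive y v (fun y => (y - x0) 0 i) (v 0 i).
    rewrite (_ : (fun y => (y - x0) 0 i) = (fun y => y 0 i) - cst (x0 0 i)); last first.
      by apply/funext => z; rewrite !fctE !mxE.
    rewrite -[v 0 i]subr0; apply: is_deriveB.
    by apply: DeriveDef; [exact/diff_derivable/differentiable_coord|exact: derive_coord].
  exact: is_deriveM.
rewrite E; apply: is_derive_eq.
(* Closedness of the form enters here: it exchanges the direction v with the radial direction y -
   x0. *)
rewrite derive_bC // derive_b // /b big_distrr -big_split /=; apply: eq_bigr => i _.
by rewrite /GRing.scale /=; ring.
Qed.

Let primitive y := (\int[mu]_(t in `[0%R, 1%R]) g t y)%R.

Let itv01 (t : R) : t \in `[0, 1] -> `|t| <= 1.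
Proof. by move=> t01; rewrite ger0_norm ?(itvP t01). Qed.

Let Bt01 (t : R) y : t \in `[0, 1] -> B y -> B (t *: (y - x0) + x0).
Proof. by move=> t01 By; exact: ball_segment. Qed.

(** Differentiation under the integral sign. On a smaller closed cube the coefficients and their
    partial derivatives are bounded, which provides a constant dominating function. *)
Let derive_primitive y v : B y ->
  derivable primitive y v /\ 'D_v primitive y = b v y.
Proof.
move=> By; have yr : `|y - x0| < r by move: By; rewrite -ball_normE /= distrC.
(* The radius s lies halfway between |y - x0| and r. The bound e on the increment h, fixed below,
   keeps y + h v in the closed cube of radius s, hence inside the ball. *)
pose s := (r + `|y - x0|) / 2.
have sr : s < r by rewrite /s ltr_pdivrMr // mulr2n mulrDr mulr1 ltrD2l.
have ys : `|y - x0| < s by rewrite /s ltr_pdivlMr // mulr2n mulrDr mulr1 ltrD2r.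
have s0 : 0 < s by rewrite /s divr_gt0 // ltr_wpDr.
pose e := (s - `|y - x0|) / (`|v| + 1).
have v0 : 0 < `|v| + 1 by rewrite ltr_wpDl.
have e0 : 0 < e by rewrite divr_gt0 // subr_gt0.
have ball_s h : (h : R) \in `]- e, e[ -> `|h *: v + y - x0| <= s.
  rewrite in_itv /= -ltr_norml => he; rewrite -addrA (le_trans (ler_normD _ _)) //.
  rewrite -lerBrDr normrZ; apply: (@le_trans _ _ (e * (`|v| + 1))).
    by rewrite ler_pM ?(ltW he) // lerDl.
  by rewrite /e divfK // gt_eqF.
have B_s z : `|z - x0| <= s -> B z.
  by move=> zs; rewrite -ball_normE /= distrC (le_lt_trans zs).
have [C HC] : exists C, forall z, `|z - x0| <= s -> forall i,
    (`|a i z| <= C) /\ (forall j, `|partial j (a i) z| <= C).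
  have b1 i := continuous_closed_cube_bounded (ltW s0) (fun z zs =>
    differentiable_continuous (da i (B_s z zs))).
  have b2 ij := continuous_closed_cube_bounded (ltW s0) (fun z zs =>
    differentiable_continuous (smooth_on_differentiable (smooth_on_partial ij.1 (sa ij.2)) (B_s z zs))).
  pose C1 := \sum_i `|projT1 (cid (b1 i))|.
  pose C2 := \sum_ij `|projT1 (cid (b2 ij))|.
  have C10 : 0 <= C1 by apply: sumr_ge0.
  have C20 : 0 <= C2 by apply: sumr_ge0.
  exists (C1 + C2) => z zs i; split => [|j].
    apply: (@le_trans _ _ C1); last by rewrite lerDl.
    rewrite /C1 (bigD1 i) //=; case: (cid (b1 i)) => c /= Hc.
    rewrite (le_trans (Hc z zs)) // (le_trans (ler_norm _)) // lerDl; exact: sumr_ge0.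
  apply: (@le_trans _ _ C2); last by rewrite lerDr.
  rewrite /C2 (bigD1 (j, i)) //=; case: (cid (b2 (j, i))) => c /= Hc.
  rewrite (le_trans (Hc z zs)) // (le_trans (ler_norm _)) // lerDl; exact: sumr_ge0.
pose f (h t : R) := g t (h *: v + y).
pose f' (h t : R) := let z := h *: v + y in
  b v (t *: (z - x0) + x0) + t * 'D_(z - x0) (b v) (t *: (z - x0) + x0).
have df h t : h \in `]- e, e[ -> t \in `[0, 1] -> is_derive h 1 (f ^~ t) (f' h t).
  move=> he t01; have BB := Bt01 t01 (B_s _ (ball_s h he)).
  have [D1 D2] := derive_g v BB.
  by rewrite /f' -D2; exact: is_derive_line.
pose K := n%:R * (`|v| * `|C|) + n%:R * (`|v| * (n%:R * (s * `|C|))).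
have f'K h t : h \in `]- e, e[ -> t \in `[0, 1] -> `|f' h t| <= K.
  move=> he t01; have hs := ball_s h he.
  have Bs := B_s _ hs; have BB := Bt01 t01 Bs.
  have ts : `|t *: (h *: v + y - x0) + x0 - x0| <= s.
    by rewrite addrK normrZ (le_trans _ hs) // ler_piMl // itv01.
  have sum_le (F : 'I_n -> R) c : (forall i, `|F i| <= c) -> `|\sum_i F i| <= n%:R * c.
    move=> Fc; apply: (le_trans (ler_norm_sum _ _ _)).
    apply: (@le_trans _ _ (\sum_(i < n) c)); first exact: ler_sum.
    by rewrite sumr_const card_ord mulr_natl.
  rewrite /f' /K (le_trans (ler_normD _ _)) // lerD //.
    apply: (sum_le) => i; rewrite normrM ler_pM // ?ler_norm_coord //.
    by rewrite (le_trans _ (ler_norm _)) //; have [] := HC _ ts i.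
  rewrite normrM (@le_trans _ _ `|'D_(h *: v + y - x0) (b v) (t *: (h *: v + y - x0) + x0)|) //.
    by rewrite ler_piMl // itv01.
  rewrite derive_b //; apply: (sum_le) => i; rewrite normrM ler_pM // ?ler_norm_coord //.
  rewrite (derive_partialE _ (da i BB)); apply: (sum_le) => j; rewrite normrM ler_pM //.
    by rewrite (le_trans (ler_norm_coord _ _)).
  by rewrite (le_trans _ (ler_norm _)) //; have [_] := HC _ ts i.
have line_cont z (h : 'rV[R]_n -> R) : B z -> (forall u, B u -> differentiable h u) ->
    forall t : R, t \in `[0, 1] -> is_derive t 1 (fun t => h (t *: (z - x0) + x0))
       ('D_(z - x0) h (t *: (z - x0) + x0)).
  by move=> Bz dh t t01; apply: is_derive_line; apply/diff_derivable/dh/Bt01.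
have intf h : h \in `]- e, e[ -> mu.-integrable `[0, 1] (EFin \o f h).
  move=> he; have Bz := B_s _ (ball_s h he).
  apply: continuous_compact_integrable; first exact: segment_compact.
  apply: derivable_within_continuous => t t01.
  by have [] := line_cont _ (b (h *: v + y - x0)) Bz (fun u => @db _ u) t t01.
have I0 : [set` `]- e, e[%R] (0 : R) by rewrite /= in_itv /= oppr_lt0 e0.
have df1 h t : [set` `]- e, e[%R] h -> `[0, 1]%classic t -> derivable (f ^~ t) h 1.
  by move=> he t01; have [] := df h t he t01.
have f'E h t : h \in `]- e, e[ -> t \in `[0, 1] -> partial1of2 f h t = f' h t.
  by move=> he t01; rewrite partial1of2E (@derive_val _ _ _ _ _ _ _ (df h t he t01)).
have intK : mu.-integrable `[0, 1] (EFin \o cst `|K|).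
  by apply: continuous_compact_integrable; [exact: segment_compact|
    apply: continuous_subspaceT => ?; exact: cst_continuous].
have f'K' h t : [set` `]- e, e[%R] h -> `[0, 1]%classic t ->
    `|partial1of2 f h t| <= cst `|K| t.
  by move=> he t01; rewrite f'E // (le_trans (f'K _ _ he t01)) // ler_norm.
have D := @cvg_differentiation_under_integral R _ _ mu f `[0, 1] (measurable_itv _)
  0 (- e) e I0 (fun h he => intf h he) df1 (cst `|K|) (fun=> normr_ge0 K) intK f'K'.
have FE : (\int[mu]_(t in `[0%R, 1%R]) partial1of2 f 0 t)%R = b v y.
  transitivity (\int[mu]_(t in `[0%R, 1%R]) f' 0 t)%R.
    by apply: eq_Rintegral => t; rewrite inE => t01; rewrite f'E.
  rewrite /Rintegral.
  (* At h = 0 the differentiated integrand is the t-derivative of [F], whose values at 0 and 1 are 0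
     and [b v y]. *)
  pose F (t : R) := t * b v (t *: (y - x0) + x0).
  have dF (t : R) : t \in `[0, 1] -> is_derive t 1 F (f' 0 t).
    move=> t01; have L := line_cont _ (b v) By (fun u => @db v u) t t01.
    apply: (is_derive_eq (is_deriveM (is_derive_id t 1) L)).
    rewrite /f' scale0r add0r /GRing.scale /= mulr1 addrC; congr (_ + _).
  rewrite (@continuous_FTC2 _ (f' 0) F 0 1) //.
  - by rewrite -EFinB /= /F scale1r subrK mul1r mul0r subr0.
  - apply: derivable_within_continuous => t t01.
    rewrite /f' scale0r add0r; apply: derivableD.
      by have [] := line_cont _ (b v) By (fun u => @db v u) t t01.
    apply: derivableM => //.
    have sD : forall u, B u -> differentiable ('D_(y - x0) (b v)) u.
      move=> u Bu; apply: (@near_eq_differentiable _ _ _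
         (\sum_i (fun u => (y - x0) 0 i * partial i (b v) u))).
        near=> z; rewrite fct_sumE derive_partialE //; apply: db; near: z.
        exact: open_nbhs_nbhs.
      apply: differentiable_sum => i; apply: differentiableM => //.
      exact: (smooth_on_differentiable (smooth_on_partial i (sb v))).
    by have [] := line_cont _ _ By sD t t01.
  - have cF (t : R) : t \in `[0, 1] -> {for t, continuous F}.
      by move=> t01; apply: differentiable_continuous; apply/derivable1_diffP; have [] := dF t t01.
    split.
    + by move=> t t01; have [] := dF t (subset_itv_oo_cc t01).
    + apply: cvg_at_right_filter; apply: cF; by rewrite in_itv /= lexx ler01.
    + apply: cvg_at_left_filter; apply: cF; by rewrite in_itv /= lexx ler01.
  - move=> t t01; rewrite derive1E.
    exact: (@derive_val _ _ _ _ _ _ _ (dF t (subset_itv_oo_cc t01))).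
rewrite FE in D.
have {}D : (fun h : R => h^-1 *: (primitive (h *: v + y) - primitive y)) @ 0^' --> b v y.
  apply: cvg_trans D; apply: near_eq_cvg; near=> h.
  by rewrite /f addr0 scale0r add0r.
split; first by apply/cvg_ex; exists (b v y).
exact: cvg_lim.
Unshelve. all: by end_near. Qed.

Lemma poincare : exists2 th : 'rV[R]_n -> R, smooth_on B th &
  forall i x, B x -> partial i th x = a i x.
Proof.
have pE i x : B x -> partial i primitive x = a i x.
  move=> Bx; rewrite /partial (derive_primitive _ Bx).2 /b (bigD1 i) //= mxE !eqxx mul1r.
  by rewrite big1 ?addr0 // => j ji; rewrite mxE (negbTE ji) andbF mul0r.
exists primitive => //; apply: smooth_on_of_partial => [x Bx|i].
  apply: (@differentiable_of_derive _ _ _ a).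
    near=> y => v; apply: derive_primitive; near: y; exact: open_nbhs_nbhs.
  by move=> i; apply: differentiable_continuous; exact: da.
by apply: eq_smooth_on (sa i) => // x Bx; rewrite pE.
Unshelve. all: by end_near. Qed.

End Poincare.

(** * Monodromy on simply connected sets *)

Section Within.
Variables (T U : topologicalType).
Implicit Types (A : set T) (f : T -> U).

(** Continuity of a restriction expressed with neighbourhoods of the ambient space, so that gluing
    and composing do not pass through subspace topologies. *)
Definition cont_on A f := forall x, A x -> forall V, nbhs (f x) V ->
  \forall y \near x, A y -> V (f y).

Lemma cont_onP A f : {within A, continuous f} <-> cont_on A f.
Proof.
rewrite continuous_subspace_in; split => [cf x Ax V fV|cf x /[!inE] Ax V fV].
  have /cf : x \in A by rewrite inE.
  by move=> /(_ V fV); rewrite /= /nbhs /= -nbhs_subspace_in.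
by rewrite /= /nbhs /= -nbhs_subspace_in //; exact: cf.
Qed.

Lemma continuous_cont_on A f : continuous f -> cont_on A f.
Proof. by move=> cf x _ V /cf fV; near=> y => _; near: y. Unshelve. all: by end_near. Qed.

(** The truth value of [P] is locally constant along [A], so the part of [A] where it holds is both
    open and closed in [A]. *)
Lemma connected_near_ind A (P : set T) x : connected A -> A x -> P x ->
  (forall y, A y -> \forall z \near y, A z -> (P y <-> P z)) ->
  forall y, A y -> P y.
Proof.
move=> cA Ax Px H y Ay.
suff : A `&` P = A by move=> E; move: Ay; rewrite -E => -[].
apply: cA; first by exists x.
- exists (interior [set z | A z -> P z]); first exact: open_interior.
  apply/seteqP; split => z [Az].
    move=> Pz; split => //; rewrite /interior /=; apply: filterS (H z Az) => w Hw /Hw <- //.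
  by move=> /interior_subset Hz; split => //; exact: Hz.
- exists (~` interior [set z | A z -> ~ P z]); first by apply: open_closedC; exact: open_interior.
  apply/seteqP; split => z [Az].
    by move=> Pz; split => // /interior_subset /(_ Az).
  move=> nz; split => //; apply: contrapT => nPz; apply: nz; rewrite /interior /=.
  by apply: filterS (H z Az) => w Hw /Hw PP /PP.
Qed.

End Within.

Lemma cont_on_comp (T U V : topologicalType) (A : set T) (B : set U)
    (f : T -> U) (g : U -> V) :
  cont_on A f -> (forall x, A x -> B (f x)) -> cont_on B g -> cont_on A (g \o f).
Proof.
move=> cf AB cg x Ax W gW; have := cf x Ax _ (cg _ (AB x Ax) W gW).
by apply: filterS => y Hy Ay; apply: Hy => //; exact: AB.
Qed.

(** Replaces a subdivision by a Lebesgue number. The set of t such that [P a s] for every s in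
    [a, t] is open and closed in [a, b]: near any t it can be extended by one short interval. *)
Lemma interval_ind (R : realType) (a b : R) (P : R -> R -> Prop) : a <= b ->
  (forall x y z, a <= x -> x <= y -> y <= z -> z <= b -> P x y -> P y z -> P x z) ->
  (forall t, a <= t <= b -> exists2 e, 0 < e & forall x y, a <= x -> x <= y -> y <= b ->
     `|x - t| < e -> `|y - t| < e -> P x y) ->
  P a b.
Proof.
move=> ab Padd Ploc.
pose S t := forall s, a <= s <= t -> P a s.
suff : S b by apply; rewrite ab lexx.
have aI : `[a, b]%classic a by rewrite /= in_itv /= lexx ab.
have bI : `[a, b]%classic b by rewrite /= in_itv /= lexx ab.
apply: (connected_near_ind (P := S) (@segment_connected _ a b) aI _ _ bI).
  move=> s /andP[sa as_]; have {as_ sa}-> : s = a by apply/le_anti; rewrite sa as_.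
  have [|e e0 He] := Ploc a; first by rewrite lexx ab.
  by apply: He; rewrite // subrr normr0.
move=> t /=; rewrite in_itv /= => atb; have [e e0 He] := Ploc t atb.
move/andP : atb => [at_ tb].
near=> u; rewrite in_itv /= => /andP[au ub].
have ut : `|u - t| < e by near: u; exists e => //= u /=; rewrite distrC.
have ext (p q : R) : a <= p -> p <= q -> q <= b -> `|p - t| < e -> `|q - t| < e ->
    S p -> S q.
  move=> ap pq qb pt qt Sp s /andP[as_ sq].
  have [sp|ps] := leP s p; first by apply: Sp; rewrite as_ sp.
  apply: (Padd a p s) => //; [exact: ltW|exact: le_trans qb|by apply: Sp; rewrite ap lexx|].
  apply: He => //; [exact: ltW|exact: le_trans qb|].
  rewrite ltr_norml; move: pt qt; rewrite !ltr_norml => /andP[p1 p2] /andP[q1 q2].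
  by apply/andP; split; [apply: lt_le_trans p1 _; rewrite lerD2r ltW|
    apply: le_lt_trans q2; rewrite lerD2r].
have res (p q : R) : p <= q -> S q -> S p.
  by move=> pq Sq s /andP[as_ sp]; apply: Sq; rewrite as_ (le_trans sp).
have tt : `|t - t| < e by rewrite subrr normr0.
by split; case: (leP t u) => [tu|/ltW tu]; do ?[exact: ext|exact: res].
Unshelve. all: by end_near. Qed.

Lemma setXUr (T1 T2 : Type) (A : set T1) (B C : set T2) :
  A `*` (B `|` C) = (A `*` B) `|` (A `*` C).
Proof.
apply/seteqP; split => -[x y] /=; first by case=> Ax [?|?]; [left|right].
by case=> -[Ax ?]; split => //; [left|right].
Qed.

Lemma setXUl (T1 T2 : Type) (A B : set T1) (C : set T2) :
  (A `|` B) `*` C = (A `*` C) `|` (B `*` C).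
Proof.
apply/seteqP; split => -[x y] /=; first by case=> -[?|?] Cy; [left|right].
by case=> -[? Cy]; split => //; [left|right].
Qed.

Section Monodromy.
Variables (R : realType) (M : topologicalType) (U : set M).
Variable prim : set M -> (M -> R) -> Prop.
Hypothesis prim_open : forall V th, prim V th -> open V /\ V `<=` U.
Hypothesis prim_ex : forall m, U m -> exists V th, prim V th /\ V m.
Hypothesis prim_rigid : forall V th V' th' m, prim V th -> prim V' th' ->
  V m -> V' m -> \forall m' \near m, th m' - th m = th' m' - th' m.
Hypothesis prim_path : forall V th m, prim V th -> V m ->
  \forall m' \near m, exists u : R -> M, [/\ path_in V u, u 0 = m & u 1 = m'].

Section Lift.
Variable T : topologicalType.
Implicit Types (Q : set T) (F : T -> M) (G : T -> R).

(** Continuation of primitives along [F]. The predicate [prim V th] abstracts the fact that [th] is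
    a local primitive on [V], and only increments are compared, so adding a constant to [G] changes
    nothing. *)
Definition lifting Q F G := forall z, Q z -> forall V th, prim V th -> V (F z) ->
  \forall z' \near z, Q z' -> G z' - G z = th (F z') - th (F z).

Lemma lifting_prim Q F V th : prim V th -> cont_on Q F ->
  (forall z, Q z -> V (F z)) -> lifting Q F (th \o F).
Proof.
move=> pV cF QV z Qz V' th' pV' V'z.
exact: cF z Qz _ (prim_rigid pV pV' (QV z Qz) V'z).
Qed.

Lemma lifting_shift Q F G c : lifting Q F G -> lifting Q F (fun z => G z + c).
Proof.
move=> lG z Qz V th pV Vz; apply: filterS (lG z Qz V th pV Vz) => z' H /H <-.
by rewrite opprD addrACA subrr addr0.
Qed.

Lemma eq_lifting Q F G F' G' : (forall z, Q z -> F z = F' z) ->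
  (forall z, Q z -> G z = G' z) -> lifting Q F G -> lifting Q F' G'.
Proof.
move=> FF GG lG z Qz V th pV; rewrite -(FF z Qz) => Vz.
by apply: filterS (lG z Qz V th pV Vz) => z' H Qz'; rewrite -!GG // -!FF // H.
Qed.

(** Around each point both liftings have the increments of the same local primitive, so their
    difference is locally constant on a connected set. *)
Lemma lifting_unique Q F G G' z0 : connected Q -> cont_on Q F ->
  (forall z, Q z -> U (F z)) -> lifting Q F G -> lifting Q F G' ->
  Q z0 -> G z0 = G' z0 -> forall z, Q z -> G z = G' z.
Proof.
move=> cQ cF QU lG lG' Qz0 GG z Qz; apply/eqP; rewrite -subr_eq0; apply/eqP.
apply: (connected_near_ind (P := fun z => G z - G' z = 0) cQ Qz0) => //.
  by rewrite GG subrr.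
move=> y Qy; have [V [th [pV Vy]]] := prim_ex (QU y Qy).
near=> z'; move=> Qz'.
have H1 : G z' - G y = th (F z') - th (F y).
  by move: Qz'; near: z'; exact: (lG y Qy V th pV Vy).
have H2 : G' z' - G' y = th (F z') - th (F y).
  by move: Qz'; near: z'; exact: (lG' y Qy V th pV Vy).
have -> : G z' - G' z' = G y - G' y by apply/eqP; rewrite -subr_eq0; apply/eqP; lra.
by [].
Unshelve. all: by end_near. Qed.

(** Closedness serves at the points of one set lying outside the other: they have a neighbourhood
    that avoids the latter, so its condition is void there. *)
Lemma liftingU Q Q' F G : closed Q -> closed Q' -> lifting Q F G ->
  lifting Q' F G -> lifting (Q `|` Q') F G.
Proof.
move=> cQ cQ' lG lG' z _ V th pV Vz.
have out P : closed P -> ~ P z -> \forall z' \near z, ~ P z'.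
  move=> cP nPz; have : open (~` P) by exact: closed_openC.
  by rewrite openE => /(_ z nPz).
have in_ P : closed P -> lifting P F G ->
    \forall z' \near z, P z' -> G z' - G z = th (F z') - th (F z).
  move=> cP lP; have [Pz|nPz] := pselect (P z); first exact: (lP z Pz V th pV Vz).
  by apply: filterS (out P cP nPz) => z' nP /nP.
near=> z'; case; first by near: z'; exact: in_.
by near: z'; exact: in_.
Unshelve. all: by end_near. Qed.

(** Shift [G'] so that it meets [G] at one common point; uniqueness on the connected intersection
    makes the two agree on the whole overlap. *)
Lemma lifting_glue Q Q' F G G' : closed Q -> closed Q' ->
  connected (Q `&` Q') -> Q `&` Q' !=set0 -> cont_on (Q `&` Q') F ->
  (forall z, Q z -> U (F z)) ->
  lifting Q F G -> lifting Q' F G' -> exists G, lifting (Q `|` Q') F G.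
Proof.
move=> cQ cQ' cQQ [z0 Qz0] cF QU lG lG'.
pose G2 z := G' z + (G z0 - G' z0); have lG2 := lifting_shift (G z0 - G' z0) lG'.
have sub P P' F0 G0 : P `<=` P' -> lifting P' F0 G0 -> lifting P F0 G0.
  move=> PP l z Pz V th pV Vz; apply: filterS (l z (PP _ Pz) V th pV Vz) => z' H Pz'.
  exact/H/PP.
have E z : (Q `&` Q') z -> G z = G2 z.
  apply: (lifting_unique cQQ cF _ _ _ Qz0) => //.
  - by move=> y [] /QU.
  - exact: sub lG.
  - exact: sub lG2.
  - by rewrite /G2 addrC subrK.
exists (fun z => if pselect (Q z) then G z else G2 z); apply: liftingU => //.
  by apply: eq_lifting lG => // z Qz; case: pselect.
by apply: eq_lifting lG2 => // z Qz; case: pselect => // Qz'; exact/esym/E.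
Qed.

End Lift.

Lemma lifting_comp (T T' : topologicalType) (Q : set T) (Q' : set T') F G s :
  cont_on Q' s -> (forall z, Q' z -> Q (s z)) -> lifting Q F G ->
  lifting Q' (F \o s) (G \o s).
Proof.
move=> cs QQ lG z Qz V th pV Vz.
have := cs z Qz _ (lG _ (QQ z Qz) V th pV Vz).
by apply: filterS => z' H Qz'; apply: H => //; exact: QQ.
Qed.

Local Notation I := (`[0, 1]%classic : set R).
Implicit Types a b c d x y s t : R.

Let rect a b c d : set (R * R) := `[a, b]%classic `*` `[c, d]%classic.

Let closed_rect a b c d : closed (rect a b c d).
Proof.
rewrite /rect (_ : _ `*` _ = fst @^-1` `[a, b]%classic `&` snd @^-1` `[c, d]%classic) //.
apply: closedI; apply: preimage_closed => //; try exact: itv_closed.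
  by move=> x _; exact: cvg_fst.
by move=> x _; exact: cvg_snd.
Qed.

Let connected_vedge a c d : connected ([set a] `*` `[c, d]%classic).
Proof.
rewrite (_ : _ `*` _ = (fun t => (a, t)) @` `[c, d]%classic); last first.
  apply/seteqP; split => [[x y] /= [-> ycd]|[x y] [t tcd [<- <-]]] //; by exists y.
apply: connected_continuous_connected; first exact: segment_connected.
apply: continuous_subspaceT => t; exact: (cvg_pair (cvg_cst a) cvg_id).
Qed.

Let connected_hedge a b c : connected (`[a, b]%classic `*` [set c]).
Proof.
rewrite (_ : _ `*` _ = (fun t => (t, c)) @` `[a, b]%classic); last first.
  by apply/seteqP; split => [[x y] /= [xab ->]|[x y] [t tcd [<- <-]]] //; exists x.
apply: connected_continuous_connected; first exact: segment_connected.
apply: continuous_subspaceT => t; exact: (cvg_pair cvg_id (cvg_cst c)).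
Qed.

Lemma itvU x y (z : R) : x <= y -> y <= z ->
  `[x, z]%classic = `[x, y]%classic `|` `[y, z]%classic.
Proof.
move=> xy yz; apply/seteqP; split => t /=; rewrite !in_itv /=.
  by move=> /andP[xt tz]; case: (leP t y) => [ty|/ltW ty]; [left|right]; rewrite ?xt ?tz ?ty.
by case=> /andP[p q]; rewrite ?p ?q ?(le_trans q) ?(le_trans _ p).
Qed.

Lemma itvI x y (z : R) : x <= y -> y <= z ->
  `[x, y]%classic `&` `[y, z]%classic = [set y].
Proof.
move=> xy yz; apply/seteqP; split => t /=; rewrite !in_itv /=.
  by move=> [/andP[_ ty] /andP[yt _]]; apply/le_anti; rewrite ty yt.
by move=> ->; rewrite xy yz !lexx.
Qed.

Section Square.
Variable F : R * R -> M.
Hypothesis cF : cont_on (I `*` I) F.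
Hypothesis FU : forall z, (I `*` I) z -> U (F z).

Lemma cont_on_sub (T T' : topologicalType) (A B : set T) (f : T -> T') :
  A `<=` B -> cont_on B f -> cont_on A f.
Proof.
move=> AB cf x Ax V fV; apply: filterS (cf x (AB _ Ax) V fV) => y H /AB; exact: H.
Qed.

Let liftable a b c d := exists G, lifting (rect a b c d) F G.

Let rect_sub a b c d : 0 <= a -> b <= 1 -> 0 <= c -> d <= 1 ->
  rect a b c d `<=` I `*` I.
Proof.
move=> a0 b1 c0 d1 [x y] [/=]; rewrite !in_itv /= => /andP[ax xb] /andP[cy yd].
by rewrite !(le_trans _ ax) ?(le_trans xb) ?(le_trans _ cy) ?(le_trans yd).
Qed.

(** A tube argument: [interval_ind] in the second coordinate, on the statement that some width
    works. Gluing two rectangles takes the smaller of the two widths. *)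
Let liftable_strip s : 0 <= s <= 1 -> exists2 e, 0 < e &
  forall x y, 0 <= x -> x <= y -> y <= 1 -> `|x - s| < e -> `|y - s| < e ->
  liftable x y 0 1.
Proof.
move=> s01.
pose P c d := exists2 e, 0 < e & forall x y, 0 <= x -> x <= y -> y <= 1 ->
  `|x - s| < e -> `|y - s| < e -> liftable x y c d.
apply: (@interval_ind R 0 1 P) => //.
  move=> c d f c0 cd df f1 [e1 e10 H1] [e2 e20 H2].
  exists (Num.min e1 e2) => [|x y x0 xy y1]; first by rewrite lt_min e10.
  rewrite !lt_min => /andP[x1 x2] /andP[y1' y2].
  have [G lG] := H1 x y x0 xy y1 x1 y1'; have [G' lG'] := H2 x y x0 xy y1 x2 y2.
  have RI : rect x y c d `&` rect x y d f = `[x, y]%classic `*` [set d].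
    by rewrite /rect -setXI setIid itvI.
  rewrite /liftable (_ : rect x y c f = rect x y c d `|` rect x y d f); last first.
    by rewrite /rect (itvU cd df) setXUr.
  apply: lifting_glue lG lG' => //.
  - by rewrite RI.
  - by rewrite RI; exists (x, d); split => //=; rewrite in_itv /= lexx.
  - apply: cont_on_sub cF => z [zr _]; apply: rect_sub zr => //; exact: le_trans f1.
  - move=> z zr; apply: FU; apply: rect_sub zr => //; exact: le_trans f1.
move=> t t01.
have Ist : (I `*` I) (s, t) by split; rewrite /= in_itv.
have [V [th [pV Vst]]] := prim_ex (FU Ist).
have [oV _] := prim_open pV.
have : \forall z \near (s, t), (I `*` I) z -> V (F z).
  by apply: cF => //; exact: open_nbhs_nbhs.
move=> /nbhs_ballP[e /= e0 He]; exists e => // c d c0 cd d1 ct dt.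
exists e => // x y x0 xy y1 xs ys; exists (th \o F).
have sub : rect x y c d `<=` I `*` I by apply: rect_sub.
apply: (lifting_prim pV); first exact: cont_on_sub cF.
move=> [p q] zr; apply: He; last exact: sub.
have mid (u v w k : R) : `|u - k| < e -> `|v - k| < e -> u <= w <= v -> `|k - w| < e.
  rewrite [`|k - w|]distrC !ltr_norml => /andP[u1 _] /andP[_ v2] /andP[uw wv].
  by rewrite (lt_le_trans u1) ?lerD2r // (le_lt_trans _ v2) ?lerD2r.
case: zr; rewrite /= !in_itv /= => pxy qcd.
by split; [exact: mid xs ys pxy|exact: mid ct dt qcd].
Qed.

Lemma lifting_square : exists G, lifting (I `*` I) F G.
Proof.
(* The local premise is [liftable_strip]; only the gluing of adjacent strips along a vertical edge
   remains. *)
apply: (@interval_ind R 0 1 (fun x y => liftable x y 0 1)) => //.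
move=> c d f c0 cd df f1 [G lG] [G' lG'].
have RI : rect c d 0 1 `&` rect d f 0 1 = [set d] `*` I.
  by rewrite /rect -setXI setIid itvI.
rewrite /liftable (_ : rect c f 0 1 = rect c d 0 1 `|` rect d f 0 1); last first.
  by rewrite /rect (itvU cd df) setXUl.
apply: lifting_glue lG lG' => //.
- by rewrite RI.
- by rewrite RI; exists (d, 0); split => //=; rewrite in_itv /= lexx ler01.
- apply: cont_on_sub cF => z [zr _]; apply: rect_sub zr => //; exact: le_trans f1.
- move=> z zr; apply: FU; apply: rect_sub zr => //; exact: le_trans f1.
Qed.

End Square.

(** A path is a square that is constant in its first coordinate, so the two-dimensional subdivision
    serves for paths too. *)
Lemma lifting_path u : path_in U u -> exists G, lifting I u G.
Proof.
move=> [/cont_onP cu uU].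
have cF : cont_on (I `*` I) (u \o snd).
  apply: (cont_on_comp (B := I)) cu; last by move=> z [].
  by apply: continuous_cont_on => z; exact: cvg_snd.
have [|G lG] := lifting_square cF; first by move=> z [_ Iz]; exact: uU.
exists (fun t => G (0, t)).
apply: (@lifting_comp _ _ (I `*` I) I (u \o snd) G (fun t => (0, t))) lG.
  by apply: continuous_cont_on => t; exact: (cvg_pair (cvg_cst (0 : R)) cvg_id).
by move=> t It; split => //=; rewrite in_itv /= lexx ler01.
Qed.

Let I0 : I 0. Proof. by rewrite /= in_itv /= lexx ler01. Qed.
Let I1 : I 1. Proof. by rewrite /= in_itv /= lexx ler01. Qed.

(* A null-homotopy carries the lifting to the whole square, where it is
   constant on the three sides mapped to the base point. *)
Lemma lifting_loop (K : R * R -> M) u G : {within I `*` I, continuous K} ->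
  (forall st, (I `*` I) st -> U (K st)) ->
  (forall t, I t -> K (0, t) = u t) -> (forall t, I t -> K (1, t) = u 0) ->
  (forall s, I s -> K (s, 0) = u 0 /\ K (s, 1) = u 0) ->
  lifting I u G -> G 1 = G 0.
Proof.
move=> /cont_onP cK KU K0 K1 Ks lG.
have [H lH] := lifting_square cK KU.
have edge (f : R -> R * R) : continuous f -> (forall t, I t -> (I `*` I) (f t)) ->
    lifting I (K \o f) (H \o f).
  by move=> cf fI; apply: lifting_comp lH => //; exact: continuous_cont_on.
have cstl : lifting I (fun=> u 0) (fun=> 0 : R).
  by move=> t It V th pV Vt; near=> s => _; rewrite !subrr.
have U0 : U (u 0) by rewrite -K0 //; exact: KU.
have flat (f : R -> R * R) : continuous f -> (forall t, I t -> (I `*` I) (f t)) ->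
    (forall t, I t -> K (f t) = u 0) -> H (f 1) = H (f 0).
  move=> cf fI fu.
  have l1 : lifting I (fun=> u 0) (H \o f) by apply: eq_lifting (edge f cf fI).
  have l2 := lifting_shift (H (f 0)) cstl.
  have cc : cont_on I (fun=> u 0).
    by apply: continuous_cont_on => t; exact: cvg_cst.
  have := lifting_unique (@segment_connected _ _ _) cc (fun _ _ => U0) l1 l2 I0.
  by rewrite /= add0r => /(_ erefl 1 I1).
have c1 (s : R) : continuous (fun t : R => (s, t)).
  by move=> t; exact: (cvg_pair (cvg_cst s) cvg_id).
have c2 (s : R) : continuous (fun t : R => (t, s)).
  by move=> t; exact: (cvg_pair cvg_id (cvg_cst s)).
have E1 : H (1, 0) = H (0, 0).
  by apply: (flat (fun s => (s, 0))) => // s Is; have [] := Ks s Is.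
have E2 : H (1, 1) = H (0, 1).
  by apply: (flat (fun s => (s, 1))) => // s Is; have [] := Ks s Is.
have E3 : H (1, 1) = H (1, 0) by apply: (flat (fun t => (1, t))).
have l0 : lifting I u (fun t => H (0, t)).
  by apply: eq_lifting (edge _ (c1 0) _) => // t It; rewrite /= K0.
have l2 := lifting_shift (G 0 - H (0, 0)) l0.
have cu : cont_on I u.
  have : cont_on I (fun t => K (0, t)).
    by apply: (cont_on_comp (B := I `*` I)) cK => //; exact: continuous_cont_on.
  move=> cc t It V; rewrite -K0 // => nV.
  by apply: filterS (cc t It V nV) => s Hs Is; rewrite -K0 //; exact: Hs.
have uU t : I t -> U (u t) by move=> It; rewrite -K0 //; exact: KU.
have := lifting_unique (@segment_connected _ _ _) cu uU lG l2 I0.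
rewrite [_ + (G 0 - _)]addrC subrK => /(_ erefl 1 I1) ->.
by rewrite -E2 E3 E1 addrC subrK.
Unshelve. all: by end_near. Qed.

(** The target type is arbitrary because paths and their liftings are concatenated by the same
    formula. *)
Let cat (T : Type) (u v : R -> T) t := if t <= 2^-1 then u (2 * t) else v (2 * t - 1).

Let left_half : set R := `[0, 2^-1]%classic.
Let right_half : set R := `[2^-1, 1]%classic.

Let halves : I = left_half `|` right_half.
Proof. by apply: itvU; lra. Qed.

Let path_cat u v : path_in U u -> path_in U v -> u 1 = v 0 ->
  path_in U (cat u v) /\ (forall G G', lifting I u G -> lifting I v G' ->
    G 1 = G' 0 -> lifting I (cat u v) (cat G G')).
Proof.
move=> [/cont_onP cu uU] [/cont_onP cv vU] uv.
have cl : continuous (fun t : R => 2 * t) by move=> t; exact: mulrl_continuous.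
have cr : continuous (fun t : R => 2 * t - 1).
  by move=> t; apply: cvgB; [exact: cl|exact: cvg_cst].
have Il t : left_half t -> I (2 * t).
  by rewrite /left_half /= !in_itv /= => /andP[? ?]; apply/andP; split; lra.
have Ir t : right_half t -> I (2 * t - 1).
  by rewrite /right_half /= !in_itv /= => /andP[? ?]; apply/andP; split; lra.
have El T (f g : R -> T) t : left_half t -> f (2 * t) = cat f g t.
  by rewrite /left_half /cat /= in_itv /= => /andP[_ ->].
have Er T (f g : R -> T) t : f 1 = g 0 -> right_half t -> g (2 * t - 1) = cat f g t.
  move=> fg; rewrite /right_half /cat /= in_itv /= => /andP[t2 t1].
  case: ifP => // t2'; have -> : t = 2^-1 by apply/le_anti; rewrite t2 t2'.
  by rewrite mulfV // subrr fg.
have ccat : cont_on I (cat u v).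
  apply/cont_onP; rewrite halves; apply: withinU_continuous; try exact: itv_closed.
    apply/cont_onP => t lt V; rewrite -(El _ _ _ _ lt) => nV.
    have := cont_on_comp (continuous_cont_on (A := left_half) cl) Il cu lt nV.
    by apply: filterS => s Hs ls; rewrite -(El _ _ v) //; exact: Hs.
  apply/cont_onP => t lt V; rewrite -(Er _ _ _ _ uv lt) => nV.
  have := cont_on_comp (continuous_cont_on (A := right_half) cr) Ir cv lt nV.
  by apply: filterS => s Hs ls; rewrite -Er //; exact: Hs.
split.
  split; first exact/cont_onP.
  move=> t; rewrite -/(I t) halves => -[ht|ht].
    by rewrite -(El _ _ v) //; exact/uU/Il.
  by rewrite -Er //; exact/vU/Ir.
move=> G G' lG lG' GG; rewrite halves; apply: liftingU; try exact: itv_closed.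
  apply: (eq_lifting _ _ (lifting_comp (continuous_cont_on (A := left_half) cl) Il lG)).
    by move=> t ht; exact: (El _ u v).
  by move=> t ht; exact: (El _ G G').
apply: (eq_lifting _ _ (lifting_comp (continuous_cont_on (A := right_half) cr) Ir lG')).
  by move=> t ht; exact: (Er _ u v).
by move=> t ht; exact: (Er _ G G').
Qed.

Let cat0 T (u v : R -> T) : cat u v 0 = u 0.
Proof. by rewrite /cat invr_ge0 ler0n mulr0. Qed.

Let cat1 T (u v : R -> T) : cat u v 1 = v 1.
Proof. by rewrite /cat ifF; [congr v; lra|apply/negbTE; rewrite -ltNge; lra]. Qed.

(** [Th m] is the increment of a lifting along any path from a base point to m. Two paths with the
    same ends form a null-homotopic loop, and [lifting_loop] says that the increment around it is
    zero. *)
Theorem monodromy : simply_connected R U -> exists Th : M -> R,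
  forall V th, prim V th -> forall m, V m ->
  \forall m' \near m, Th m' - Th m = th m' - th m.
Proof.
move=> [conU loopU].
have [[m0 Um0]|U0] := pselect (U !=set0); last first.
  by exists (fun=> 0) => V th /prim_open[_ VU] m /VU Um; case: U0; exists m.
pose Rel m c := exists u G, [/\ path_in U u, u 0 = m0, u 1 = m, lifting I u G &
  G 0 = 0 /\ G 1 = c].
have Rel_ex m : U m -> exists c, Rel m c.
  move=> Um; have [u [pu u0 u1]] := conU m0 m Um0 Um.
  have [G lG] := lifting_path pu.
  exists (G 1 - G 0), u, (fun t => G t - G 0); split => //.
    exact: (lifting_shift (- G 0) lG).
  by rewrite subrr.
have Rel_uniq m c c' : Rel m c -> Rel m c' -> c = c'.
  move=> [u [G [pu u0 u1 lG [G0 G1]]]] [v [H [pv v0 v1 lH [H0 H1]]]].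
  (* [K] lifts the reversed path and starts at the final value of [G]. Along the concatenated loop
     the lifting runs from 0 to c - c'. *)
  pose w t := v (1 - t); pose K t := H (1 - t) + (G 1 - H 1).
  have cs : continuous (fun t : R => 1 - t).
    by move=> t; apply: cvgB; [exact: cvg_cst|exact: cvg_id].
  have Is t : I t -> I (1 - t).
    by rewrite /= !in_itv /= => /andP[? ?]; apply/andP; split; lra.
  have pw : path_in U w.
    case: pv => /cont_onP cv vU; split; last by move=> t It; exact/vU/Is.
    by apply/cont_onP; apply: (cont_on_comp (continuous_cont_on (A := I) cs) Is cv).
  have lK : lifting I w K.
    exact: (lifting_shift _ (lifting_comp (continuous_cont_on (A := I) cs) Is lH)).
  have uw : u 1 = w 0 by rewrite /w subr0 u1 v1.
  have [pc lc] := path_cat pu pw uw.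
  have {}lc : lifting I (cat u w) (cat G K).
    by apply: lc => //; rewrite /K subr0 addrC subrK.
  have c01 : cat u w 0 = cat u w 1 by rewrite cat0 cat1 u0 /w subrr v0.
  have [F [cF FU F0 F1 Fs]] := loopU _ pc c01.
  have := lifting_loop cF FU F0 F1 Fs lc.
  by rewrite cat0 cat1 /K subrr H0 G0 add0r G1 H1 => /eqP; rewrite subr_eq0 => /eqP.
pose Th m := get (Rel m).
have ThP m : U m -> Rel m (Th m) by move=> /Rel_ex [c Hc]; exact: (@getI _ (Rel m) c).
exists Th => V th pV m Vm; have [oV VU] := prim_open pV.
near=> m'.
(* Appending a path that stays in [V] lengthens the lifting by the increment of [th]. *)
have [w [pw w0 w1]] : exists w : R -> M, [/\ path_in V w, w 0 = m & w 1 = m'].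
  by near: m'; exact: (prim_path pV Vm).
have [u [G [pu u0 u1 lG [G0 G1]]]] := ThP m (VU _ Vm).
have pwU : path_in U w by case: pw => cw wV; split => // t /wV/VU.
have uw : u 1 = w 0 by rewrite u1 w0.
have [pc lc] := path_cat pu pwU uw.
have lw : lifting I w (th \o w).
  by case: pw => /cont_onP cw wV; exact: lifting_prim pV cw wV.
have {}lc := lc _ _ lG (lifting_shift (G 1 - th m) lw).
have RR : Rel m' (th m' + (G 1 - th m)).
  exists (cat u w); eexists; split; [exact: pc|by rewrite cat0|by rewrite cat1| |].
    by apply: lc; rewrite /= w0 addrC subrK.
  by rewrite cat0 cat1 /= w1.
have Um' : U m' by apply: VU; rewrite -w1; apply: (pw.2); exact: I1.
by rewrite -(Rel_uniq _ _ _ RR (ThP _ Um')) G1; ring.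
Unshelve. all: by end_near. Qed.

End Monodromy.

(** * Bump functions *)

Section Bump.
Variable R : realType.

(** The function p(1/t) exp(-1/t), extended by 0. The polynomial makes the family stable under
    differentiation, which replaces p by X^2 (p - p'). *)
Let flat_exp (p : {poly R}) (t : R) :=
  if 0 < t then p.[t^-1] * expR (- t^-1) else 0.

(** From exp(x) >= x^(i+1) / (i+1)! at x = 1/t, each term t^(-i) exp(-1/t) is at most (i+1)! t. *)
Let flat_exp_bound (p : {poly R}) : exists2 C, 0 < C &
  forall t : R, 0 < t -> `|flat_exp p t| <= C * t.
Proof.
exists (\sum_(i < size p) `|p`_i| * (i.+1)`!%:R + 1).
  by rewrite ltr_wpDl // sumr_ge0 // => i _; rewrite mulr_ge0.
move=> t t0; rewrite /flat_exp t0 horner_coef.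
have x0 : 0 < t^-1 by rewrite invr_gt0.
apply: (@le_trans _ _ ((\sum_(i < size p) `|p`_i| * (i.+1)`!%:R) * t)); last first.
  by rewrite ler_pM2r // lerDl.
rewrite !big_distrl /=; apply: (le_trans (ler_norm_sum _ _ _)).
apply: ler_sum => i _; rewrite -!mulrA normrM; apply: ler_wpM2l => //.
rewrite ger0_norm; last by rewrite mulr_ge0 ?expR_ge0 // exprn_ge0 // ltW.
rewrite expRN ler_pdivrMr ?expR_gt0 //.
apply: (@le_trans _ _ ((i.+1)`!%:R * t * (t^-1 ^+ i.+1 / (i.+1)`!%:R))).
  have f0 : ((i.+1)`!%:R : R) != 0 by rewrite pnatr_eq0 -lt0n fact_gt0.
  rewrite exprS; move: (t^-1 ^+ i) => u.
  have -> // : (i.+1)`!%:R * t * (t^-1 * u / (i.+1)`!%:R) = u.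
  by field; rewrite f0 gt_eqF.
apply: ler_wpM2l; first by rewrite mulr_ge0 // ltW.
by apply: le_trans (expR_ge1Dxn i (ltW x0)); rewrite lerDr.
Qed.

Let flat_exp_derive p (t : R) :
  is_derive t 1 (flat_exp p) (flat_exp ('X^2 * (p - p^`())) t).
Proof.
have [t0|t0|->] := ltgtP t 0.
- have -> : flat_exp ('X^2 * (p - p^`())) t = 0 by rewrite /flat_exp lt_gtF.
  apply: (near_eq_is_derive (f := fun=> 0 : R)).
  near=> s; rewrite /flat_exp lt_gtF //; near: s; exact: lt_nbhsl.
- have -> : flat_exp ('X^2 * (p - p^`())) t =
      ('X^2 * (p - p^`())).[t^-1] * expR (- t^-1) by rewrite /flat_exp t0.
  apply: (@near_eq_is_derive R R R (fun t : R => p.[t^-1] * expR (- t^-1))).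
    near=> s; rewrite /flat_exp ifT //; near: s; exact: lt_nbhsr.
  have tn0 : t != 0 by rewrite gt_eqF.
  have dI : is_derive t 1 (fun x : R => x^-1) (- t ^- 2).
    apply: DeriveDef; first exact: derivableV.
    by rewrite deriveV // derive_id; exact: mulr1.
  have dp : is_derive t 1 (fun t => p.[t^-1]) (p^`().[t^-1] * (- t ^- 2)).
    exact: (is_derive1_comp (f := horner p) (g := fun x : R => x^-1)).
  have de : is_derive t 1 (fun t => expR (- t^-1)) (expR (- t^-1) * (t ^- 2)).
    rewrite -[t ^- 2]opprK.
    exact: (is_derive1_comp (f := expR) (g := fun x : R => - x^-1)).
  apply: (is_derive_eq (is_deriveM dp de)).
  rewrite /GRing.scale /= hornerM hornerXn hornerD hornerN exprVn; ring.
(* For h > 0 the difference quotient at 0 is [flat_exp ('X * p) h], bounded by C h, so the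
   derivative at 0 vanishes. *)
- have [C C0 HC] := flat_exp_bound ('X * p).
  have -> : flat_exp ('X^2 * (p - p^`())) 0 = 0 by rewrite /flat_exp ltxx.
  have F0 : flat_exp p 0 = 0 by rewrite /flat_exp ltxx.
  have c0 : continuous (\0 : {linear R -> R}) by exact: cst_continuous.
  have [|df dE] := @differentiable_approx _ _ _ (flat_exp p) \0 (0 : R) c0.
    move=> e e0; near=> h; rewrite F0 !subr0 addr0.
    have [h0|h0] := ltP 0 h; last first.
      by rewrite /flat_exp ltNge h0 /= normr0 mulr_ge0 // ltW.
    have -> : flat_exp p h = h * flat_exp ('X * p) h.
      rewrite /flat_exp h0 hornerM hornerX !mulrA mulfV ?mul1r // gt_eqF //.
    rewrite normrM mulrC ler_pM2r ?normr_gt0 ?gt_eqF //.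
    apply: (le_trans (HC h h0)); rewrite mulrC -ler_pdivlMr //.
    near: h; apply: nbhs0_ltW.
    by rewrite divr_gt0.
  apply: DeriveDef; first by apply/derivable1_diffP.
  by rewrite deriveE // dE.
Unshelve. all: by end_near. Qed.

Lemma exists_flat_function : exists2 h : R -> R,
  (forall t, (0 < h t) = (0 < t)) /\ (forall t, t <= 0 -> h t = 0) &
  forall n (O : set 'rV[R]_n) f, open O -> smooth_on O f ->
    smooth_on O (fun x => h (f x)).
Proof.
exists (flat_exp 1).
  split=> t; rewrite /flat_exp; last by rewrite ltNge => ->.
  by case: (0 < t); rewrite ?ltxx // hornerC mul1r expR_gt0.
move=> n O f oO sf; apply: (@smooth_on_unary _ _ _ oO
  (fun h => exists p, h = flat_exp p) setT) => //.
- exact: openT.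
- by move=> _ t [p ->] _; have [] := flat_exp_derive p t.
- move=> _ [p ->]; exists (flat_exp ('X^2 * (p - p^`()))); first by eexists.
  by move=> t _; rewrite derive1E (@derive_val _ _ _ _ _ _ _ (flat_exp_derive p t)).
- by exists 1.
Qed.

(* The bump function of a cube: a product of flat functions of r^2 - (x_i - c_i)^2. *)
Lemma exists_bump n (c : 'rV[R]_n) (r : R) : 0 < r -> exists2 f : 'rV[R]_n -> R,
  smooth_on setT f /\ f c != 0 & forall x, ~ `|x - c| <= r -> f x = 0.
Proof.
move=> r0; have [h [hpos h0] hs] := exists_flat_function.
pose F (x : 'rV[R]_n) := \prod_i h (r ^+ 2 - (x 0 i - c 0 i) ^+ 2).
exists F; first split.
- have oT : open (@setT 'rV[R]_n) by exact: openT.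
  rewrite /F; elim: (index_enum _) => [|i s IH].
    by apply: (eq_smooth_on oT _ (@smooth_on_cst R n setT 1)) => x _; rewrite big_nil.
  apply: (eq_smooth_on oT (f := fun x => h (r ^+ 2 - (x 0 i - c 0 i) * (x 0 i - c 0 i)) *
     \prod_(i <- s) h (r ^+ 2 - (x 0 i - c 0 i) ^+ 2))).
    by move=> x _; rewrite big_cons expr2.
  apply: smooth_onM => //; apply: hs => //.
  apply: smooth_onB => //; first exact: smooth_on_cst.
  by apply: smooth_onM => //; apply: smooth_onB => //;
     [exact: smooth_on_coord|exact: smooth_on_cst|exact: smooth_on_coord|exact: smooth_on_cst].
- rewrite /F gt_eqF // prodr_gt0 // => i _.
  by rewrite hpos subrr expr0n subr0 exprn_gt0.
- move=> x; rewrite norm_row_le ?ltW // => /negP; rewrite negb_forall => /existsP[j].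
  rewrite -ltNge !mxE => ri; rewrite /F (bigD1 j) //= h0 ?mul0r //.
  rewrite subr_le0 -[leRHS]real_normK ?num_real // ler_pXn2r // ?nnegrE ?ltW //.
Qed.

End Bump.

(** * The inverse function theorem *)

Section SmoothMatrix.
Variables (R : realType) (n : nat) (O : set 'rV[R]_n).
Hypothesis oO : open O.

Lemma smooth_on_prod (I : Type) (r : seq I) (f : I -> 'rV[R]_n -> R) :
  (forall i, smooth_on O (f i)) -> smooth_on O (fun x => \prod_(i <- r) f i x).
Proof.
move=> sf; elim: r => [|i r IH].
  by apply: (eq_smooth_on oO _ (@smooth_on_cst R n O 1)) => x _; rewrite big_nil.
apply: (eq_smooth_on oO (f := fun x => f i x * \prod_(i <- r) f i x)).
  by move=> x _; rewrite big_cons.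
exact: smooth_onM.
Qed.

Definition smooth_mx m p (M : 'rV[R]_n -> 'M[R]_(m, p)) :=
  forall i j, smooth_on O (fun x => M x i j).

Lemma smooth_mxM m p q (M : 'rV[R]_n -> 'M[R]_(m, p)) (N : 'rV[R]_n -> 'M[R]_(p, q)) :
  smooth_mx M -> smooth_mx N -> smooth_mx (fun x => M x *m N x).
Proof.
move=> sM sN i j; apply: (eq_smooth_on oO (f := fun x => \sum_k M x i k * N x k j)).
  by move=> x _; rewrite mxE.
by apply: smooth_on_sum => // k; apply: smooth_onM.
Qed.

Lemma smooth_mx_tr m p (M : 'rV[R]_n -> 'M[R]_(m, p)) :
  smooth_mx M -> smooth_mx (fun x => (M x)^T).
Proof.
by move=> sM i j; apply: (eq_smooth_on oO (f := fun x => M x j i)) => // x _; rewrite mxE.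
Qed.

Lemma smooth_mx_cst m p (M : 'M[R]_(m, p)) : smooth_mx (fun=> M).
Proof. by move=> i j; exact: smooth_on_cst. Qed.

Lemma smooth_on_det m (M : 'rV[R]_n -> 'M[R]_m) :
  smooth_mx M -> smooth_on O (fun x => \det (M x)).
Proof.
move=> sM; apply: smooth_on_sum => // s; apply: smooth_onM => //.
  exact: smooth_on_cst.
by apply: smooth_on_prod => i; exact: sM.
Qed.

Lemma smooth_mx_inv m (M : 'rV[R]_n -> 'M[R]_m) :
  smooth_mx M -> (forall x, O x -> M x \in unitmx) -> smooth_mx (fun x => invmx (M x)).
Proof.
move=> sM uM i j.
apply: (eq_smooth_on oO (f := fun x => (\det (M x))^-1 * cofactor (M x) j i)).
  by move=> x Ox; rewrite /invmx uM // !mxE.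
apply: smooth_onM => //.
  apply: smooth_onV => //; first exact: smooth_on_det.
  by move=> x Ox; have := uM x Ox; rewrite unitmxE unitfE.
apply: smooth_onM => //; first exact: smooth_on_cst.
(* A minor has one row and one column less, so the size has to be a successor; size 0 has no
   entries. *)
case: m M sM uM i j => [|m] M sM uM i j; first by case: i.
have sR : smooth_mx (fun x => row' j (col' i (M x))).
  by move=> k l; apply: (eq_smooth_on oO (f := fun x => M x (lift j k) (lift i l))) => // x _;
    rewrite !mxE.
apply: smooth_on_sum => // s; apply: smooth_onM => //.
  exact: smooth_on_cst.
by apply: smooth_on_prod => k; exact: sR.
Qed.

End SmoothMatrix.

Lemma derive_local_min (R : realType) n (f : 'rV[R]_n -> R) x v :
  (\near x, differentiable f x) -> (\forall y \near x, f x <= f y) ->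
  'D_v f x = 0.
Proof.
move=> df fmin.
have /nbhs_ballP[d /= d0 Hd] : \forall y \near x, differentiable f y /\ f x <= f y.
  by near=> y; split; near: y.
pose e := d / (`|v| + 1).
have v0 : 0 < `|v| + 1 by rewrite ltr_wpDl.
have e0 : 0 < e by rewrite divr_gt0.
have B (t : R) : t \in `]- e, e[ -> ball x d (t *: v + x).
  rewrite in_itv /= -ltr_norml => te.
  rewrite -ball_normE /= opprD addrC subrK normrN normrZ.
  apply: (@le_lt_trans _ _ (`|t| * (`|v| + 1))); first by rewrite ler_wpM2l // lerDl.
  by rewrite -ltr_pdivlMr.
have D (t : R) : t \in `]- e, e[ -> is_derive t 1 (fun t => f (t *: v + x)) ('D_v f (t *: v + x)).
  by move=> te; apply: is_derive_line; apply: diff_derivable; exact: (Hd _ (B t te)).1.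
have I0 : (0 : R) \in `]- e, e[ by rewrite in_itv /= oppr_lt0 e0.
have le_e : - e <= e by rewrite (@le_trans _ _ 0) ?oppr_le0 ?ltW.
have := @derive1_at_min R (fun t => f (t *: v + x)) (- e) e 0 le_e _ I0 _.
case.
- by move=> t te; have [] := D t te.
- by move=> t te; rewrite scale0r add0r; exact: (Hd _ (B t te)).2.
move=> _; have [_] := D 0 I0; rewrite scale0r add0r => -> //.
Unshelve. all: by end_near. Qed.

Section InverseFunction.
Variables (R : realType) (n : nat).
Implicit Types (x y v : 'rV[R]_n) (O : set 'rV[R]_n).

Lemma mulmxr_continuous m (A : 'M[R]_(n, m)) : continuous (fun v : 'rV[R]_n => v *m A).
Proof.
move=> v; apply: differentiable_continuous; apply: differentiable_rowP => j.
rewrite (_ : (fun _ => _) = \sum_i (fun v : 'rV[R]_n => v 0 i * A i j)); last first.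
  by apply/funext => w; rewrite fct_sumE mxE.
apply: differentiable_sum => i; apply: differentiableM => //; exact: differentiable_coord.
Qed.

Section NearIdentity.
Variables (H : 'rV[R]_n -> 'rV[R]_n) (W : set 'rV[R]_n).
Hypothesis oW : open W.
Hypothesis sH : forall j, smooth_on W (fun x => H x 0 j).
Hypothesis H_expand : forall x y, W x -> W y ->
  `|H x - H y - (x - y)| <= 2^-1 * `|x - y|.
Hypothesis JH : forall x v, W x -> `|v *m jacobian H x - v| <= 2^-1 * `|v|.

Let dH x : W x -> differentiable H x.
Proof.
move=> Wx; apply: differentiable_rowP => j; exact: smooth_on_differentiable (sH j) Wx.
Qed.

Let norm_half (u v : 'rV[R]_n) : `|u - v| <= 2^-1 * `|v| -> `|v| <= 2 * `|u|.
Proof.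
move=> uv; have : `|v| <= `|u| + `|u - v|.
  by rewrite -[X in `|X| <= _](subrK u) addrC (le_trans (ler_normD _ _)) // distrC.
by lra.
Qed.

Let H_inj_norm x y : W x -> W y -> `|x - y| <= 2 * `|H x - H y|.
Proof. by move=> Wx Wy; apply: norm_half; exact: H_expand. Qed.

Let H_inj x y : W x -> W y -> H x = H y -> x = y.
Proof.
move=> Wx Wy E; apply/eqP; rewrite -subr_eq0 -normr_le0.
by rewrite (le_trans (H_inj_norm Wx Wy)) // E subrr normr0 mulr0.
Qed.

Let J_unit x : W x -> jacobian H x \in unitmx.
Proof.
move=> Wx; rewrite -row_free_unit -kermx_eq0; apply/eqP/row_matrixP => i.
set u := row i _; rewrite row0; apply/eqP; rewrite -normr_le0.
have := norm_half (JH u Wx); rewrite (_ : u *m _ = 0) ?normr0 ?mulr0 //.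
by rewrite /u -row_mul mulmx_ker row0.
Qed.

Let invJ_norm x v : W x -> `|v *m invmx (jacobian H x)| <= 2 * `|v|.
Proof.
move=> Wx; apply: norm_half; rewrite -[X in `|X - _|](mulmxKV (J_unit Wx)).
exact: JH.
Qed.

(** Instead of a fixed point argument, the Euclidean distance from H x to the target y is minimized
    over a closed cube around x1. The minimum is not on the boundary because [H] shrinks distances
    at most by half, and at an interior critical point invertibility of the jacobian forces H x =
    y. *)
Lemma near_identity_open : open (H @` W).
Proof.
rewrite openE => _ [x1 Wx1 <-].
have /nbhs_ballP[s' /= s'0 Bs] : nbhs x1 W by exact: open_nbhs_nbhs.
pose s := s' / 2; have s0 : 0 < s by rewrite divr_gt0.
have cW x : `|x - x1| <= s -> W x.
  move=> xs; apply: Bs; rewrite -ball_normE /= distrC (le_lt_trans xs) //.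
  by rewrite /s ltr_pdivrMr // ltr_pMr // ltr1n.
(* The norm is a maximum of coordinates, while the function minimized is a sum of n squares. The
   factor N absorbs this: n d^2 < (d N)^2 = (s/4)^2. *)
pose N : R := n.+1%:R; have N1 : 1 <= N by rewrite ler1n.
have N0 : 0 < N by exact: lt_le_trans N1.
pose d := s / (4 * N); have d0 : 0 < d by rewrite divr_gt0 // mulr_gt0.
have dN : s / 4 = d * N by rewrite /d; field; rewrite gt_eqF.
apply/nbhs_ballP; exists d => // y; rewrite -ball_normE /= => yd.
pose f x := \sum_j (H x 0 j - y 0 j) * (H x 0 j - y 0 j).
have sf : smooth_on W f.
  by apply: smooth_on_sum => // j; apply: smooth_onM => //; apply: smooth_onB => //;
    exact: smooth_on_cst.
have [|||xi /[!inE] /= xis Hmin] := @EVT_min_rV R n f [set x | `|x - x1| <= s].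
- by exists x1; rewrite /= subrr normr0 ltW.
- by apply: closed_cube_compact; exact: ltW.
- apply: continuous_in_subspaceT => x /[!inE] /= xs.
  apply: differentiable_continuous; apply: (smooth_on_differentiable sf); exact: cW.
have f_ge x (c : R) : 0 <= c -> c <= `|H x - y| -> c ^+ 2 <= f x.
  move=> c0 cH; have [->|cn0] := eqVneq c 0.
    by rewrite expr0n /= sumr_ge0 // => j _; rewrite -expr2 sqr_ge0.
  have cp : 0 < c by rewrite lt0r cn0.
  have : ~~ (`|H x - y| < c) by rewrite -leNgt.
  suff [j Hj] : exists j, c <= `|(H x - y) 0 j|.
    move=> _; rewrite /f (bigD1 j) //= -[leLHS]addr0 lerD //; last first.
      by rewrite sumr_ge0 // => k _; rewrite -expr2 sqr_ge0.
    rewrite -expr2 -[leRHS]real_normK ?num_real // ler_pXn2r ?nnegrE //.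
    by move: Hj; rewrite !mxE.
  apply: contrapT => nH; move: cH; rewrite leNgt => /negP; apply.
  rewrite [ltLHS]/Num.Def.normr/= mx_normrE; apply: bigmax_lt => // -[i j] _ /=.
  by rewrite (ord1 i) ltNge; apply/negP => ?; apply: nH; exists j.
have f_le : f x1 < (s / 4) ^+ 2.
  apply: (@le_lt_trans _ _ (n%:R * d ^+ 2)).
    apply: (@le_trans _ _ (\sum_(j < n) d ^+ 2)); last by rewrite sumr_const card_ord mulr_natl.
    apply: ler_sum => j _; rewrite -expr2 -[leLHS]real_normK ?num_real //.
    rewrite ler_pXn2r ?nnegrE ?(ltW d0) //.
    by have := ler_norm_coord (H x1 - y) j; rewrite !mxE => /le_trans; apply; exact: ltW.
  rewrite dN (exprMn 2 d N) (mulrC n%:R) ltr_pM2l ?exprn_gt0 //.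
  rewrite (@lt_le_trans _ _ N) ?ltr_nat // expr2 ler_peMr // ltW.
(* On the boundary H xi is at distance at least s/2 from H x1, which lies within d <= s/4 of y. Then
   f xi >= (s/4)^2 > f x1, against minimality. *)
have xi_int : `|xi - x1| < s.
  rewrite lt_neqAle xis andbT; apply/eqP => xiE.
  have := Hmin x1; rewrite inE /= subrr normr0 => /(_ (ltW s0)).
  apply/negP; rewrite -ltNge; apply: (lt_le_trans f_le); apply: f_ge; first by rewrite divr_ge0 ?ltW.
  have Wxi : W xi by apply: cW.
  have := H_inj_norm Wxi Wx1; rewrite xiE => H1.
  have : `|H xi - H x1| <= `|H xi - y| + `|H x1 - y|.
    by rewrite [`|H x1 - y|]distrC (le_trans _ (ler_normD _ _)) // addrA subrK.
  have : d <= s / 4.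
    by rewrite dN ler_peMr // ltW.
  by lra.
have Wxi : W xi by apply: cW.
exists xi => //; apply/eqP; rewrite -subr_eq0; apply/eqP/rowP => j; rewrite [RHS]mxE.
have D0 v : 'D_v f xi = 0.
  apply: derive_local_min.
    near=> x; apply: (smooth_on_differentiable sf); near: x; exact: open_nbhs_nbhs.
  have oB : nbhs xi (ball x1 s).
    apply: open_nbhs_nbhs; split; first exact: ball_open.
    by rewrite -ball_normE /= distrC.
  near=> x; apply: Hmin; rewrite inE /= ltW // distrC.
  suff : ball x1 s x by rewrite -ball_normE.
  by near: x.
have Dv v : 'D_v f xi = 2 * \sum_j (H xi - y) 0 j * (v *m jacobian H xi) 0 j.
  rewrite /f (_ : (fun x => _) = \sum_j ((fun x => H x 0 j - y 0 j) * (fun x => H x 0 j - y 0 j))); last first.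
    by apply/funext => z; rewrite fct_sumE.
  have dj k : derivable (fun x => H x 0 k - y 0 k) xi v.
    apply: derivableB; last exact: derivable_cst.
    apply: diff_derivable; exact: smooth_on_differentiable (sH k) Wxi.
  rewrite derive_sum => [|k]; last exact: derivableM.
  rewrite big_distrr; apply: eq_bigr => k _; rewrite deriveM //.
  have -> : 'D_v (fun x => H x 0 k - y 0 k) xi = (v *m jacobian H xi) 0 k.
    rewrite -(deriveEjacobian _ (dH Wxi)) derive_row ?mxE; last exact: dH.
    rewrite deriveB; [|exact/diff_derivable/(smooth_on_differentiable (sH k))|exact: derivable_cst].
    by rewrite derive_cst subr0.
  rewrite !mxE /GRing.scale /=; ring.
(* In this direction the derivative of f is twice the sum of the squares of the coordinates of H xi
   - y. *)
have := Dv ((H xi - y) *m invmx (jacobian H xi)); rewrite D0 mulmxKV ?J_unit //.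
move=> /esym/eqP; rewrite mulf_eq0 pnatr_eq0 /= psumr_eq0 => [/allP/(_ j)|k _].
  by rewrite mem_index_enum => /(_ isT); rewrite -expr2 sqrf_eq0 => /eqP.
by rewrite -expr2 sqr_ge0.
Unshelve. all: by end_near. Qed.

Definition near_identity_inv y := get [set x | W x /\ H x = y].
Local Notation K := near_identity_inv.

Lemma near_identity_invK x : W x -> K (H x) = x.
Proof.
move=> Wx; have [WK HK] : [set x' | W x' /\ H x' = H x] (K (H x)) by apply: (@getI _ _ x).
exact: H_inj.
Qed.

Let O' := H @` W.

Let WK y : O' y -> W (K y) /\ H (K y) = y.
Proof. by move=> [x Wx <-]; rewrite near_identity_invK. Qed.

Let dK y : O' y -> differentiable K y /\
  forall v, 'D_v K y = v *m invmx (jacobian H (K y)).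
Proof.
move=> Oy; have [Wx Hx] := WK Oy; set x := K y in Wx Hx *.
pose L := mulmxr (invmx (jacobian H x)) : {linear 'rV[R]_n -> 'rV[R]_n}.
have cL : continuous L by exact: mulmxr_continuous.
suff [dK dKE] : differentiable K y /\ 'd K y = L :> ('rV[R]_n -> 'rV[R]_n).
  by split => // v; rewrite deriveE // dKE.
apply: differentiable_approx => // e e0.
(* One factor 2 is lost to the inverse jacobian, another to the bound of the increment of [K] by
   twice the norm of k. *)
have e4 : 0 < e / 4 by rewrite divr_gt0.
have /nbhs_ballP[d /= d0 Hd] := differentiable_approxE (dH Wx) e4.
have Oopen : \forall z \near y, O' z by apply: open_nbhs_nbhs; split => //; exact: near_identity_open.
have Ok : \forall k \near (0 : 'rV[R]_n), O' (k + y).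
  by move: Oopen; rewrite (near_shift 0); apply: filterS => k /=; rewrite subr0.
have Hs : \forall k \near (0 : 'rV[R]_n), `|k| < 2^-1 * d.
  apply/nbhs_ballP; exists (2^-1 * d); first by rewrite /= mulr_gt0.
  by move=> k; rewrite -ball_normE /= sub0r normrN.
near=> k.
have Oky : O' (k + y) by near: k.
have [Wxk Hxk] := WK Oky.
set h := K (k + y) - x.
have hk : `|h| <= 2 * `|k|.
  by rewrite (le_trans (H_inj_norm Wxk Wx)) // Hxk Hx addrK.
have hd : ball 0 d h.
  rewrite -ball_normE /= sub0r normrN (le_lt_trans hk) // -ltr_pdivlMl //.
  by near: k.
have := Hd h hd; rewrite /h subrK Hxk Hx addrK -/h => Hh.
have E : h - L k = - ((k - 'd H x h) *m invmx (jacobian H x)).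
  rewrite mulmxBl -(deriveE _ (dH Wx)) (deriveEjacobian _ (dH Wx)).
  by rewrite mulmxK ?J_unit // opprB.
rewrite E normrN (le_trans (invJ_norm _ Wx)) //.
have : `|k - 'd H x h| <= e / 4 * (2 * `|k|).
  by apply: (le_trans Hh); rewrite ler_wpM2l // ltW.
by lra.
Unshelve. all: by end_near. Qed.

(** The functions h o K with h smooth on [W] are stable under partial derivatives: by the chain rule
    the i-th one is the sum over j of (d_j h) (J^-1)_ij, again composed with K. Coinduction thus
    replaces a bootstrap on the regularity of [K]. *)
Lemma near_identity_inv_smooth h : smooth_on W h -> smooth_on O' (h \o K).
Proof.
move=> sh0; apply: (@smooth_on_class _ _ O'
  (fun f => exists2 h, smooth_on W h & f = h \o K) near_identity_open) (h \o K) _ _ _.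
- move=> _ y [{sh0}h sh ->] Oy; apply: differentiable_comp; first exact: (dK Oy).1.
  exact: (smooth_on_differentiable sh (WK Oy).1).
- move=> _ i [{sh0}h sh ->].
  exists ((fun x => \sum_j partial j h x * invmx (jacobian H x) i j) \o K).
    eexists; last reflexivity.
    apply: smooth_on_sum => // j; apply: smooth_onM => //; first exact: smooth_on_partial.
    apply: (@smooth_mx_inv R n W oW n (fun x => jacobian H x)) => // k l.
    apply: (eq_smooth_on oW (f := partial k (fun x => H x 0 l))).
      by move=> x Wx; rewrite jacobianE //; exact: dH.
    exact: smooth_on_partial.
  move=> y Oy; have [dKy DK] := dK Oy.
  rewrite partial_comp //; last exact: (smooth_on_differentiable sh (WK Oy).1).
  apply: eq_bigr => j _; congr (_ * _).
  have /rowP/(_ j) := derive_row (bvec R i) dKy; rewrite DK !mxE /partial => <-.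
  rewrite (bigD1 i) //= big1 => [|k ki]; first by rewrite mxE !eqxx mul1r addr0.
  by rewrite mxE (negbTE ki) andbF mul0r.
- by exists h.
- by [].
Qed.

End NearIdentity.

(* After composition with the inverse of the differential at the point, the
   map is a small perturbation of the identity. *)
Theorem inverse_function (G : 'rV[R]_n -> 'rV[R]_n) O x0 : open O -> O x0 ->
  (forall j, smooth_on O (fun x => G x 0 j)) -> jacobian G x0 \in unitmx ->
  exists W (K : 'rV[R]_n -> 'rV[R]_n), [/\ open W, W x0, W `<=` O, open (G @` W) &
    (forall x, W x -> K (G x) = x) /\
    (forall h, smooth_on W h -> smooth_on (G @` W) (h \o K))].
Proof.
move=> oO Ox0 sG uB; set B := jacobian G x0 in uB.
pose H x := G x *m invmx B.
have sH : forall j, smooth_on O (fun x => H x 0 j).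
  have sGm : smooth_mx O G by move=> i j; rewrite (ord1 i); exact: sG.
  by move=> j; exact: (smooth_mxM oO sGm (@smooth_mx_cst R n O _ _ (invmx B))).
have dG x : O x -> differentiable G x.
  by move=> Ox; apply: differentiable_rowP => j; exact: smooth_on_differentiable (sG j) Ox.
have dH x : O x -> differentiable H x.
  by move=> Ox; apply: differentiable_rowP => j; exact: smooth_on_differentiable (sH j) Ox.
have pH x i j : O x -> partial i (fun x => H x 0 j) x = jacobian H x i j.
  by move=> Ox; rewrite jacobianE //; exact: dH.
have H0 : jacobian H x0 = 1%:M.
  apply/matrixP => i j; rewrite -pH //.
  rewrite (_ : (fun x => H x 0 j) = (fun y => \sum_k y 0 k * invmx B k j) \o G); last first.
    by apply/funext => x; rewrite /H mxE.
  pose l (y : 'rV[R]_n) := \sum_k y 0 k * invmx B k j.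
  have sl : smooth_on setT l.
    have oT : open (@setT 'rV[R]_n) by exact: openT.
    apply: smooth_on_sum => // k; apply: smooth_onM => //; first exact: smooth_on_coord.
    exact: smooth_on_cst.
  have pl k y : partial k l y = invmx B k j.
    rewrite /partial /l (_ : (fun y => _) =
        \sum_m ((fun y : 'rV[R]_n => y 0 m) * cst (invmx B m j))); last first.
      by apply/funext => z; rewrite fct_sumE.
    have dc m : derivable (fun y : 'rV[R]_n => y 0 m) y (bvec R k).
      exact/diff_derivable/differentiable_coord.
    rewrite derive_sum => [|m]; last by apply: derivableM => //; exact: derivable_cst.
    rewrite (bigD1 k) //= big1 => [|m mk].
      by rewrite deriveM // ?derive_cst ?derive_coord ?mxE ?eqxx ?scaler0 ?add0r ?addr0 /GRing.scale /= ?mulr1.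
    by rewrite deriveM // derive_cst derive_coord mxE (negbTE mk) andbF !scaler0 addr0.
  rewrite (partial_comp (h := l)) //; [|exact: dG|exact: (smooth_on_differentiable sl)].
  rewrite -(mulmxV uB) mxE; apply: eq_bigr => k _.
  by rewrite pl mulrC /B jacobianE //; exact: dG.
(* If the entries of the jacobian differ from those of the identity by less than e, the sum of n
   errors is at most half the norm of the vector. *)
pose e : R := (2 * n.+1%:R)^-1.
have e0 : 0 < e by rewrite invr_gt0 mulr_gt0.
have [r r0 Hr] : exists2 r, 0 < r & forall x, ball x0 r x -> O x /\
    forall i j, `|jacobian H x i j - (i == j)%:R| < e.
  have Hij : \forall x \near x0, forall ij, `|jacobian H x ij.1 ij.2 - (ij.1 == ij.2)%:R| < e.
    near=> x; move=> ij; move: ij; near: x; apply: filter_forall => -[i j] /=.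
    have c : {for x0, continuous (partial i (fun x => H x 0 j))}.
      apply: differentiable_continuous.
      exact: (smooth_on_differentiable (smooth_on_partial i (sH j))).
    have /cvgrPdist_lt/(_ _ e0) := c; rewrite pH // H0 mxE => Hn.
    near=> x; rewrite -pH; last by near: x; exact: open_nbhs_nbhs.
    by rewrite distrC; near: x.
  have /nbhs_ballP[r /= r0 Hr] : \forall x \near x0, O x /\
      forall ij, `|jacobian H x ij.1 ij.2 - (ij.1 == ij.2)%:R| < e.
    by near=> x; split; near: x => //; exact: open_nbhs_nbhs.
  by exists r => // x /Hr[Ox Hx]; split => // i j; exact: (Hx (i, j)).
pose W := ball x0 r.
have WO : W `<=` O by move=> x /Hr[].
have Jv x v : W x -> forall j, `|(v *m jacobian H x) 0 j - v 0 j| <= 2^-1 * `|v|.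
  move=> /Hr[_ Hx] j.
  have -> : (v *m jacobian H x) 0 j - v 0 j = \sum_i v 0 i * (jacobian H x i j - (i == j)%:R).
    rewrite mxE; under [RHS]eq_bigr do rewrite mulrBr.
    rewrite sumrB; congr (_ - _); rewrite (bigD1 j) //= eqxx mulr1 big1 ?addr0 // => i ij.
    by rewrite (negbTE ij) mulr0.
  apply: (le_trans (ler_norm_sum _ _ _)).
  apply: (@le_trans _ _ (\sum_(i < n) `|v| * e)).
    apply: ler_sum => i _; rewrite normrM; apply: ler_pM => //.
      exact: ler_norm_coord.
    exact: ltW.
  rewrite sumr_const card_ord -[X in X <= _]mulr_natl mulrCA mulrC ler_wpM2r //.
  rewrite /e invfM mulrCA ler_piMr ?invr_ge0 // ler_pdivrMr // mul1r ler_nat //.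
have JH x v : W x -> `|v *m jacobian H x - v| <= 2^-1 * `|v|.
  move=> Wx; rewrite norm_row_le ?mulr_ge0 ?invr_ge0 //; apply/forallP => j.
  by rewrite !mxE; have := Jv x v Wx j; rewrite mxE.
(* Mean value theorem for each coordinate of H - id on a segment, which stays in [W] because a ball
   is convex. *)
have H_expand x y : W x -> W y -> `|H x - H y - (x - y)| <= 2^-1 * `|x - y|.
  move=> Wx Wy; rewrite norm_row_le ?mulr_ge0 ?invr_ge0 //; apply/forallP => j.
  have seg (t : R) : t \in `[0, 1] -> W (t *: (x - y) + y).
    move=> t01; rewrite /W -ball_normE /=.
    have -> : x0 - (t *: (x - y) + y) = t *: (x0 - x) + (1 - t) *: (x0 - y).
      by apply/rowP => k; rewrite !mxE; ring.
    have t0 : 0 <= t by rewrite (itvP t01).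
    have t1 : 0 <= 1 - t by rewrite subr_ge0 (itvP t01).
    rewrite (le_lt_trans (ler_normD _ _)) // !normrZ !ger0_norm //.
    move: Wx Wy; rewrite /W -!ball_normE /= => Wx Wy.
    have [->|tn0] := eqVneq t 0; first by rewrite mul0r add0r subr0 mul1r.
    have tp : 0 < t by rewrite lt0r tn0.
    apply: (@lt_le_trans _ _ (t * r + (1 - t) * r)); last by rewrite -mulrDl addrCA subrr addr0 mul1r.
    by rewrite ltr_leD // ?ltr_pM2l // ler_wpM2l // ltW.
  pose f z := H z 0 j - z 0 j.
  have df z : W z -> derivable (fun x => H x 0 j) z (x - y) /\ derivable (fun z : 'rV[R]_n => z 0 j) z (x - y).
    move=> Wz; split; last exact/diff_derivable/differentiable_coord.
    by apply: diff_derivable; apply: (smooth_on_differentiable (sH j)); exact: WO.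
  have [t t01 E] := @mean_value _ _ f y (x - y) (fun t t01 =>
     derivableB (df _ (seg t t01)).1 (df _ (seg t t01)).2).
  have -> : (H x - H y - (x - y)) 0 j = f (x - y + y) - f y.
    by rewrite subrK /f !mxE; ring.
  rewrite E (deriveB (df _ (seg t t01)).1 (df _ (seg t t01)).2) derive_coord.
  have -> : 'D_(x - y) (fun x => H x 0 j) (t *: (x - y) + y) =
      ((x - y) *m jacobian H (t *: (x - y) + y)) 0 j.
    have dd := dH _ (WO _ (seg t t01)).
    by rewrite -(deriveEjacobian _ dd) derive_row // mxE.
  exact: Jv (seg t t01) j.
have oW : open W by exact: ball_open.
have sHW j : smooth_on W (fun x => H x 0 j) by exact: smooth_on_sub WO (sH j).
have GH x : G x = H x *m B by rewrite /H mulmxKV.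
have GW : G @` W = (fun y => y *m invmx B) @^-1` (H @` W).
  apply/seteqP; split => y /=; first by move=> [x Wx <-]; exists x.
  move=> [x Wx E]; exists x => //.
  by rewrite GH E mulmxKV.
exists W, (near_identity_inv H W \o (fun y => y *m invmx B)); split => //.
- exact: ballxx.
- rewrite GW; apply: open_comp; last exact: near_identity_open oW sHW H_expand JH.
  by move=> y _; exact: mulmxr_continuous.
- split=> [x Wx|h sh]; first exact: (near_identity_invK H_expand Wx).
  have oGW : open (G @` W).
    rewrite GW; apply: open_comp; last exact: near_identity_open oW sHW H_expand JH.
    by move=> y _; exact: mulmxr_continuous.
  apply: (smooth_on_comp oGW (T := fun y => y *m invmx B)
    (h := h \o near_identity_inv H W) _ _ (near_identity_inv_smooth oW sHW H_expand JH sh)).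
    move=> j; apply: (eq_smooth_on oGW (f := fun y => \sum_k y 0 k * invmx B k j)).
      by move=> y _; rewrite mxE.
    apply: smooth_on_sum => // k; apply: smooth_onM => //; first exact: smooth_on_coord.
    exact: smooth_on_cst.
  by rewrite GW.
Unshelve. all: by end_near. Qed.

End InverseFunction.

Local Open Scope complex_scope.
Local Notation cRe := (@complex.Re _).
Local Notation cIm := (@complex.Im _).

(** * The Cauchy-Riemann equation *)

Section BilinearDerivative.
Variables (R : realType) (V : normedModType R).
Variables (a b c d : V -> R) (x v : V).
Hypotheses (da : derivable a x v) (db : derivable b x v).
Hypotheses (dc : derivable c x v) (dd : derivable d x v).

Lemma derive_mulD : 'D_v (fun y => a y * c y + b y * d y) x =
  'D_v a x * c x + a x * 'D_v c x + ('D_v b x * d x + b x * 'D_v d x).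
Proof.
have D := is_deriveD (is_deriveM (derivableP da) (derivableP dc))
  (is_deriveM (derivableP db) (derivableP dd)).
by rewrite (@derive_val _ _ _ _ _ _ _ D) /GRing.scale /=; ring.
Qed.

Lemma derive_mulB : 'D_v (fun y => a y * c y - b y * d y) x =
  'D_v a x * c x + a x * 'D_v c x - ('D_v b x * d x + b x * 'D_v d x).
Proof.
have D := is_deriveB (is_deriveM (derivableP da) (derivableP dc))
  (is_deriveM (derivableP db) (derivableP dd)).
by rewrite (@derive_val _ _ _ _ _ _ _ D) /GRing.scale /=; ring.
Qed.

End BilinearDerivative.

Section ComplexDerivative.
Variable R : realType.
Implicit Types z w : R[i].

Lemma ReM z w : cRe (z * w) = cRe z * cRe w - cIm z * cIm w.
Proof. by case: z w => a b [c d]. Qed.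

Lemma ImM z w : cIm (z * w) = cRe z * cIm w + cIm z * cRe w.
Proof. by case: z w => a b [c d]. Qed.

Lemma complexP z w : cRe z = cRe w -> cIm z = cIm w -> z = w.
Proof. by case: z w => a b [c d] /= -> ->. Qed.

Variable n : nat.
Implicit Types (F G : 'rV[R]_n -> R[i]) (v x : 'rV[R]_n) (O : set 'rV[R]_n).

Definition cderive v F x : R[i] := 'D_v (cRe \o F) x +i* 'D_v (cIm \o F) x.

Definition cdifferentiable F x :=
  differentiable (cRe \o F) x /\ differentiable (cIm \o F) x.

Definition csmooth_on O F := smooth_on O (cRe \o F) /\ smooth_on O (cIm \o F).

Lemma csmooth_on_differentiable O F x : csmooth_on O F -> O x -> cdifferentiable F x.
Proof. by move=> [sr si] Ox; split; [exact: (smooth_on_differentiable sr)|exact: (smooth_on_differentiable si)]. Qed.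

Lemma cdifferentiableD F G x : cdifferentiable F x -> cdifferentiable G x ->
  cdifferentiable (fun x => F x + G x) x.
Proof.
move=> [f1 f2] [g1 g2]; split.
  rewrite (_ : _ \o _ = (cRe \o F) + (cRe \o G)); first exact: differentiableD.
  by apply/funext => y /=; rewrite fctE /= raddfD.
rewrite (_ : _ \o _ = (cIm \o F) + (cIm \o G)); first exact: differentiableD.
by apply/funext => y /=; rewrite fctE /= raddfD.
Qed.

Lemma cdifferentiableM F G x : cdifferentiable F x -> cdifferentiable G x ->
  cdifferentiable (fun x => F x * G x) x.
Proof.
move=> [f1 f2] [g1 g2]; split.
  rewrite (_ : _ \o _ = (cRe \o F) * (cRe \o G) - (cIm \o F) * (cIm \o G)).
    by apply: differentiableB; exact: differentiableM.
  by apply/funext => y; rewrite /= !fctE /= ReM.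
rewrite (_ : _ \o _ = (cRe \o F) * (cIm \o G) + (cIm \o F) * (cRe \o G)).
  by apply: differentiableD; exact: differentiableM.
by apply/funext => y; rewrite /= !fctE /= ImM.
Qed.

Lemma cderiveD F G x v : cdifferentiable F x -> cdifferentiable G x ->
  cderive v (fun x => F x + G x) x = cderive v F x + cderive v G x.
Proof.
move=> [f1 f2] [g1 g2]; apply: complexP => /=.
  rewrite -deriveD; [|exact: diff_derivable..].
  by congr ('D_v _ x); apply/funext => y /=; rewrite fctE /= raddfD.
rewrite -deriveD; [|exact: diff_derivable..].
by congr ('D_v _ x); apply/funext => y /=; rewrite fctE /= raddfD.
Qed.

Lemma cderiveM F G x v : cdifferentiable F x -> cdifferentiable G x ->
  cderive v (fun x => F x * G x) x = cderive v F x * G x + F x * cderive v G x.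
Proof.
move=> [f1 f2] [g1 g2].
have d1 : derivable (cRe \o F) x v by exact: diff_derivable.
have d2 : derivable (cIm \o F) x v by exact: diff_derivable.
have d3 : derivable (cRe \o G) x v by exact: diff_derivable.
have d4 : derivable (cIm \o G) x v by exact: diff_derivable.
apply: complexP; rewrite raddfD /= ?ReM ?ImM /=.
  rewrite (_ : _ \o _ = (fun y => cRe (F y) * cRe (G y) - cIm (F y) * cIm (G y))); last first.
    by apply/funext => y; exact: ReM.
  rewrite (derive_mulB d1 d2 d3 d4) /=.
  move: ('D_v _ x) ('D_v _ x) ('D_v _ x) ('D_v _ x) => p q r s; ring.
rewrite (_ : _ \o _ = (fun y => cRe (F y) * cIm (G y) + cIm (F y) * cRe (G y))); last first.
  by apply/funext => y; exact: ImM.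
rewrite (derive_mulD d1 d2 d4 d3) /=.
move: ('D_v _ x) ('D_v _ x) ('D_v _ x) ('D_v _ x) => p q r s; ring.
Qed.

Lemma cderive_cst (a : R[i]) x v : cderive v (fun=> a) x = 0.
Proof.
by apply: complexP; rewrite /= -/(cst _) (derive_cst).
Qed.

Lemma near_eq_cderive F G x v : (\near x, F x = G x) -> cderive v F x = cderive v G x.
Proof.
move=> FG; apply: complexP => /=; apply: near_eq_derive; apply: filterS FG => y /=.
  by move=> ->.
by move=> ->.
Qed.

Lemma cderiveE F x v : cdifferentiable F x ->
  cderive v F x = \sum_i (v 0 i)%:C * cderive (bvec R i) F x.
Proof.
move=> [f1 f2]; apply: complexP; rewrite raddf_sum /= derive_partialE //.
  by apply: eq_bigr => i _; rewrite /= mul0r subr0.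
by apply: eq_bigr => i _; rewrite /= mul0r addr0.
Qed.

Section Smooth.
Variable O : set 'rV[R]_n.
Hypothesis oO : open O.

Lemma csmooth_onD F G : csmooth_on O F -> csmooth_on O G ->
  csmooth_on O (fun x => F x + G x).
Proof.
move=> [f1 f2] [g1 g2]; split.
  by apply: (eq_smooth_on oO _ (smooth_onD oO f1 g1)) => x _; rewrite /= raddfD.
by apply: (eq_smooth_on oO _ (smooth_onD oO f2 g2)) => x _; rewrite /= raddfD.
Qed.

Lemma csmooth_onM F G : csmooth_on O F -> csmooth_on O G ->
  csmooth_on O (fun x => F x * G x).
Proof.
move=> [f1 f2] [g1 g2]; split.
  apply: (eq_smooth_on oO _ (smooth_onB oO (smooth_onM oO f1 g1) (smooth_onM oO f2 g2))).
  by move=> x _; rewrite /= ReM.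
apply: (eq_smooth_on oO _ (smooth_onD oO (smooth_onM oO f1 g2) (smooth_onM oO f2 g1))).
by move=> x _; rewrite /= ImM.
Qed.

Lemma csmooth_on_cst (a : R[i]) : csmooth_on O (fun=> a).
Proof. by split; exact: smooth_on_cst. Qed.

Lemma csmooth_onC f : smooth_on O f -> csmooth_on O (fun x => (f x)%:C).
Proof. by move=> sf; split => //; exact: smooth_on_cst. Qed.

Lemma csmooth_on_conj F : csmooth_on O F -> csmooth_on O (fun x => (F x)^*).
Proof.
move=> [f1 f2]; split.
  by apply: (eq_smooth_on oO _ f1) => x _ /=; case: (F x).
by apply: (eq_smooth_on oO _ (smooth_onN oO f2)) => x _ /=; case: (F x).
Qed.

Lemma csmooth_on_cderive F i : csmooth_on O F -> csmooth_on O (cderive (bvec R i) F).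
Proof. by move=> [f1 f2]; split; exact: smooth_on_partial. Qed.

Lemma eq_csmooth_on F G : (forall x, O x -> F x = G x) ->
  csmooth_on O F -> csmooth_on O G.
Proof.
by move=> FG [f1 f2]; split; [apply: (eq_smooth_on oO _ f1)|apply: (eq_smooth_on oO _ f2)] => x Ox /=; rewrite FG.
Qed.

End Smooth.
End ComplexDerivative.

(** * A maximum principle for subharmonic functions on cubes *)

Section MaximumPrinciple.
Variable R : realType.
Implicit Types (x y c : 'rV[R]_2) (f : 'rV[R]_2 -> R) (O : set 'rV[R]_2).

(** A positive second derivative would make the first one positive on a short segment starting at x,
    so f would exceed its maximum at the other end. The intermediate point must differ from x, hence
    [mean_value_oo]. *)
Lemma partial2_local_max O f x i : open O -> smooth_on O f -> O x ->
  (\forall y \near x, f y <= f x) -> partial i (partial i f) x <= 0.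
Proof.
move=> oO sf Ox fmax; rewrite leNgt; apply/negP => d2.
have df y : O y -> differentiable f y by exact: smooth_on_differentiable.
have d1 : partial i f x = 0.
  rewrite /partial; apply/eqP; rewrite -oppr_eq0 -deriveN; last exact/diff_derivable/df.
  apply/eqP/derive_local_min.
    by near=> y; apply: differentiableN; apply: df; near: y; exact: open_nbhs_nbhs.
  by near=> y; rewrite lerN2; near: y.
pose e := partial i (partial i f) x / 2; have e0 : 0 < e by rewrite divr_gt0.
have dp := smooth_on_differentiable (smooth_on_partial i sf) Ox.
have /nbhs_ballP[d /= d0 Hd] := differentiable_approxE dp e0.
have /nbhs_ballP[d' /= d'0 Hd'] : \forall y \near x, O y /\ f y <= f x.
  by near=> y; split; near: y => //; exact: open_nbhs_nbhs.
have [t t0 tm] : exists2 t, 0 < t & t < Num.min d d'.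
  have m0 : 0 < Num.min d d' by rewrite lt_min d0.
  by exists (Num.min d d' / 2); rewrite ?divr_gt0 // ltr_pdivrMr // ltr_pMr // ltr1n.
have nb : `|bvec R i| <= 1 :> R.
  rewrite norm_row_le //; apply/forallP => j; rewrite mxE eqxx.
  by case: (_ == _); rewrite /= ?normr1 ?normr0.
have small (s : R) : s \in `[0, 1] -> `|s *: (t *: bvec R i)| < Num.min d d'.
  move=> s01; rewrite !normrZ !ger0_norm ?(itvP s01) ?(ltW t0) //.
  apply: le_lt_trans tm; apply: (@le_trans _ _ (t * `|bvec R i|)); last by rewrite ger_pMr.
  by rewrite ler_piMl ?mulr_ge0 ?(ltW t0) // (itvP s01).
have B (s : R) : s \in `[0, 1] -> ball x d' (s *: (t *: bvec R i) + x).
  move=> s01; rewrite -ball_normE /= opprD addrC subrK normrN.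
  by have := small s s01; rewrite lt_min => /andP[].
have [s s01] : exists2 s : R, s \in `]0, 1[ &
    f (t *: bvec R i + x) - f x = 'D_(t *: bvec R i) f (s *: (t *: bvec R i) + x).
  by apply: mean_value_oo => s s01; apply: diff_derivable; apply: df; exact: (Hd' _ (B s s01)).1.
have s01' := subset_itv_oo_cc s01.
rewrite derive_dirZ; last by apply: df; exact: (Hd' _ (B s s01')).1.
have s0 : 0 < s by rewrite (itvP s01).
move=> E; have : 0 < 'D_(bvec R i) f (s *: (t *: bvec R i) + x).
  have Hb : ball 0 d (s *: (t *: bvec R i)).
    by rewrite -ball_normE /= sub0r normrN; have := small s s01'; rewrite lt_min => /andP[].
  have := Hd _ Hb; rewrite d1 subr0 scalerA -(deriveE _ dp) derive_dirZ //.
  rewrite -/(partial i (partial i f) x) -/(partial i f _) normrZ.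
  have st0 : 0 < s * t by rewrite mulr_gt0.
  rewrite (gtr0_norm st0) => H.
  have {H} : `|partial i f ((s * t) *: bvec R i + x) - s * t * partial i (partial i f) x| <= e * (s * t).
    by apply: (le_trans H); rewrite ler_wpM2l ?(ltW e0) // ger_pMr.
  rewrite ler_norml => /andP[H _].
  have : s * t * partial i (partial i f) x = 2 * (e * (s * t)) by rewrite /e; field.
  have : 0 < e * (s * t) by rewrite mulr_gt0.
  by lra.
move=> H; have : 0 < t * 'D_(bvec R i) f (s *: (t *: bvec R i) + x) by rewrite mulr_gt0.
rewrite -E subr_gt0 ltNge => /negP; apply.
have I1 : (1 : R) \in `[0, 1] by rewrite in_itv /= ler01 lexx.
by have := (Hd' _ (B 1 I1)).2; rewrite scale1r.
Unshelve. all: by end_near. Qed.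

(** Adding e (y_0 - c_0)^2 raises the Laplacian to at least 2e > 0, which excludes an interior
    maximum on the compact cube. The choice e = e'/r^2 keeps the perturbation at most e'. *)
Lemma maximum_principle O f c (r M : R) : open O -> smooth_on O f -> 0 < r ->
  (forall x, `|x - c| <= r -> O x) ->
  (forall x, O x -> 0 <= partial 0 (partial 0 f) x + partial 1 (partial 1 f) x) ->
  (forall x, `|x - c| = r -> f x <= M) ->
  forall x, `|x - c| <= r -> f x <= M.
Proof.
move=> oO sf r0 cO Lf fM x xr; apply/ler_addgt0Pr => e' e'0.
pose e := e' / r ^+ 2; have e0 : 0 < e by rewrite divr_gt0 // exprn_gt0.
pose q (y : 'rV[R]_2) := y 0 0 - c 0 0.
have sq : smooth_on O q.
  by apply: smooth_onB => //; [exact: smooth_on_coord|exact: smooth_on_cst].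
pose g y := f y + e * (q y * q y).
have sq2 : smooth_on O (fun y => e * (q y * q y)).
  by apply: smooth_onM => //; [exact: smooth_on_cst|exact: smooth_onM].
have sg : smooth_on O g by exact: smooth_onD.
have dfO h y i : smooth_on O h -> O y -> derivable h y (bvec R i).
  by move=> sh Oy; apply: diff_derivable; exact: smooth_on_differentiable sh Oy.
have pq i y : O y -> partial i q y = (i == 0)%:R.
  move=> Oy; rewrite /partial /q deriveB; [|exact/diff_derivable/differentiable_coord|exact: derivable_cst].
  by rewrite derive_cst subr0 derive_coord mxE eqxx eq_sym.
have pe i y : O y -> partial i (fun y => e * (q y * q y)) y = e * (2 * (i == 0)%:R) * q y.
  move=> Oy; rewrite /partial derive_cmul; last exact: dfO (smooth_onM oO sq sq) Oy.
  have dq := dfO _ _ i sq Oy.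
  by rewrite (deriveM dq dq) -/(partial i q y) pq // /GRing.scale /=; ring.
have pe2 i y : O y -> partial i (partial i (fun y => e * (q y * q y))) y = 2 * e * (i == 0)%:R.
  move=> Oy; rewrite {1}/partial (@near_eq_derive _ _ _ _ (fun y => e * (2 * (i == 0)%:R) * q y)); last first.
    by near=> z; apply: pe; near: z; exact: open_nbhs_nbhs.
  rewrite derive_cmul; last exact: dfO.
  by rewrite -/(partial i q y) pq //; case: (i == 0); rewrite ?mulr1 ?mulr0 // mulrC.
have pg i y : O y -> partial i (partial i g) y = partial i (partial i f) y + 2 * e * (i == 0)%:R.
  move=> Oy; rewrite -(pe2 _ _ Oy) {1}/partial (@near_eq_derive _ _ _ _
     (fun y => partial i f y + partial i (fun y => e * (q y * q y)) y)); last first.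
    near=> z; have Oz : O z by near: z; exact: open_nbhs_nbhs.
    by rewrite /partial -deriveD //; exact: dfO.
  by rewrite (deriveD (f := partial i f)) //; exact: dfO (smooth_on_partial _ _) Oy.
have [|||xi /[!inE] /= xis Hmax] := @EVT_max_rV R 2 g [set y | `|y - c| <= r].
- by exists c; rewrite /= subrr normr0 ltW.
- by apply: closed_cube_compact; exact: ltW.
- apply: continuous_in_subspaceT => y /[!inE] /= ys.
  apply: differentiable_continuous; apply: (smooth_on_differentiable sg); exact: cO.
have qr y : `|y - c| <= r -> e * (q y * q y) <= e'.
  move=> yr; have eE : e * r ^+ 2 = e' by rewrite /e divfK // gt_eqF // exprn_gt0.
  rewrite -[leRHS]eE ler_pM2l // -expr2 -[leLHS]real_normK ?num_real // ler_pXn2r ?nnegrE ?(ltW r0) //.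
  by have := ler_norm_coord (y - c) 0; rewrite !mxE => /le_trans; apply.
have fg : f x <= g x by rewrite /g lerDl mulr_ge0 ?(ltW e0) // -expr2 sqr_ge0.
apply: (le_trans fg); apply: (@le_trans _ _ (g xi)); first by apply: Hmax; rewrite inE.
have [xiE|xin] := eqVneq `|xi - c| r.
  by rewrite /g lerD ?fM ?qr.
exfalso; have xilt : `|xi - c| < r by rewrite lt_neqAle xin.
have Oxi := cO _ xis.
have lm : \forall y \near xi, g y <= g xi.
  have oB : nbhs xi (ball c r).
    apply: open_nbhs_nbhs; split; first exact: ball_open.
    by rewrite -ball_normE /= distrC.
  near=> y; apply: Hmax; rewrite inE /= ltW // distrC.
  suff : ball c r y by rewrite -ball_normE.
  by near: y.
have h0 := partial2_local_max 0 oO sg Oxi lm; have h1 := partial2_local_max 1 oO sg Oxi lm.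
have L := Lf _ Oxi; have E0 := pg 0 xi Oxi; have E1 := pg 1 xi Oxi.
rewrite eqxx mulr1 in E0; rewrite (_ : ((1 : 'I_2) == 0) = false) // mulr0 addr0 in E1.
rewrite E0 in h0; rewrite E1 in h1.
move: (partial 0 _ xi) (partial 1 _ xi) h0 h1 L => p q' h0 h1 L.
by clear - e0 h0 h1 L; lra.
Unshelve. all: by end_near. Qed.

End MaximumPrinciple.

(** * Solutions of the Cauchy-Riemann equation and their zeros *)

Section CauchyRiemann.
Variable R : realType.
Implicit Types (x y c v : 'rV[R]_2) (F G H : 'rV[R]_2 -> R[i]) (O : set 'rV[R]_2).

(** Twice the Wirtinger derivative with respect to the conjugate of z. *)
Definition dbar F x : R[i] :=
  cderive (bvec R 0) F x + 'i%C * cderive (bvec R 1) F x.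

Definition CR O F := csmooth_on O F /\ forall x, O x -> dbar F x = 0.

Lemma dbarM F G x : cdifferentiable F x -> cdifferentiable G x ->
  dbar (fun x => F x * G x) x = dbar F x * G x + F x * dbar G x.
Proof.
move=> dF dG; rewrite /dbar !cderiveM //.
move: (cderive _ F x) (cderive _ F x) (cderive _ G x) (cderive _ G x) => a b p q.
by move: (F x) (G x) 'i%C => u w j; ring.
Qed.

Lemma CR_mul O F G : open O -> CR O F -> CR O G -> CR O (fun x => F x * G x).
Proof.
move=> oO [sF cF] [sG cG]; split; first exact: csmooth_onM.
move=> x Ox; rewrite dbarM ?cF ?cG ?mul0r ?mulr0 ?addr0 //.
  exact: csmooth_on_differentiable sF Ox.
exact: csmooth_on_differentiable sG Ox.
Qed.

Lemma CR_cst O (a : R[i]) : CR O (fun=> a).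
Proof.
by split=> [|x Ox]; [exact: csmooth_on_cst|rewrite /dbar !cderive_cst mulr0 addr0].
Qed.

Lemma CR_exp O F n : open O -> CR O F -> CR O (fun x => F x ^+ n).
Proof.
move=> oO cF; elim: n => [|n IH]; first by apply: CR_cst.
by under eq_fun do rewrite exprS; exact: CR_mul.
Qed.

Lemma CR_sub O O' F : O' `<=` O -> CR O F -> CR O' F.
Proof.
by move=> OO [[f1 f2] cF]; split; [split; exact: smooth_on_sub OO _|move=> x /OO; exact: cF].
Qed.

Definition zcoord c x : R[i] := (x 0 0 - c 0 0) +i* (x 0 1 - c 0 1).

Lemma derive_coordB c x v (j : 'I_2) :
  'D_v (fun x : 'rV[R]_2 => x 0 j - c 0 j) x = v 0 j.
Proof.
rewrite deriveB; [|exact/diff_derivable/differentiable_coord|exact: derivable_cst].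
by rewrite derive_cst subr0 derive_coord.
Qed.

Lemma CR_zcoord O c : open O -> CR O (zcoord c).
Proof.
move=> oO; split.
  by split; apply: smooth_onB => //; first [exact: smooth_on_coord|exact: smooth_on_cst].
move=> x Ox; rewrite /dbar /cderive !derive_coordB !mxE /=.
by apply: complexP => /=; ring.
Qed.

Definition normsq F x : R := cRe (F x) * cRe (F x) + cIm (F x) * cIm (F x).

Lemma normsqM F G x : normsq (fun x => F x * G x) x = normsq F x * normsq G x.
Proof. by rewrite /normsq ReM ImM; ring. Qed.

Lemma normsq_ge0 F x : 0 <= normsq F x.
Proof. by rewrite addr_ge0 // -expr2 sqr_ge0. Qed.

Lemma normsq_eq0 F x : normsq F x = 0 -> F x = 0.
Proof.
move/eqP; rewrite /normsq -!expr2 paddr_eq0 ?sqr_ge0 // !sqrf_eq0 => /andP[/eqP a /eqP b].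
exact: complexP.
Qed.

(** Smoothness is read off from conj(F) / |F|^2; the equation then follows from the product rule
    applied to F F^-1 = 1. *)
Lemma CR_inv O F : open O -> CR O F -> (forall x, O x -> F x != 0) ->
  CR O (fun x => (F x)^-1).
Proof.
move=> oO [sF cF] F0.
have n0 x : O x -> normsq F x != 0.
  by move=> Ox; apply/eqP => /normsq_eq0 E; have := F0 x Ox; rewrite E eqxx.
have sn : smooth_on O (normsq F).
  by case: sF => f1 f2; apply: smooth_onD => //; exact: smooth_onM.
have si : smooth_on O (fun x => (normsq F x)^-1) by exact: smooth_onV.
have sI : csmooth_on O (fun x => (F x)^-1).
  case: sF => f1 f2; split.
    apply: (eq_smooth_on oO _ (smooth_onM oO f1 si)) => x Ox /=.
    by rewrite /normsq; case: (F x) => a b /=; rewrite !expr2.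
  apply: (eq_smooth_on oO _ (smooth_onN oO (smooth_onM oO f2 si))) => x Ox /=.
  by rewrite /normsq; case: (F x) => a b /=; rewrite !expr2.
split=> // x Ox.
have dF := csmooth_on_differentiable sF Ox; have dI := csmooth_on_differentiable sI Ox.
have := dbarM dF dI; rewrite cF // mul0r add0r.
rewrite {1}/dbar !(@near_eq_cderive _ _ (fun x => F x * (F x)^-1) (fun=> 1)); last 2 first.
  near=> y; have Oy : O y by near: y; exact: open_nbhs_nbhs.
  by rewrite mulfV // F0.
  near=> y; have Oy : O y by near: y; exact: open_nbhs_nbhs.
  by rewrite mulfV // F0.
rewrite !cderive_cst mulr0 addr0 => /esym/eqP; rewrite mulf_eq0 (negbTE (F0 x Ox)) /=.
by move/eqP.
Unshelve. all: by end_near. Qed.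

Lemma CR_real O F x : O x -> CR O F ->
  partial 0 (cRe \o F) x = partial 1 (cIm \o F) x /\
  partial 1 (cRe \o F) x = - partial 0 (cIm \o F) x.
Proof.
move=> Ox [_ /(_ x Ox)]; rewrite /dbar /cderive /partial.
move: ('D__ (cRe \o F) x) ('D__ (cIm \o F) x) => a b.
move: ('D__ (cRe \o F) x) ('D__ (cIm \o F) x) => c d E.
have := congr1 cRe E; have := congr1 cIm E => /=.
by rewrite !mul0r !mul1r sub0r add0r => H1 H2; split; lra.
Qed.

Section RealPart.
Variables (O : set 'rV[R]_2) (F : 'rV[R]_2 -> R[i]).
Hypotheses (oO : open O) (cF : CR O F).
Let a : 'rV[R]_2 -> R := cRe \o F.
Let b : 'rV[R]_2 -> R := cIm \o F.
Let sa : smooth_on O a. Proof. by case: cF => -[]. Qed.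
Let sb : smooth_on O b. Proof. by case: cF => -[]. Qed.

Let partialE (f g : 'rV[R]_2 -> R) i x : O x -> (forall y, O y -> f y = g y) ->
  partial i f x = partial i g x.
Proof.
move=> Ox fg; rewrite /partial; apply: near_eq_derive; near=> y; apply: fg.
by near: y; exact: open_nbhs_nbhs.
Unshelve. all: by end_near. Qed.

Let dO (f : 'rV[R]_2 -> R) x v : smooth_on O f -> O x -> derivable f x v.
Proof. by move=> sf Ox; apply: diff_derivable; exact: smooth_on_differentiable sf Ox. Qed.

Let harm x : O x ->
  partial 0 (partial 0 a) x + partial 1 (partial 1 a) x = 0 /\
  partial 0 (partial 0 b) x + partial 1 (partial 1 b) x = 0.
Proof.
move=> Ox.
have E1 y : O y -> partial 0 a y = partial 1 b y by move=> Oy; have [] := CR_real Oy cF.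
have E2 y : O y -> partial 1 a y = - partial 0 b y by move=> Oy; have [] := CR_real Oy cF.
have E3 y : O y -> partial 0 b y = - partial 1 a y by move=> Oy; rewrite E2 // opprK.
have nD i (f : 'rV[R]_2 -> R) : smooth_on O f -> partial i (fun y => - f y) x = - partial i f x.
  by move=> sf; rewrite /partial deriveN //; exact: dO.
split.
  rewrite (partialE 0 Ox E1) (partialE 1 Ox E2) nD; last exact: smooth_on_partial.
  by rewrite (partial_commute 0 1 oO sb Ox) subrr.
rewrite (partialE 0 Ox E3) (partialE 1 Ox (fun y Oy => esym (E1 y Oy))) nD; last exact: smooth_on_partial.
by rewrite (partial_commute 0 1 oO sa Ox) addNr.
Qed.

Let pn i y : O y -> partial i (normsq F) y = 2 * (a y * partial i a y + b y * partial i b y).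
Proof.
move=> Oy; have da := @dO a y (bvec R i) sa Oy; have db := @dO b y (bvec R i) sb Oy.
rewrite {1}/partial (derive_mulD da db da db) -!/(partial _ _ _).
by move: (partial i a y) (partial i b y) => p q; rewrite /a /b /=; ring.
Qed.

Let pn2 i y : O y -> partial i (partial i (normsq F)) y =
  2 * (partial i a y ^+ 2 + partial i b y ^+ 2
    + (a y * partial i (partial i a) y + b y * partial i (partial i b) y)).
Proof.
move=> Oy; rewrite (partialE i Oy (fun z Oz => pn i Oz)).
have da := @dO a y (bvec R i) sa Oy; have db := @dO b y (bvec R i) sb Oy.
have dpa := @dO _ y (bvec R i) (smooth_on_partial i sa) Oy.
have dpb := @dO _ y (bvec R i) (smooth_on_partial i sb) Oy.
rewrite {1}/partial derive_cmul; last first.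
  exact: (derivableD (derivableM da dpa) (derivableM db dpb)).
rewrite (derive_mulD da db dpa dpb) -!/(partial _ _ _).
move: (partial i (partial i a) y) (partial i (partial i b) y) (partial i a y) (partial i b y).
by move=> p q r s; ring.
Qed.

(** Real and imaginary parts are harmonic, so only twice the sum of the squares of their first
    partial derivatives remains. *)
Lemma laplacian_normsq_ge0 x : O x ->
  0 <= partial 0 (partial 0 (normsq F)) x + partial 1 (partial 1 (normsq F)) x.
Proof.
move=> Ox; rewrite !pn2 //; have [h1 h2] := harm Ox.
rewrite -mulrDr mulr_ge0 // addrACA; apply: addr_ge0.
  by do 2 apply: addr_ge0; rewrite ?addr_ge0 ?sqr_ge0.
move: (partial 0 (partial 0 a) x) (partial 0 (partial 0 b) x) h1 h2 => p q h1 h2.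
move: (partial 1 (partial 1 a) x) (partial 1 (partial 1 b) x) h1 h2 => p' q' h1 h2.
have -> : a x * p + b x * q + (a x * p' + b x * q') = a x * (p + p') + b x * (q + q') by ring.
by rewrite h1 h2 !mulr0 addr0.
Qed.

End RealPart.

(* Maximum principle for F / (z - c)^n with n arbitrarily large. *)
Lemma CR_vanish_cube O F c (r e : R) : open O -> CR O F -> 0 < r -> 0 < e ->
  (forall x, `|x - c| <= r -> O x) -> (forall x, ball c e x -> F x = 0) ->
  forall x, `|x - c| < r / 2 -> F x = 0.
Proof.
move=> oO cF r0 e0 cO F0 x xr.
have [->|xc] := eqVneq x c; first by apply: F0; exact: ballxx.
have [[sF1 sF2] _] := cF.
have snF : smooth_on O (normsq F) by apply: smooth_onD => //; exact: smooth_onM.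
have [C HC] : exists C, forall y, `|y - c| <= r -> `|normsq F y| <= C.
  apply: continuous_closed_cube_bounded; first exact: ltW.
  move=> y yr; apply: differentiable_continuous; apply: (smooth_on_differentiable snF); exact: cO.
pose Z := zcoord c; pose D := normsq Z.
have ZN y : y != c -> Z y != 0.
  apply: contraNneq => Zy; apply/eqP/rowP => j.
  have := congr1 cRe Zy; have := congr1 cIm Zy => /= /eqP + /eqP; rewrite !subr_eq0 => /eqP h1 /eqP h0.
  by case: (unliftP 0 j) => [k ->|-> //]; rewrite (_ : lift 0 k = 1) //; apply/val_inj; rewrite /= (ord1 k).
have Dp y : y != c -> 0 < D y.
  move=> yc; rewrite lt0r normsq_ge0 andbT; apply/eqP => /normsq_eq0 E.
  by have := ZN y yc; rewrite E eqxx.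
pose O1 := O `&` [set y | y != c].
have oN : open [set y : 'rV[R]_2 | y != c].
  rewrite (_ : [set y | y != c] = ~` [set c]).
    apply: closed_openC; apply: accessible_closed_set1; apply: hausdorff_accessible.
    exact: norm_hausdorff.
  by apply/seteqP; split => y /= /eqP.
have oO1 : open O1 by exact: openI.
have cZ : CR O1 (fun y => (Z y)^-1).
  by apply: CR_inv => //; [exact: CR_zcoord|move=> y [_]; exact: ZN].
(* The function |F|^2 / |z - c|^(2n) is subharmonic. On the boundary of the cube it is at most C /
   r^(2n), since the Euclidean norm dominates the sup norm, equal to r there. *)
have bound n : normsq F x <= C * (D x / r ^+ 2) ^+ n.
  pose phi := normsq (fun y => F y * (Z y)^-1 ^+ n).
  have cH : CR O1 (fun y => F y * (Z y)^-1 ^+ n).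
    apply: CR_mul => //; first by apply: CR_sub cF => y [].
    exact: CR_exp.
  have phi0 y : ball c e y -> phi y = 0.
    by move=> yb; rewrite /phi normsqM /normsq F0 //= !mul0r addr0 mul0r.
  have s1 : smooth_on O1 phi.
    by case: cH => -[h1 h2] _; apply: smooth_onD => //; exact: smooth_onM.
  have s2 : smooth_on (ball c e) phi.
    apply: (eq_smooth_on (ball_open _ _) _ (@smooth_on_cst R 2 _ 0)) => y yb.
    by rewrite phi0.
  (* The pole at [c] is harmless: [phi] is smooth away from [c], and it is identically 0 on the ball
     where F vanishes. *)
  have OO y : O y -> (O1 `|` ball c e) y.
    move=> Oy; have [->|yc] := eqVneq y c; first by right; exact: ballxx.
    by left.
  have sphi : smooth_on O phi by apply: smooth_on_sub OO _; exact: smooth_onU.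
  have lap y : O y -> 0 <= partial 0 (partial 0 phi) y + partial 1 (partial 1 phi) y.
    move=> /OO [Oy|yb]; first exact: (laplacian_normsq_ge0 oO1 cH Oy).
    have z0 i : partial i phi y = 0 /\ partial i (partial i phi) y = 0.
      have nb z : ball c e z -> \near z, phi z = cst 0 z.
        move=> zb; near=> w; apply: phi0; near: w.
        by apply: open_nbhs_nbhs; split => //; exact: ball_open.
      have p1 z : ball c e z -> partial i phi z = 0.
        by move=> zb; rewrite /partial (near_eq_derive _ (nb z zb)) derive_cst.
      split; first exact: p1.
      rewrite {1}/partial (@near_eq_derive _ _ _ _ (cst 0)) ?derive_cst //.
      near=> w; apply: p1; near: w.
      by apply: open_nbhs_nbhs; split => //; exact: ball_open.
    by rewrite (z0 0).2 (z0 1).2 addr0.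
  have phiE y : y != c -> phi y = normsq F y * (D y)^-1 ^+ n.
    move=> yc; rewrite /phi normsqM; congr (_ * _).
    have E m : normsq (fun y => (Z y)^-1 ^+ m) y = normsq (fun y => (Z y)^-1) y ^+ m.
      elim: m => [|m IH]; first by rewrite /normsq !expr0 /= mul1r mul0r addr0.
      rewrite [RHS]exprS -IH -normsqM; congr (normsq _ y).
      by apply/funext => z; rewrite exprS.
    rewrite E; congr (_ ^+ _).
    apply: (mulIf (x := D y)); first by rewrite gt_eqF ?Dp.
    rewrite mulVf ?gt_eqF ?Dp // -normsqM /normsq mulVf ?ZN //= mul1r mul0r addr0 //.
  have max_b y : `|y - c| = r -> phi y <= C * (r ^+ 2)^-1 ^+ n.
    move=> yr; have yc : y != c.
      by apply/eqP => E; move: yr; rewrite E subrr normr0 => r0'; rewrite -r0' ltxx in r0.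
    have Cge : normsq F y <= C by apply: le_trans (ler_norm _) (HC _ _); rewrite yr.
    rewrite phiE //; apply: ler_pM => //; first exact: normsq_ge0.
      by rewrite exprn_ge0 // invr_ge0 normsq_ge0.
    have rD : r ^+ 2 <= D y.
      have [j Hj] : exists j, r <= `|(y - c) 0 j|.
        apply: contrapT => nH; move: (lexx r); rewrite -{2}yr leNgt => /negP; apply.
        rewrite [ltLHS]/Num.Def.normr/= mx_normrE; apply: bigmax_lt => // -[i j] _ /=.
        by rewrite (ord1 i) ltNge; apply/negP => ?; apply: nH; exists j.
      have Hj2 : r ^+ 2 <= (y 0 j - c 0 j) * (y 0 j - c 0 j).
        rewrite -expr2 -[leRHS]real_normK ?num_real // ler_pXn2r ?nnegrE ?(ltW r0) //.
        by move: Hj; rewrite !mxE.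
      apply: (le_trans Hj2); rewrite /D /normsq /=.
      case: (unliftP 0 j) => [k ->|->]; last by rewrite lerDl -expr2 sqr_ge0.
      rewrite (_ : lift 0 k = 1); last by apply/val_inj; rewrite /= (ord1 k).
      by rewrite lerDr -expr2 sqr_ge0.
    rewrite lerXn2r ?nnegrE ?invr_ge0 ?normsq_ge0 ?exprn_ge0 ?(ltW r0) //.
    by rewrite lef_pV2 // posrE ?Dp // exprn_gt0.
  have xr' : `|x - c| <= r.
    by apply/ltW/(lt_le_trans xr); rewrite ler_pdivrMr // ler_peMr ?(ltW r0) // ler1n.
  have := maximum_principle oO sphi r0 cO lap max_b xr'.
  rewrite phiE // => H.
  have Dn : 0 < D x ^+ n by rewrite exprn_gt0 ?Dp.
  move: H; rewrite exprVn ler_pdivrMr // => H; apply: (le_trans H).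
  by rewrite expr_div_n exprVn mulrAC mulrA.
(* Both coordinates of x - c are below r/2, so the squared Euclidean distance is at most r^2/2. This
   is why the conclusion is limited to radius r/2: the bound then decays like 2^(-n). *)
have D12 : D x / r ^+ 2 <= 2^-1.
  rewrite ler_pdivrMr ?exprn_gt0 //.
  have h j : (x 0 j - c 0 j) * (x 0 j - c 0 j) <= (r / 2) ^+ 2.
    rewrite -expr2 -[leLHS]real_normK ?num_real // ler_pXn2r ?nnegrE ?divr_ge0 ?(ltW r0) //.
    by have := ler_norm_coord (x - c) j; rewrite !mxE => /le_trans; apply; exact: ltW.
  have := h 0; have := h 1; rewrite /D /normsq /= => h1 h0.
  apply: (le_trans (lerD h0 h1)); rewrite le_eqVlt; apply/orP; left; apply/eqP; by field.
apply: normsq_eq0; apply/eqP; rewrite eq_le normsq_ge0 andbT leNgt; apply/negP => Fp.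
have C0 : 0 < C.
  rewrite (lt_le_trans Fp) // (le_trans (ler_norm _)) // HC //.
  by apply/ltW/(lt_le_trans xr); rewrite ler_pdivrMr // ler_peMr ?(ltW r0) // ler1n.
have [n Hn] : exists n : nat, C / normsq F x < n%:R.
  exists (Num.bound (C / normsq F x)); apply: archi_boundP.
  by rewrite divr_ge0 ?ltW.
have := bound n; apply/negP; rewrite -ltNge.
apply: (@le_lt_trans _ _ (C * 2^-1 ^+ n)).
  rewrite ler_pM2l // lerXn2r ?nnegrE ?invr_ge0 // divr_ge0 ?normsq_ge0 // exprn_ge0 // ltW //.
rewrite exprVn ltr_pdivrMr ?exprn_gt0 // mulrC -ltr_pdivrMr //.
apply: (lt_trans Hn); rewrite -natrX ltr_nat; exact: ltn_expl.
Unshelve. all: by end_near. Qed.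

End CauchyRiemann.

Import Normc.

(** * Complex differentiability and the operator dbar *)

Section ComplexDerivable.
Variable R : realType.
Implicit Types (x : 'rV[R]_2) (F : 'rV[R]_2 -> R[i]).

Lemma normcRe (z : R[i]) : `|cRe z| <= normc z.
Proof. by rewrite -lecR; exact: normc_ge_Re. Qed.

Lemma normcIm (z : R[i]) : `|cIm z| <= normc z.
Proof.
case: z => a b; rewrite /normc /= -sqrtr_sqr ler_wsqrtr // lerDr; exact: sqr_ge0.
Qed.

Lemma normc_le_ReIm (z : R[i]) : normc z <= `|cRe z| + `|cIm z|.
Proof.
case: z => a b; rewrite -[a +i* b]/(complex.Re (a +i* b) +i* complex.Im (a +i* b)).
have -> : a +i* b = a%:C + (0 +i* b) by apply: complexP; rewrite /= ?addr0 ?add0r.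
rewrite (le_trans (le_normcD _ _)) // /normc /= expr0n /= addr0 add0r.
by rewrite !sqrtr_sqr addr0 add0r.
Qed.

Lemma rV_of_complexK x : rV_of_complex (complex_of_rV x) = x.
Proof.
apply/rowP => j; rewrite mxE; case: (unliftP 0 j) => [k ->|->] //.
by rewrite (_ : lift 0 k = 1) //; apply/val_inj; rewrite /= (ord1 k).
Qed.

Lemma rV_of_complexD (z w : R[i]) :
  rV_of_complex (z + w) = rV_of_complex z + rV_of_complex w.
Proof. by apply/rowP => j; rewrite !mxE; case: ifP; rewrite raddfD. Qed.

Lemma norm_rV_of_complex (z : R[i]) : `|rV_of_complex z| <= normc z.
Proof.
rewrite norm_row_le; last by case: z => a b; exact: sqrtr_ge0.
by apply/forallP => j; rewrite mxE; case: ifP => _; [exact: normcRe|exact: normcIm].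
Qed.

(** The limit is taken over [R[i]] normed by itself, where a positive epsilon or delta is an element
    with zero imaginary part. The equivalence passes to real epsilon and delta. *)
Lemma derivable_approx F x (l : R[i]) :
  (forall e : R, 0 < e -> exists2 d, 0 < d & forall h : R[i], normc h < d ->
     normc (F (rV_of_complex h + x) - F x - h * l) <= e * normc h) <->
  (fun h : R[i]^o => h^-1 *: (((F \o @rV_of_complex R : R[i]^o -> R[i]^o) \o
      shift (complex_of_rV x)) (h *: 1) - F (rV_of_complex (complex_of_rV x)))) @ 0^' --> (l : R[i]^o).
Proof.
have E (h : R[i]) : h != 0 -> normc (l - h^-1 * (F (rV_of_complex h + x) - F x)) * normc h =
    normc (F (rV_of_complex h + x) - F x - h * l).
  move=> h0; rewrite -normcM mulrBl mulrAC mulVf // mul1r -normcN opprB mulrC.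
  by [].
have R0 (h : R[i]) : ((F \o @rV_of_complex R : R[i]^o -> R[i]^o) \o
      shift (complex_of_rV x)) (h *: (1 : R[i]^o)) = F (rV_of_complex h + x).
  by rewrite /= rV_of_complexD rV_of_complexK -[h *: 1]/(h * 1) mulr1.
split=> [H|].
  apply/cvgrPdist_le => e e0.
  have [Ie Re0] : cIm e = 0 /\ 0 < cRe e.
    by move: e0; rewrite ltcE /= => /andP[/eqP -> ->].
  have [d d0 Hd] := H _ Re0.
  exists d%:C; first by rewrite /= ltcR.
  move=> h /=; rewrite sub0r normrN => hd hn0; have {}hd : normc h < d by rewrite -ltcR.
  have hp : 0 < normc h.
    rewrite lt_neqAle eq_sym; apply/andP; split; last by case: (h) => a b; exact: sqrtr_ge0.
    by apply: contra hn0 => /eqP/eq0_normc ->.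
  have -> : e = (cRe e)%:C by apply: complexP.
  rewrite lecR -(ler_pM2r hp) rV_of_complexK.
  have := R0 h; rewrite /= => ->.
  by rewrite E //; exact: Hd.
move=> /cvgrPdist_le H e e0; have e0' : (0 : R[i]) < e%:C by rewrite ltcR.
have [d /= d0 Hd] := H _ e0'.
have [Id Rd0] : cIm d = 0 /\ 0 < cRe d by move: d0; rewrite ltcE /= => /andP[/eqP -> ->].
exists (cRe d) => // h hd.
have [->|hn0] := eqVneq h 0.
  have -> : rV_of_complex (0 : R[i]) = 0 by apply/rowP => j; rewrite !mxE; case: ifP.
  by rewrite add0r subrr mul0r subr0 normc0 mulr0.
have := Hd h; rewrite /= sub0r normrN => /(_ _ hn0).
have -> : d = (cRe d)%:C by apply: complexP.
rewrite ltcR => /(_ hd); have := R0 h; rewrite /= rV_of_complexK => ->.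
rewrite lecR -E // => H'; rewrite ler_wpM2r //.
by case: (h) => a b; exact: sqrtr_ge0.
Qed.

Lemma diff_partial2 (f : 'rV[R]_2 -> R) x k : differentiable f x ->
  'd f x k = k 0 0 * partial 0 f x + k 0 1 * partial 1 f x.
Proof.
move=> df; rewrite -(deriveE _ df) derive_partialE // !big_ord_recl big_ord0 addr0.
by rewrite (_ : lift ord0 ord0 = 1) //; exact/val_inj.
Qed.

Let partials F x : cdifferentiable F x -> forall e : R, 0 < e ->
  exists2 d, 0 < d & forall k : 'rV[R]_2, `|k| < d ->
    `|cRe (F (k + x) - F x) - (k 0 0 * partial 0 (cRe \o F) x + k 0 1 * partial 1 (cRe \o F) x)| <= e * `|k| /\
    `|cIm (F (k + x) - F x) - (k 0 0 * partial 0 (cIm \o F) x + k 0 1 * partial 1 (cIm \o F) x)| <= e * `|k|.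
Proof.
move=> [dr di] e e0.
have /nbhs_ballP[d1 /= d10 H1] := differentiable_approxE dr e0.
have /nbhs_ballP[d2 /= d20 H2] := differentiable_approxE di e0.
exists (Num.min d1 d2); first by rewrite lt_min d10.
move=> k; rewrite lt_min => /andP[k1 k2].
have b1 : ball 0 d1 k by rewrite -ball_normE /= sub0r normrN.
have b2 : ball 0 d2 k by rewrite -ball_normE /= sub0r normrN.
have := H1 _ b1; have := H2 _ b2.
by rewrite (diff_partial2 k dr) (diff_partial2 k di) !raddfB.
Qed.

Lemma derivable_of_dbar F x : cdifferentiable F x -> dbar F x = 0 ->
  derivable (F \o @rV_of_complex R : R[i]^o -> R[i]^o) (complex_of_rV x) 1.
Proof.
move=> dF F0; apply/cvg_ex; exists (cderive (bvec R 0) F x); apply/derivable_approx.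
have [E1 E2] : partial 0 (cRe \o F) x = partial 1 (cIm \o F) x /\
    partial 1 (cRe \o F) x = - partial 0 (cIm \o F) x.
  move: F0; rewrite /dbar /cderive /partial.
  move: ('D__ (cRe \o F) x) ('D__ (cIm \o F) x) => a b.
  move: ('D__ (cRe \o F) x) ('D__ (cIm \o F) x) => c d E.
  have := congr1 cRe E; have := congr1 cIm E => /=.
  by rewrite !mul0r !mul1r sub0r add0r => H1 H2; split; lra.
move=> e e0; have e20 : 0 < e / 2 by rewrite divr_gt0.
have [d d0 Hd] := partials dF e20; exists d => // h hd.
have hk := norm_rV_of_complex h.
have [] := Hd _ (le_lt_trans hk hd); set k := rV_of_complex h in hk *.
have -> : k 0 0 = cRe h by rewrite mxE.
have -> : k 0 1 = cIm h by rewrite mxE.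
move=> H1 H2; apply: (le_trans (normc_le_ReIm _)).
have -> : cRe (F (k + x) - F x - h * cderive (bvec R 0) F x) =
   cRe (F (k + x) - F x) - (cRe h * partial 0 (cRe \o F) x + cIm h * partial 1 (cRe \o F) x).
  by rewrite E2 raddfB /= ReM /=; congr (_ - _); rewrite mulrN.
have -> : cIm (F (k + x) - F x - h * cderive (bvec R 0) F x) =
   cIm (F (k + x) - F x) - (cRe h * partial 0 (cIm \o F) x + cIm h * partial 1 (cIm \o F) x).
  by rewrite -E1 raddfB /= ImM.
rewrite (splitr e) mulrDl; apply: lerD; [apply: (le_trans H1)|apply: (le_trans H2)];
  by rewrite ler_wpM2l // ltW.
Qed.

(** The real differential must be multiplication by the complex derivative l. Along 1 and i this
    makes the two partial derivatives l and i l, and l + i (i l) = 0. *)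
Lemma dbar_of_derivable F x : cdifferentiable F x ->
  derivable (F \o @rV_of_complex R : R[i]^o -> R[i]^o) (complex_of_rV x) 1 ->
  dbar F x = 0.
Proof.
move=> dF /cvg_ex[l /= /derivable_approx Hl].
suff H (w : R[i]) : normc w = 1 ->
    cRe w * partial 0 (cRe \o F) x + cIm w * partial 1 (cRe \o F) x = cRe (w * l) /\
    cRe w * partial 0 (cIm \o F) x + cIm w * partial 1 (cIm \o F) x = cIm (w * l).
  have [h1 h2] := H 1 (normc1 _).
  have [|h3 h4] := H 'i%C.
    by rewrite /normc /= expr0n /= expr1n add0r sqrtr1.
  move: h1 h2 h3 h4; rewrite /= !mul1r !mul0r !addr0 !add0r => h1 h2 h3 h4.
  rewrite /dbar /cderive -!/(partial _ _ _) h1 h2 h3 h4; case: (l) => a b /=.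
  by apply: complexP => /=; ring.
move=> w1.
have key (e : R) : 0 < e ->
    `|cRe w * partial 0 (cRe \o F) x + cIm w * partial 1 (cRe \o F) x - cRe (w * l)| <= e /\
    `|cRe w * partial 0 (cIm \o F) x + cIm w * partial 1 (cIm \o F) x - cIm (w * l)| <= e.
  move=> e0; have e20 : 0 < e / 2 by rewrite divr_gt0.
  have [d1 d10 H1] := Hl _ e20; have [d2 d20 H2] := partials dF e20.
  pose t := Num.min d1 d2 / 2.
  have m0 : 0 < Num.min d1 d2 by rewrite lt_min d10.
  have t0 : 0 < t by rewrite divr_gt0.
  have /andP[t1 t2] : (t < d1) && (t < d2).
    by rewrite -lt_min ltr_pdivrMr // ltr_pMr // ltr1n.
  pose h : R[i] := t%:C * w.
  have nh : normc h = t.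
    by rewrite /h normcM w1 mulr1 /normc /= expr0n addr0 sqrtr_sqr gtr0_norm.
  have hk := norm_rV_of_complex h; rewrite nh in hk.
  have B1 := H1 h; rewrite nh in B1; have {}B1 := B1 t1.
  have [] := H2 _ (le_lt_trans hk t2); set k := rV_of_complex h in hk B1 *.
  have -> : k 0 0 = t * cRe w by rewrite mxE /= ReM /= mul0r subr0.
  have -> : k 0 1 = t * cIm w by rewrite mxE /= ImM /= mul0r addr0.
  have Br := le_trans (normcRe _) B1; have Bi := le_trans (normcIm _) B1.
  have RE : cRe (F (k + x) - F x - h * l) = cRe (F (k + x) - F x) - t * cRe (w * l).
    by rewrite raddfB /= /h -mulrA [cRe (t%:C * _)]ReM /= mul0r subr0.
  have IE : cIm (F (k + x) - F x - h * l) = cIm (F (k + x) - F x) - t * cIm (w * l).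
    by rewrite raddfB /= /h -mulrA [cIm (t%:C * _)]ImM /= mul0r addr0.
  rewrite RE in Br; rewrite IE in Bi.
  move: (partial 0 _ x) (partial 1 _ x) (partial 0 _ x) (partial 1 _ x) => p q p' q'.
  have fin (A B C : R) : `|A - t * C| <= e / 2 * t -> `|A - t * B| <= e / 2 * `|k| -> `|B - C| <= e.
    move=> h1 h2; rewrite -(ler_pM2l t0) -{1}(gtr0_norm t0) -normrM.
    have -> : t * (B - C) = (A - t * C) - (A - t * B) by ring.
    rewrite (le_trans (ler_normB _ _)) //.
    have : e / 2 * `|k| <= e / 2 * t by rewrite ler_pM2l.
    by move: h1 h2; rewrite [t * e]mulrC; lra.
  move=> h1 h2; split.
    by apply: fin Br _; apply: le_trans h1; rewrite le_eqVlt; apply/orP; left; apply/eqP; congr (`|_|); ring.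
  by apply: fin Bi _; apply: le_trans h2; rewrite le_eqVlt; apply/orP; left; apply/eqP; congr (`|_|); ring.
have small (u : R) : (forall e : R, 0 < e -> `|u| <= e) -> u = 0.
  move=> ue; apply/eqP; rewrite -normr_eq0 eq_le normr_ge0 andbT.
  by apply/ler_addgt0Pr => e e0; rewrite add0r ue.
split; apply/eqP; rewrite -subr_eq0; apply/eqP; apply: small => e e0.
  exact: (key e e0).1.
exact: (key e e0).2.
Qed.

End ComplexDerivable.

Local Notation coord := Defs.coord.

(** * Change of charts *)

Lemma invmx_congruence (F : fieldType) n (J G : 'M[F]_n) :
  J \in unitmx -> G \in unitmx ->
  invmx (J *m G *m J^T) = invmx J^T *m invmx G *m invmx J.
Proof.
move=> uJ uG; have uJG : J *m G *m J^T \in unitmx by rewrite !unitmx_mul unitmx_tr uJ uG.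
apply: (can_inj (mulKmx uJG)); rewrite mulmxV //.
by rewrite !mulmxA mulmxK ?unitmx_tr // mulmxK // mulmxV.
Qed.

Section Charts.
Variables (R : realType) (n : nat) (M : topologicalType).
Implicit Types (c : chart R n M) (m : M) (U V : set M).

Lemma coord_image c x : (coord c @` dom c) x ->
  dom c (coordV c x) /\ coord c (coordV c x) = x.
Proof. by move=> [m cm <-]; rewrite coordK. Qed.

Lemma coord_imageI c U :
  coord c @` (dom c `&` U) = coord c @` dom c `&` coordV c @^-1` U.
Proof.
apply/seteqP; split => [x [m [cm Um] <-]|x [[m cm <-]]] /=.
  by split; [exists m|rewrite coordK].
by rewrite coordK // => Um; exists m.
Qed.

Lemma open_coord_image c U : open U -> open (coord c @` (dom c `&` U)).
Proof.
move=> oU; rewrite coord_imageI openE => x [xc Ux]; apply: filterI.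
  by apply: open_nbhs_nbhs; split => //; exact: image_open.
by apply: (coordV_continuous xc); exact: open_nbhs_nbhs.
Qed.

Lemma near_coordV c m U : dom c m -> open U -> U m ->
  \forall x \near coord c m, (coord c @` (dom c `&` U)) x.
Proof.
move=> cm oU Um; apply: open_nbhs_nbhs; split; first exact: open_coord_image.
by exists m.
Qed.

Lemma near_coord c m (P : set 'rV[R]_n) : dom c m -> nbhs (coord c m) P ->
  \forall m' \near m, P (coord c m').
Proof. by move=> cm nP; exact: (Defs.coord_continuous cm nP). Qed.

Lemma near_dom c m : dom c m -> \forall m' \near m, dom c m'.
Proof. by move=> cm; apply: open_nbhs_nbhs; split => //; exact: dom_open. Qed.

Lemma transition_coord c c' m : dom c m -> transition c c' (coord c m) = coord c' m.
Proof. by move=> cm; rewrite /transition /= coordK. Qed.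

Lemma coordV_transition c c' x : (coord c @` (dom c `&` dom c')) x ->
  coordV c x = coordV c' (transition c c' x).
Proof. by move=> [m [cm c'm] <-]; rewrite transition_coord // !coordK. Qed.

Lemma open_coord_preimage c (W : set 'rV[R]_n) : open W ->
  W `<=` coord c @` dom c -> open (coordV c @` W).
Proof.
move=> oW Wc; rewrite openE => _ [x Wx <-].
have [cx xx] := coord_image (Wc _ Wx).
have : \forall m \near coordV c x, W (coord c m).
  by apply: near_coord => //; rewrite xx; exact: open_nbhs_nbhs.
have H := near_dom cx; move=> HW; near=> m; exists (coord c m); first by near: m.
by rewrite coordK //; near: m.
Unshelve. all: by end_near. Qed.

End Charts.

Section Manifold.
Variables (R : realType) (n : nat) (M : topologicalType) (X : oriented_manifold R n M).
Implicit Types (c : chart R n M) (m : M) (U V : set M) (f : M -> R).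

Lemma transition_smooth c c' j : atlas X c -> atlas X c' ->
  smooth_on (coord c @` (dom c `&` dom c')) (fun x => transition c c' x 0 j).
Proof. by move=> Xc Xc'; have [+ _] := atlas_compatible Xc Xc'; exact. Qed.

Lemma transition_differentiable c c' m : atlas X c -> atlas X c' ->
  dom c m -> dom c' m -> differentiable (transition c c') (coord c m).
Proof.
move=> Xc Xc' cm c'm; apply: differentiable_rowP => j.
by apply: (smooth_on_differentiable (transition_smooth j Xc Xc')); exists m.
Qed.

Lemma near_transition c c' f m : dom c m -> dom c' m ->
  \forall x \near coord c m,
    (f \o coordV c') (transition c c' x) = (f \o coordV c) x.
Proof.
move=> cm c'm; near=> x.
have Hx : (coord c @` (dom c `&` dom c')) x.
  by near: x; apply: near_coordV => //; exact: dom_open.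
by rewrite /= -coordV_transition.
Unshelve. all: by end_near. Qed.

Lemma dchart_change c c' f m v : atlas X c -> atlas X c' -> dom c m -> dom c' m ->
  differentiable (f \o coordV c') (coord c' m) ->
  differentiable (f \o coordV c) (coord c m) /\
  dchart c v f m = dchart c' (v *m jacobian (transition c c') (coord c m)) f m.
Proof.
move=> Xc Xc' cm c'm df.
have dT := transition_differentiable Xc Xc' cm c'm.
have E := near_transition f cm c'm.
have df' : differentiable (f \o coordV c') (transition c c' (coord c m)).
  by rewrite transition_coord.
split.
  apply: near_eq_differentiable E _.
  by apply: (@differentiable_comp _ _ _ _ (transition c c') (f \o coordV c')).
rewrite /dchart -(near_eq_derive v E).
rewrite (derive_comp (f := transition c c') (h := f \o coordV c')) //.
by rewrite transition_coord // (deriveEjacobian _ dT).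
Qed.

Lemma jacobian_det_gt0 c c' m : atlas X c -> atlas X c' -> dom c m -> dom c' m ->
  0 < \det (jacobian (transition c c') (coord c m)).
Proof.
by move=> Xc Xc' cm c'm; have [_] := atlas_compatible Xc Xc'; apply; exists m.
Qed.

Lemma jacobian_unit c c' m : atlas X c -> atlas X c' -> dom c m -> dom c' m ->
  jacobian (transition c c') (coord c m) \in unitmx.
Proof.
by move=> Xc Xc' cm c'm; rewrite unitmxE unitfE gt_eqF // jacobian_det_gt0.
Qed.

(** Transition maps are smooth, so one chart around each point controls all the others. *)
Lemma smooth_fun_local U f :
  (forall m, U m -> exists c V, [/\ atlas X c, open V, V m, V `<=` dom c &
     smooth_on (coord c @` V) (f \o coordV c)]) -> smooth_fun X U f.
Proof.
move=> H c' Xc' s _ [m [c'm Um] <-].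
have [c [V [Xc oV Vm Vc sf]]] := H m Um.
have oO : open (coord c' @` (dom c' `&` V)) by exact: open_coord_image.
suff : smooth_on (coord c' @` (dom c' `&` V)) (f \o coordV c') by apply; exists m.
apply: (eq_smooth_on oO (f := fun x => (f \o coordV c) (transition c' c x))).
  move=> _ [m' [c'm' Vm'] <-]; rewrite /= -(coordV_transition (c := c')) //.
  by exists m' => //; split => //; exact: Vc.
apply: (smooth_on_comp oO (O' := coord c @` V)) sf.
  move=> j; apply: smooth_on_sub (transition_smooth j Xc' Xc) => _ [m' [c'm' Vm'] <-].
  by exists m' => //; split => //; exact: Vc.
by move=> _ [m' [c'm' Vm'] <-]; rewrite transition_coord //; exists m'.
Qed.

Lemma smooth_fun_differentiable U f c m : smooth_fun X U f -> atlas X c ->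
  dom c m -> U m -> differentiable (f \o coordV c) (coord c m).
Proof.
by move=> sf Xc cm Um; apply: (smooth_on_differentiable (sf c Xc)); exists m.
Qed.

Lemma csmooth_on_chart U (f : M -> R[i]) c : csmooth_fun X U f -> atlas X c ->
  csmooth_on (coord c @` (dom c `&` U)) (f \o coordV c).
Proof. by move=> [f1 f2] Xc; split; [exact: f1|exact: f2]. Qed.

Lemma csmooth_funP U (f : M -> R[i]) :
  (forall c, atlas X c -> csmooth_on (coord c @` (dom c `&` U)) (f \o coordV c)) ->
  csmooth_fun X U f.
Proof. by move=> H; split => c Xc; have [] := H c Xc. Qed.

Lemma cdchartE c v (f : M -> R[i]) m :
  cdchart c v f m = cderive v (f \o coordV c) (coord c m).
Proof. by []. Qed.

Variable g : riemannian_metric X.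

Lemma gmx_unit c m : atlas X c -> dom c m -> gmx g c m \in unitmx.
Proof.
move=> Xc cm; rewrite -row_free_unit -kermx_eq0; apply/eqP/row_matrixP => i.
set u := row i _; rewrite row0; apply/eqP/negP => /negP u0.
have := gmx_pos g Xc cm u0.
by rewrite (_ : u *m _ = 0) ?mul0mx ?mxE ?ltxx // /u -row_mul mulmx_ker row0.
Qed.

Lemma gmx_smooth_mx c : atlas X c ->
  smooth_mx (coord c @` dom c) (fun x => gmx g c (coordV c x)).
Proof. by move=> Xc i j; exact: gmx_smooth. Qed.

Definition diff_row c f m : 'rV[R]_n := \row_i dchart c (bvec R i) f m.

Lemma diff_row_change c c' f m : atlas X c -> atlas X c' -> dom c m -> dom c' m ->
  differentiable (f \o coordV c') (coord c' m) ->
  diff_row c f m = diff_row c' f m *m (jacobian (transition c c') (coord c m))^T.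
Proof.
move=> Xc Xc' cm c'm df; apply/rowP => i; rewrite mxE.
rewrite (dchart_change _ Xc Xc' cm c'm df).2; move: (jacobian _ _) => J.
rewrite /dchart derive_partialE // mxE -rowE.
by apply: eq_bigr => j _; rewrite !mxE mulrC.
Qed.

Lemma grad_change c c' f m : atlas X c -> atlas X c' -> dom c m -> dom c' m ->
  differentiable (f \o coordV c') (coord c' m) ->
  grad g c' f m = grad g c f m *m jacobian (transition c c') (coord c m).
Proof.
move=> Xc Xc' cm c'm df; rewrite /grad -!/(diff_row _ _ _).
rewrite (diff_row_change Xc Xc' cm c'm df) (gmx_change g Xc Xc' cm c'm).
have uG := gmx_unit Xc' c'm; have uJ := jacobian_unit Xc Xc' cm c'm.
move: (jacobian _ _) uJ => J uJ.
by rewrite invmx_congruence // !mulmxA mulmxK ?unitmx_tr // mulmxKV.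
Qed.

End Manifold.

(** * Riemannian surfaces *)

Section Matrix2.
Variable F : comNzRingType.
Implicit Types A B : 'M[F]_2.

Lemma ord2P (P : 'I_2 -> Prop) : P 0 -> P 1 -> forall i, P i.
Proof.
move=> P0 P1 i; case: (unliftP 0 i) => [k ->|->] //.
by rewrite (_ : lift 0 k = 1) //; apply/val_inj; rewrite /= (ord1 k).
Qed.

Lemma sum2 (V : nmodType) (f : 'I_2 -> V) : \sum_i f i = f 0 + f 1.
Proof.
rewrite !big_ord_recl big_ord0 addr0; congr (_ + f _); exact/val_inj.
Qed.

Lemma mulmx2 m p (A : 'M[F]_(m, 2)) (B : 'M[F]_(2, p)) i j :
  (A *m B) i j = A i 0 * B 0 j + A i 1 * B 1 j.
Proof. by rewrite mxE sum2. Qed.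

Lemma matrix2P A B : A 0 0 = B 0 0 -> A 0 1 = B 0 1 -> A 1 0 = B 1 0 ->
  A 1 1 = B 1 1 -> A = B.
Proof.
by move=> h00 h01 h10 h11; apply/matrixP; apply: ord2P; apply: ord2P.
Qed.

Lemma row2P (A B : 'rV[F]_2) : A 0 0 = B 0 0 -> A 0 1 = B 0 1 -> A = B.
Proof. by move=> h0 h1; apply/rowP; apply: ord2P. Qed.

Lemma det2 A : \det A = A 0 0 * A 1 1 - A 0 1 * A 1 0.
Proof.
have l1 : lift 0 0 = 1 :> 'I_2 by exact/val_inj.
have l0 : lift 1 0 = 0 :> 'I_2 by exact/val_inj.
rewrite (expand_det_row _ 0) sum2 /cofactor !det_mx11 !mxE l1 l0 /=.
by rewrite addn0 expr0 mul1r expr1; ring.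
Qed.

(** The quarter turn on row vectors in an oriented orthonormal basis, sending e_1 to e_2. *)
Definition Kmx : 'M[F]_2 := delta_mx 0 1 - delta_mx 1 0.

Lemma Kmx00 : Kmx 0 0 = 0. Proof. by rewrite !mxE subrr. Qed.
Lemma Kmx01 : Kmx 0 1 = 1. Proof. by rewrite !mxE subr0. Qed.
Lemma Kmx10 : Kmx 1 0 = -1. Proof. by rewrite !mxE sub0r. Qed.
Lemma Kmx11 : Kmx 1 1 = 0. Proof. by rewrite !mxE subrr. Qed.
Definition KmxE := (Kmx00, Kmx01, Kmx10, Kmx11).

(** [Kmx] is also the matrix of the area form, which a congruence multiplies by the determinant. The
    invariance of J under changes of chart and its form in orthonormal frames both rest on this. *)
Lemma trmx_Kmx A : A^T *m Kmx *m A = \det A *: Kmx.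
Proof.
by apply: matrix2P; rewrite det2 !mulmx2 !mxE /=; ring.
Qed.

Lemma Kmx_sqr : Kmx *m Kmx = - 1%:M.
Proof. by apply: matrix2P; rewrite !mulmx2 !KmxE !mxE /=; ring. Qed.

Lemma mul_row_Kmx (v : 'rV[F]_2) : (v *m Kmx) 0 0 = - v 0 1 /\ (v *m Kmx) 0 1 = v 0 0.
Proof. by rewrite !mulmx2 !KmxE; split; ring. Qed.

End Matrix2.

Lemma invmx2 (F : fieldType) (A : 'M[F]_2) : A \in unitmx ->
  [/\ invmx A 0 0 = (\det A)^-1 * A 1 1, invmx A 0 1 = - (\det A)^-1 * A 0 1,
      invmx A 1 0 = - (\det A)^-1 * A 1 0 & invmx A 1 1 = (\det A)^-1 * A 0 0].
Proof.
move=> uA; rewrite /invmx uA !mxE /cofactor !det_mx11 !mxE /=.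
have l1 : lift 0 0 = 1 :> 'I_2 by exact/val_inj.
have l0 : lift 1 0 = 0 :> 'I_2 by exact/val_inj.
by rewrite !l1 !l0 /= !addn0 !expr0 !expr1 sqrrN expr1n !mul1r; split; ring.
Qed.

Section Surface.
Variables (R : realType) (M : topologicalType) (X : oriented_manifold R 2 M).
Variable g : riemannian_metric X.
Implicit Types (c : chart R 2 M) (m : M) (U V : set M) (p q : M -> R[i]).
Local Notation cmx := (map_mx (real_complex R)).
Local Notation K := (Kmx R).

Lemma JmxE c m : Jmx g c m = (Num.sqrt (\det (gmx g c m)))^-1 *: (gmx g c m *m K).
Proof. by []. Qed.

Lemma det_gmx_gt0 c m : atlas X c -> dom c m -> 0 < \det (gmx g c m).
Proof.
move=> Xc cm; set G := gmx g c m.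
have sG : G 1 0 = G 0 1.
  by have := congr1 (fun A : 'M[R]_2 => A 0 1) (gmx_sym g Xc cm); rewrite mxE.
have pos (v : 'rV[R]_2) : v != 0 ->
    0 < v 0 0 * v 0 0 * G 0 0 + 2 * (v 0 0 * v 0 1 * G 0 1) + v 0 1 * v 0 1 * G 1 1.
  move=> v0; have := gmx_pos g Xc cm v0; rewrite -/G !mulmx2 !mxE sG.
  by congr (0 < _); ring.
have a0 : 0 < G 0 0.
  have := pos (bvec R 0); rewrite !mxE /= => /(_ _); rewrite !(mul0r, mulr0, mul1r, addr0).
  by apply; apply/eqP => /rowP /(_ 0); rewrite !mxE /= => /eqP; rewrite oner_eq0.
(* On this vector the quadratic form takes the value G_00 det G. *)
have := pos (\row_j (if j == 0 then - G 0 1 else G 0 0)).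
rewrite !mxE /= det2 sG => /(_ _) H.
have {H} : 0 < G 0 0 * (G 0 0 * G 1 1 - G 0 1 * G 0 1).
  have -> : G 0 0 * (G 0 0 * G 1 1 - G 0 1 * G 0 1) =
    - G 0 1 * - G 0 1 * G 0 0 + 2 * (- G 0 1 * G 0 0 * G 0 1) + G 0 0 * G 0 0 * G 1 1 by ring.
  by apply: H; apply/eqP => /rowP /(_ 1); rewrite !mxE /= => E; move: a0; rewrite E ltxx.
by rewrite pmulr_rgt0.
Qed.

(** The square root of det g picks up the absolute value of the jacobian determinant, which is the
    determinant itself because the atlas is oriented; it cancels the one produced by [trmx_Kmx]. *)
Lemma Jmx_change c c' m : atlas X c -> atlas X c' -> dom c m -> dom c' m ->
  Jmx g c m *m jacobian (transition c c') (coord c m) =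
  jacobian (transition c c') (coord c m) *m Jmx g c' m.
Proof.
move=> Xc Xc' cm c'm; rewrite !JmxE (gmx_change g Xc Xc' cm c'm).
have dJ := jacobian_det_gt0 Xc Xc' cm c'm.
have dG := det_gmx_gt0 Xc' c'm.
move: (jacobian _ _) dJ (gmx g c' m) dG => J dJ G dG.
rewrite !det_mulmx det_tr mulrAC -expr2 sqrtrM ?sqr_ge0 // sqrtr_sqr gtr0_norm //.
rewrite -scalemxAl -scalemxAr -!mulmxA [X in J *m (G *m X)]mulmxA trmx_Kmx.
rewrite -!scalemxAr scalerA invfM mulrAC mulVf ?gt_eqF // mul1r.
by rewrite !mulmxA.
Qed.

Lemma cgrad_change c c' p m : atlas X c -> atlas X c' -> dom c m -> dom c' m ->
  cdifferentiable (p \o coordV c') (coord c' m) ->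
  cgrad g c' p m = cgrad g c p m *m cmx (jacobian (transition c c') (coord c m)).
Proof.
move=> Xc Xc' cm c'm [d1 d2]; rewrite /cgrad.
rewrite (grad_change g Xc Xc' cm c'm d1) (grad_change g Xc Xc' cm c'm d2).
by rewrite !map_mxM mulmxDl scalemxAl.
Qed.

Definition conjugate c p q m := cgrad g c p m = cgrad g c q m *m cmx (Jmx g c m).

Lemma conjugate_change c c' p q m : atlas X c -> atlas X c' -> dom c m -> dom c' m ->
  cdifferentiable (p \o coordV c') (coord c' m) ->
  cdifferentiable (q \o coordV c') (coord c' m) ->
  conjugate c p q m -> conjugate c' p q m.
Proof.
move=> Xc Xc' cm c'm dp dq; rewrite /conjugate => E.
rewrite (cgrad_change Xc Xc' cm c'm dp) (cgrad_change Xc Xc' cm c'm dq) E.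
by rewrite -!mulmxA -!map_mxM Jmx_change.
Qed.

Definition cdiff_row c p m : 'rV[R[i]]_2 := \row_j cdchart c (bvec R j) p m.

Lemma cgradE c p m : cgrad g c p m = cdiff_row c p m *m cmx (invmx (gmx g c m)).
Proof.
rewrite /cgrad /grad !map_mxM -!/(diff_row _ _ _) scalemxAl -mulmxDl; congr (_ *m _).
apply/rowP => j; rewrite !mxE /cdchart.
by apply: complexP => /=; ring.
Qed.

Lemma cdchart_row c p m (E : 'M[R]_2) i : cdifferentiable (p \o coordV c) (coord c m) ->
  cdchart c (row i E) p m = (cdiff_row c p m *m cmx E^T) 0 i.
Proof.
move=> dp; rewrite cdchartE cderiveE // mxE; apply: eq_bigr => j _.
by rewrite !mxE mulrC.
Qed.

Section Frame.
Variables (c : chart R 2 M) (m : M) (E : 'M[R]_2).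
Hypotheses (Xc : atlas X c) (cm : dom c m).
Hypothesis orthoE : E *m gmx g c m *m E^T = 1%:M.
Hypothesis detE : 0 < \det E.

Let uE : E \in unitmx. Proof. by rewrite unitmxE unitfE gt_eqF. Qed.

Let gmxE : gmx g c m = invmx E *m invmx E^T.
Proof.
have uEt : E^T \in unitmx by rewrite unitmx_tr.
rewrite -[LHS](mulKmx uE); congr (_ *m _).
by rewrite -[LHS](mulmxK uEt) orthoE mul1mx.
Qed.

Lemma frame_invmx : invmx (gmx g c m) = E^T *m E.
Proof.
have uG := gmx_unit g Xc cm; apply: (can_inj (mulKmx uG)).
by rewrite mulmxV // gmxE mulmxA mulmxKV ?unitmx_tr // mulVmx.
Qed.

Lemma frame_Jmx : E *m Jmx g c m = K *m E.
Proof.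
have dG : \det (gmx g c m) = (\det E)^-1 ^+ 2.
  by rewrite gmxE det_mulmx !det_inv det_tr expr2.
rewrite JmxE dG sqrtr_sqr gtr0_norm ?invr_gt0 // invrK -scalemxAr gmxE !mulmxA.
rewrite mulmxV // mul1mx scalemxAr -trmx_Kmx !mulmxA mulVmx ?unitmx_tr //.
by rewrite mul1mx.
Qed.

(** In an oriented orthonormal frame the components of a gradient are directional derivatives and J
    is [Kmx], so the tensor equation becomes a Cauchy-Riemann system. *)
Lemma conjugate_frame p q : cdifferentiable (p \o coordV c) (coord c m) ->
  cdifferentiable (q \o coordV c) (coord c m) ->
  conjugate c p q m <->
  cdchart c (row 0 E) p m = - cdchart c (row 1 E) q m /\
  cdchart c (row 1 E) p m = cdchart c (row 0 E) q m.
Proof.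
move=> dp dq; rewrite !cdchart_row // /conjugate !cgradE frame_invmx map_mxM !mulmxA.
rewrite -[X in _ = X]mulmxA -map_mxM frame_Jmx map_mxM mulmxA.
set a := cdiff_row c p m *m _; set b := cdiff_row c q m *m _.
have -> : cmx K = Kmx R[i].
  by rewrite /Kmx raddfB /= !map_delta_mx.
have [b0 b1] := mul_row_Kmx b.
split=> [H|[h0 h1]].
  have {H} -> : a = b *m Kmx R[i].
    have uEc : cmx E \in unitmx by rewrite map_unitmx.
    exact: (can_inj (mulmxK uEc)).
  by rewrite b0 b1.
by congr (_ *m _); apply: row2P; rewrite ?b0 ?b1.
Qed.

End Frame.

Lemma conformal_conjugate c p q m : conformal g c -> dom c m ->
  cdifferentiable (p \o coordV c) (coord c m) ->
  cdifferentiable (q \o coordV c) (coord c m) ->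
  conjugate c p q m <->
  cdchart c (bvec R 0) p m = - cdchart c (bvec R 1) q m /\
  cdchart c (bvec R 1) p m = cdchart c (bvec R 0) q m.
Proof.
move=> [Xc cc] cm dp dq; have [[lam lam0 gE] _] := cc m cm.
(* The coordinate frame scaled by s is orthonormal, and s is a common nonzero factor of both
   equations. *)
pose s := (Num.sqrt lam)^-1; have s0 : 0 < s by rewrite invr_gt0 sqrtr_gt0.
have o : s%:M *m gmx g c m *m (s%:M)^T = 1%:M :> 'M[R]_2.
  rewrite gE tr_scalar_mx -!scalar_mxM; congr (_%:M).
  by rewrite mulrAC -expr2 exprVn sqr_sqrtr ?ltW // mulVf // gt_eqF.
have d : 0 < \det (s%:M : 'M[R]_2) by rewrite det_scalar exprn_gt0.
have rE i : row i (s%:M) = s *: bvec R i :> 'rV[R]_2.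
  by apply/rowP => j; rewrite !mxE eqxx /= mulr_natr eq_sym.
rewrite (conjugate_frame Xc cm o d dp dq) !rE.
have Z i f : cdifferentiable (f \o coordV c) (coord c m) ->
    cdchart c (s *: bvec R i) f m = s%:C * cdchart c (bvec R i) f m.
  move=> [d1 d2]; apply: complexP.
    by rewrite ReM /= mul0r subr0; apply: derive_dirZ.
  by rewrite ImM /= mul0r addr0; apply: derive_dirZ.
rewrite !Z // -mulrN.
have sC : s%:C != 0 by apply/eqP => /(congr1 cRe) /= E; move: s0; rewrite E ltxx.
by split=> [[/(mulfI sC) h0 /(mulfI sC) h1]|[-> ->]].
Qed.

End Surface.

(** * The Laplace-Beltrami operator as a divergence of fluxes *)

Section Laplacian.
Variables (R : realType) (M : topologicalType) (X : oriented_manifold R 2 M).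
Variable g : riemannian_metric X.
Implicit Types (c : chart R 2 M) (m : M) (U V : set M).
Local Notation K := (Kmx R).

Definition vol c m : R := Num.sqrt (\det (gmx g c m)).

Lemma vol_gt0 c m : atlas X c -> dom c m -> 0 < vol c m.
Proof. by move=> Xc cm; rewrite sqrtr_gt0 det_gmx_gt0. Qed.

Lemma vol_sqr c m : atlas X c -> dom c m -> vol c m * vol c m = \det (gmx g c m).
Proof. by move=> Xc cm; rewrite -expr2 sqr_sqrtr // ltW // det_gmx_gt0. Qed.

Lemma vol_smooth c : atlas X c -> smooth_on (coord c @` dom c) (vol c \o coordV c).
Proof.
move=> Xc; have oO : open (coord c @` dom c) by exact: Defs.image_open.
apply: (smooth_on_sqrt oO (f := fun x => \det (gmx g c (coordV c x)))).
  by apply: smooth_on_det => //; exact: gmx_smooth_mx.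
by move=> x /coord_image [cx _]; exact: det_gmx_gt0.
Qed.

(** Here a, b, d are the metric coefficients g_00, g_01, g_11, with D their determinant and s its
    root; a trailing 0 or 1 on them marks a partial derivative. The field has components y0, y1, and
    y00, y11 are their diagonal derivatives. The parentheses on the left are Christoffel symbols. *)
Let divergence_algebra (a b d D s a0 b0 d0 a1 b1 d1 s0 s1 y0 y1 y00 y11 : R) :
  s != 0 -> s * s = D -> D = a * d - b * b ->
  2 * (s * s0) = a0 * d + a * d0 - 2 * (b * b0) ->
  2 * (s * s1) = a1 * d + a * d1 - 2 * (b * b1) ->
  s * (y00 + (y0 * (2^-1 * (D^-1 * d * (a0 + a0 - a0) + - D^-1 * b * (b0 + b0 - a1)))
            + y1 * (2^-1 * (D^-1 * d * (b0 + a1 - b0) + - D^-1 * b * (d0 + b1 - b1))))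
     + (y11 + (y0 * (2^-1 * (- D^-1 * b * (a1 + b0 - b0) + D^-1 * a * (b1 + d0 - b1)))
            + y1 * (2^-1 * (- D^-1 * b * (b1 + b1 - d0) + D^-1 * a * (d1 + d1 - d1))))))
  = s0 * y0 + s * y00 + (s1 * y1 + s * y11).
Proof.
move=> sn0 sD DE h0 h1; have Dn0 : D != 0 by rewrite -sD mulf_neq0.
have e0 : s0 = s * (a0 * d + a * d0 - 2 * (b * b0)) / (2 * D).
  by rewrite -h0 -sD; field.
have e1 : s1 = s * (a1 * d + a * d1 - 2 * (b * b1)) / (2 * D).
  by rewrite -h1 -sD; field.
by rewrite e0 e1; field.
Qed.

(** Eliminates the Christoffel symbols: in this classical form a vanishing divergence is the
    closedness of a 1-form. *)
Lemma divergence_vol c (Y : M -> 'rV[R]_2) m : atlas X c -> dom c m ->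
  (forall i, differentiable (fun x => Y (coordV c x) 0 i) (coord c m)) ->
  vol c m * divergence g c Y m =
  \sum_i partial i (fun x => vol c (coordV c x) * Y (coordV c x) 0 i) (coord c m).
Proof.
move=> Xc cm dY; set x := coord c m.
have Ox : (coord c @` dom c) x by exists m.
have oO : open (coord c @` dom c) by exact: Defs.image_open.
have mE : coordV c x = m by rewrite coordK.
have sG := gmx_smooth_mx g Xc.
have dG i j : differentiable (fun x => gmx g c (coordV c x) i j) x.
  exact: smooth_on_differentiable (sG i j) Ox.
have ds : differentiable (vol c \o coordV c) x.
  exact: smooth_on_differentiable (vol_smooth Xc) Ox.
have nearO : \forall y \near x, (coord c @` dom c) y.
  by apply: open_nbhs_nbhs; split.
have sym y : dom c y -> gmx g c y 1 0 = gmx g c y 0 1.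
  move=> cy; have := congr1 (fun A : 'M[R]_2 => A 0 1) (gmx_sym g Xc cy).
  by rewrite mxE.
have p10 k : partial k (fun x => gmx g c (coordV c x) 1 0) x =
    partial k (fun x => gmx g c (coordV c x) 0 1) x.
  rewrite /partial; apply: near_eq_derive; near=> y.
  have /coord_image[cy _] : (coord c @` dom c) y by near: y.
  exact: sym.
have dchE i (f : M -> R) : dchart c (bvec R i) f m = partial i (f \o coordV c) x by [].
have vol2 k : 2 * (vol c m * partial k (vol c \o coordV c) x) =
    partial k (fun x => gmx g c (coordV c x) 0 0) x * gmx g c m 1 1 +
    gmx g c m 0 0 * partial k (fun x => gmx g c (coordV c x) 1 1) x -
    2 * (gmx g c m 0 1 * partial k (fun x => gmx g c (coordV c x) 0 1) x).
  have E : \forall y \near x, (vol c \o coordV c) y * (vol c \o coordV c) y + cst 0 y * cst 0 y =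
      gmx g c (coordV c y) 0 0 * gmx g c (coordV c y) 1 1 -
      gmx g c (coordV c y) 0 1 * gmx g c (coordV c y) 0 1.
    near=> y; have /coord_image[cy _] : (coord c @` dom c) y by near: y.
    by rewrite /= mulr0 addr0 vol_sqr // det2 sym.
  have := near_eq_derive (bvec R k) E.
  have dv v := diff_derivable ds (v := v).
  have dg i j v := diff_derivable (dG i j) (v := v).
  have d0 : derivable (cst 0 : 'rV[R]_2 -> R) x (bvec R k) by exact: derivable_cst.
  rewrite (derive_mulD (dv _) d0 (dv _) d0) (derive_mulB (dg _ _ _) (dg _ _ _) (dg _ _ _) (dg _ _ _)).
  rewrite derive_cst !mulr0 ?mul0r !addr0 -!/(partial _ _ _) /= mE.
  move=> H; rewrite (_ : 2 * _ = partial k (vol c \o coordV c) x * vol c m +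
      vol c m * partial k (vol c \o coordV c) x); last by ring.
  by rewrite H; ring.
have pY k : partial k (fun x => vol c (coordV c x) * Y (coordV c x) 0 k) x =
    partial k (vol c \o coordV c) x * Y m 0 k + vol c m * partial k (fun x => Y (coordV c x) 0 k) x.
  have d1 := diff_derivable ds (v := bvec R k).
  have d2 := diff_derivable (dY k) (v := bvec R k).
  have D := is_deriveM (derivableP d1) (derivableP d2).
  rewrite /partial (@derive_val _ _ _ _ _ _ _ D) /GRing.scale /= mE addrC.
  by rewrite [X in X + _]mulrC.
rewrite sum2 !pY /divergence sum2 /nabla /christoffel_term.
have row_sum (w : 'I_2 -> 'I_2 -> R) i :
    \sum_(k < 2) \sum_(l < 2) bvec R i 0 k * Y m 0 l * w k l = Y m 0 0 * w i 0 + Y m 0 1 * w i 1.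
  rewrite !sum2; move: i; apply: ord2P; rewrite !mxE /=; ring.
rewrite !mxE !row_sum /christoffel !sum2.
have uG := gmx_unit g Xc cm; have [i00 i01 i10 i11] := invmx2 uG.
rewrite i00 i01 i10 i11 !dchE -!/(partial _ _ _).
have pE k i j : partial k ((fun m' : M => gmx g c m' i j) \o coordV c) x =
   partial k (fun x => gmx g c (coordV c x) i j) x by [].
have pYE k i : partial k ((fun m' : M => Y m' 0 i) \o coordV c) x =
   partial k (fun x => Y (coordV c x) 0 i) x by [].
rewrite !pE !pYE !p10 sym //.
apply: divergence_algebra.
- by rewrite gt_eqF // vol_gt0.
- exact: vol_sqr.
- by rewrite det2 sym.
- exact: vol2.
- exact: vol2.
Unshelve. all: by end_near. Qed.

Lemma grad_smooth U c f i : open U -> atlas X c -> smooth_fun X U f ->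
  smooth_on (coord c @` (dom c `&` U)) (fun x => grad g c f (coordV c x) 0 i).
Proof.
move=> oU Xc sf; have oO : open (coord c @` (dom c `&` U)) by exact: open_coord_image.
have sub : coord c @` (dom c `&` U) `<=` coord c @` dom c by move=> _ [m [cm _] <-]; exists m.
have sd : smooth_mx (coord c @` (dom c `&` U)) (fun x => diff_row c f (coordV c x)).
  move=> i' j; apply: (eq_smooth_on oO (f := partial j (f \o coordV c))).
    by move=> _ [m [cm Um] <-]; rewrite coordK // mxE.
  exact/smooth_on_partial/sf.
have sI : smooth_mx (coord c @` (dom c `&` U)) (fun x => invmx (gmx g c (coordV c x))).
  apply: smooth_mx_inv => //; first by move=> i' j; exact: smooth_on_sub sub (gmx_smooth_mx g Xc i' j).
  by move=> _ [m [cm Um] <-]; rewrite coordK //; exact: gmx_unit.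
exact: (smooth_mxM oO sd sI 0 i).
Qed.

(** The gradient weighted by the area density. The 1-form with coefficients - flux_1 and flux_0 is
    the Hodge star of df. *)
Definition flux c f i : 'rV[R]_2 -> R :=
  fun x => vol c (coordV c x) * grad g c f (coordV c x) 0 i.

Lemma flux_smooth U c f i : open U -> atlas X c -> smooth_fun X U f ->
  smooth_on (coord c @` (dom c `&` U)) (flux c f i).
Proof.
move=> oU Xc sf; apply: smooth_onM; [exact: open_coord_image| |exact: grad_smooth].
by apply: smooth_on_sub (vol_smooth Xc) => _ [m [cm _] <-]; exists m.
Qed.

Lemma laplacian_flux U c f m : open U -> atlas X c -> smooth_fun X U f ->
  dom c m -> U m ->
  vol c m * laplacian g c f m =
  partial 0 (flux c f 0) (coord c m) + partial 1 (flux c f 1) (coord c m).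
Proof.
move=> oU Xc sf cm Um; rewrite /laplacian divergence_vol // ?sum2 // => i.
by apply: (smooth_on_differentiable (grad_smooth i oU Xc sf)); exists m.
Qed.

(** The case of a symmetric matrix in [trmx_Kmx]; it moves the quarter turn across the metric at the
    cost of inverting it. *)
Lemma gmx_Kmx c m : atlas X c -> dom c m ->
  gmx g c m *m K = vol c m ^+ 2 *: (K *m invmx (gmx g c m)).
Proof.
move=> Xc cm; have uG := gmx_unit g Xc cm.
have := trmx_Kmx (gmx g c m); rewrite gmx_sym // -vol_sqr // -expr2 => H.
by rewrite scalemxAl -H mulmxK.
Qed.

(* The 1-form dual to J grad u is the rotated flux of u. *)
Lemma grad_Jmx_flux c u th m : atlas X c -> dom c m ->
  (partial 0 (th \o coordV c) (coord c m) = - flux c u 1 (coord c m) /\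
   partial 1 (th \o coordV c) (coord c m) = flux c u 0 (coord c m)) <->
  grad g c th m = grad g c u m *m Jmx g c m.
Proof.
move=> Xc cm; have uG := gmx_unit g Xc cm; have v0 := vol_gt0 Xc cm.
have E : grad g c u m *m Jmx g c m = vol c m *: (grad g c u m *m K) *m invmx (gmx g c m).
  rewrite JmxE -/(vol c m) gmx_Kmx // scalerA expr2 mulKf ?gt_eqF //.
  by rewrite -scalemxAr -scalemxAl mulmxA.
rewrite E /grad -!/(diff_row _ _ _) -/(grad g c u m).
have [k0 k1] := mul_row_Kmx (grad g c u m).
have dE i : diff_row c th m 0 i = partial i (th \o coordV c) (coord c m) by rewrite mxE.
have vE i (w : 'rV[R]_2) : (vol c m *: w) 0 i = vol c m * w 0 i by rewrite mxE.
rewrite /flux coordK //; split=> [[h0 h1]|].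
  by congr (_ *m _); apply: row2P; rewrite dE vE ?h0 ?h1 ?k0 ?k1 ?mulrN.
move/(can_inj (mulmxKV uG)) => H; rewrite -!dE H !vE k0 k1 mulrN.
by [].
Qed.

End Laplacian.

(** * Harmonic conjugates on simply connected regions *)

Section HarmonicConjugate.
Variables (R : realType) (M : topologicalType) (X : oriented_manifold R 2 M).
Variable g : riemannian_metric X.
Implicit Types (c : chart R 2 M) (m : M) (U V : set M).
Local Notation K := (Kmx R).

Lemma chart_ball c m U : open U -> dom c m -> U m ->
  exists2 r, 0 < r & ball (coord c m) r `<=` coord c @` (dom c `&` U).
Proof.
move=> oU cm Um; have /nbhs_ballP[r /= r0 Hr] := near_coordV cm oU Um.
by exists r.
Qed.

Lemma chart_ball_open c (x : 'rV[R]_2) r V : ball x r `<=` coord c @` (dom c `&` V) ->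
  open (coordV c @` ball x r) /\ coord c @` (coordV c @` ball x r) = ball x r.
Proof.
move=> BV; have Bc : ball x r `<=` coord c @` dom c.
  by move=> y /BV [m [cm _] <-]; exists m.
split; first by apply: open_coord_preimage => //; exact: ball_open.
apply/seteqP; split => [_ [_ [y yb <-] <-]|y yb].
  by have [_ ->] := coord_image (Bc _ yb).
by exists (coordV c y); [exists y|have [_] := coord_image (Bc _ yb)].
Qed.

Variables (U : set M) (u : M -> R).
Hypothesis oU : open U.
Hypothesis su : smooth_fun X U u.

(** The notion of local primitive to which [monodromy] is applied. *)
Definition local_conjugate V th := [/\ open V, V `<=` U, smooth_fun X V th &
  forall c m, atlas X c -> dom c m -> V m ->
    grad g c th m = grad g c u m *m Jmx g c m].

Let conjugate_in_chart V th c c' m : smooth_fun X V th -> V m -> V `<=` U ->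
  atlas X c -> atlas X c' -> dom c m -> dom c' m ->
  grad g c th m = grad g c u m *m Jmx g c m ->
  grad g c' th m = grad g c' u m *m Jmx g c' m.
Proof.
move=> sth Vm VU Xc Xc' cm c'm E.
rewrite (grad_change g Xc Xc' cm c'm (smooth_fun_differentiable sth Xc' c'm Vm)).
rewrite (grad_change g Xc Xc' cm c'm (smooth_fun_differentiable su Xc' c'm (VU _ Vm))).
by rewrite E -!mulmxA Jmx_change.
Qed.

(** Harmonicity of [u] is the closedness of its rotated flux, so [poincare] on a coordinate ball
    supplies the conjugate. The gradient equation is checked in that one chart and then
    transported. *)
Lemma local_conjugate_ex m :
  (forall c m, atlas X c -> dom c m -> U m -> laplacian g c u m = 0) ->
  U m -> exists V th, local_conjugate V th /\ V m.
Proof.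
move=> Lu Um; have [c Xc cm] := atlas_cover X m.
have [r r0 Br] := chart_ball oU cm Um.
set x := coord c m in Br; have [oV VB] := chart_ball_open Br.
set V := coordV c @` ball x r in oV VB.
have Bdom y : ball x r y -> [/\ dom c (coordV c y), U (coordV c y) & coord c (coordV c y) = y].
  by move=> /Br [m' [cm' Um'] <-]; rewrite coordK.
have VU : V `<=` U by move=> _ [y yb <-]; have [] := Bdom y yb.
have Vc : V `<=` dom c by move=> _ [y yb <-]; have [] := Bdom y yb.
pose a (i : 'I_2) y := if i == 0 then - flux g c u 1 y else flux g c u 0 y.
have sflux i : smooth_on (ball x r) (flux g c u i).
  exact: smooth_on_sub Br (flux_smooth g i oU Xc su).
have sa i : smooth_on (ball x r) (a i).
  move: i; apply: ord2P; rewrite /a /=; last exact: sflux.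
  by apply: smooth_onN; [exact: ball_open|exact: sflux].
have pN y : ball x r y -> partial 1 (fun z => - flux g c u 1 z) y = - partial 1 (flux g c u 1) y.
  move=> yb; rewrite /partial deriveN //; apply: diff_derivable.
  exact: smooth_on_differentiable (sflux 1) yb.
have c01 y : ball x r y -> partial 0 (a 1) y = partial 1 (a 0) y.
  move=> yb; have [cy Uy yE] := Bdom y yb.
  rewrite /a /= pN //; apply/eqP; rewrite -subr_eq0 opprK; apply/eqP.
  by have := laplacian_flux g oU Xc su cy Uy; rewrite Lu // mulr0 yE.
have closed_a i j y : ball x r y -> partial i (a j) y = partial j (a i) y.
  move=> yb; move: i j; apply: ord2P; apply: ord2P => //; first exact: c01.
  exact/esym/c01.
have [th sth pth] := poincare r0 sa closed_a.
have Vm : V m by exists x; [exact: ballxx|rewrite /x coordK].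
have thE y : ball x r y -> \forall z \near y, th z = ((th \o coord c) \o coordV c) z.
  move=> yb; near=> z; have zb : ball x r z.
    by near: z; apply: open_nbhs_nbhs; split => //; exact: ball_open.
  by have [_ _] := Bdom z zb => /= ->.
have sV : smooth_fun X V (th \o coord c).
  apply: smooth_fun_local => m' Vm'; exists c, V; split => //.
  rewrite VB; apply: (eq_smooth_on (ball_open _ _) _ sth) => y yb /=.
  by have [_ _ ->] := Bdom y yb.
exists V, (th \o coord c); split=> //; split=> // c' m' Xc' c'm' Vm'.
have cm' := Vc _ Vm'.
apply: (conjugate_in_chart sV Vm' VU Xc Xc' cm' c'm').
apply/(grad_Jmx_flux g u _ Xc cm').
have xb : ball x r (coord c m') by rewrite -VB; exists m'.
have E i : partial i ((th \o coord c) \o coordV c) (coord c m') = a i (coord c m').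
  by rewrite -pth // /partial; apply/esym/near_eq_derive/thE.
by rewrite !E.
Unshelve. all: by end_near. Qed.

Lemma local_conjugate_rigid V th V' th' m : local_conjugate V th ->
  local_conjugate V' th' -> V m -> V' m ->
  \forall m' \near m, th m' - th m = th' m' - th' m.
Proof.
move=> [oV VU sth gth] [oV' VU' sth' gth'] Vm V'm.
have [c Xc cm] := atlas_cover X m.
have oVV : open (V `&` V') by exact: openI.
have [r r0 Br] := chart_ball oVV cm (conj Vm V'm).
set x := coord c m in Br *.
pose f y := th (coordV c y) - th' (coordV c y).
have Bdom y : ball x r y ->
    [/\ dom c (coordV c y), V (coordV c y), V' (coordV c y) & coord c (coordV c y) = y].
  by move=> /Br [m' [cm' [Vm' V'm']] <-]; rewrite coordK.
have d1 y : ball x r y -> differentiable (th \o coordV c) y.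
  move=> yb; have [cy Vy V'y yE] := Bdom y yb; rewrite -yE.
  exact: smooth_fun_differentiable sth Xc cy Vy.
have d2 y : ball x r y -> differentiable (th' \o coordV c) y.
  move=> yb; have [cy Vy V'y yE] := Bdom y yb; rewrite -yE.
  exact: smooth_fun_differentiable sth' Xc cy V'y.
have df y : ball x r y -> differentiable f y.
  by move=> yb; exact: (differentiableB (d1 y yb) (d2 y yb)).
have pf y i : ball x r y -> partial i f y = 0.
  move=> yb; have [cy Vy V'y yE] := Bdom y yb.
  have := etrans (gth c _ Xc cy Vy) (esym (gth' c _ Xc cy V'y)).
  move/(can_inj (mulmxKV (gmx_unit g Xc cy))) => /rowP/(_ i); rewrite !mxE /dchart yE => E.
  have := deriveB (diff_derivable (d1 y yb) (v := bvec R i)) (diff_derivable (d2 y yb) (v := bvec R i)).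
  by rewrite E subrr.
have fc := derive0_ball_cst df pf.
have : \forall m' \near m, ball x r (coord c m').
  by apply: near_coord => //; apply: open_nbhs_nbhs; split; [exact: ball_open|exact: ballxx].
have nd := near_dom cm; move=> nb; near=> m'.
have cm' : dom c m' by near: m'.
have mb : ball x r (coord c m') by near: m'.
have := fc _ mb; rewrite /f /x !coordK // => E.
by apply/eqP; rewrite -subr_eq0; apply/eqP; lra.
Unshelve. all: by end_near. Qed.

Lemma local_conjugate_path V th m : local_conjugate V th -> V m ->
  \forall m' \near m, exists w : R -> M, [/\ path_in V w, w 0 = m & w 1 = m'].
Proof.
move=> [oV _ _ _] Vm; have [c Xc cm] := atlas_cover X m.
have [r r0 Br] := chart_ball oV cm Vm.
set x := coord c m in Br *.
have : \forall m' \near m, ball x r (coord c m').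
  by apply: near_coord => //; apply: open_nbhs_nbhs; split; [exact: ball_open|exact: ballxx].
have nd := near_dom cm; move=> nb; near=> m'.
have cm' : dom c m' by near: m'.
have mb : ball x r (coord c m') by near: m'.
pose l (s : R) := s *: (coord c m' - x) + x.
have lb s : s \in `[0, 1] -> ball x r (l s) by move=> s01; exact: ball_segment.
have Bdom y : ball x r y -> (coord c @` dom c) y /\ V (coordV c y).
  by move=> /Br [m1 [cm1 Vm1] <-]; rewrite coordK //; split => //; exists m1.
have cl : continuous l.
  by move=> s; apply: cvgD; [exact: scalel_continuous|exact: cvg_cst].
exists (coordV c \o l); split.
- split=> [|s s01]; last exact: (Bdom _ (lb s s01)).2.
  apply: continuous_in_subspaceT => s; rewrite inE => s01.
  apply: continuous_comp; first exact: cl.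
  exact: (coordV_continuous (Bdom _ (lb s s01)).1).
- by rewrite /= /l scale0r add0r coordK.
- by rewrite /= /l scale1r subrK coordK.
Unshelve. all: by end_near. Qed.

Lemma harmonic_conjugate : simply_connected R U ->
  (forall c m, atlas X c -> dom c m -> U m -> laplacian g c u m = 0) ->
  exists2 th, smooth_fun X U th & forall c m, atlas X c -> dom c m -> U m ->
    grad g c th m = grad g c u m *m Jmx g c m.
Proof.
move=> scU Lu.
have [Th HTh] := @monodromy R M U local_conjugate
  (fun V th H => let: And4 a b _ _ := H in conj a b)
  (fun m => @local_conjugate_ex m Lu) local_conjugate_rigid local_conjugate_path scU.
have near_chart V th c m : local_conjugate V th -> V m -> atlas X c -> dom c m ->
    \forall x \near coord c m, (th \o coordV c) x + (Th m - th m) = (Th \o coordV c) x.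
  move=> lc Vm Xc cm; have H := HTh V th lc m Vm.
  have : \forall x \near coord c m, Th (coordV c x) - Th m = th (coordV c x) - th m.
    have Ix : (coord c @` dom c) (coord c m) by exists m.
    have H' : nbhs (coordV c (coord c m)) [set m' | Th m' - Th m = th m' - th m].
      by rewrite coordK.
    exact: (coordV_continuous Ix H').
  by apply: filterS => x /= E; apply/eqP; rewrite -subr_eq0; apply/eqP; lra.
have sTh : smooth_fun X U Th.
  apply: smooth_fun_local => m Um.
  have [V [th [lc Vm]]] := local_conjugate_ex Lu Um.
  have [c Xc cm] := atlas_cover X m.
  have [oV VU sth gth] := lc.
  have := near_chart V th c m lc Vm Xc cm => H.
  have Hn : \forall x \near coord c m, (th \o coordV c) x + (Th m - th m) = (Th \o coordV c) x /\
       (coord c @` (dom c `&` V)) x.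
    by near=> x; split; near: x => //; exact: near_coordV.
  have /nbhs_ballP[r /= r0 Br] := Hn.
  have BV : ball (coord c m) r `<=` coord c @` (dom c `&` V) by move=> y /Br[].
  have [oB BE] := chart_ball_open BV.
  exists c, (coordV c @` ball (coord c m) r); split => //.
  - by exists (coord c m); [exact: ballxx|rewrite coordK].
  - by move=> _ [y yb <-]; have [m' [cm' _] <-] := BV _ yb; rewrite coordK.
  rewrite BE; apply: (@eq_smooth_on _ _ _ (fun x => (th \o coordV c) x + (Th m - th m))).
  - exact: ball_open.
  - by move=> y /Br[].
  apply: smooth_onD; [exact: ball_open| |exact: smooth_on_cst].
  exact: smooth_on_sub BV (sth c Xc).
exists Th => // c m Xc cm Um.
have [V [th [lc Vm]]] := local_conjugate_ex Lu Um.
have [oV VU sth gth] := lc; rewrite -(gth c m) //.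
rewrite /grad; congr (_ *m _); apply/rowP => i; rewrite !mxE /dchart.
rewrite -(near_eq_derive _ (near_chart V th c m lc Vm Xc cm)).
have dth := smooth_fun_differentiable sth Xc cm Vm.
have -> : (fun x => (th \o coordV c) x + (Th m - th m)) = (th \o coordV c) + cst (Th m - th m) by [].
rewrite deriveD; [|exact: diff_derivable|exact: derivable_cst].
by rewrite derive_cst addr0.
Unshelve. all: by end_near. Qed.

End HarmonicConjugate.

(** Here a and b stand for dp and dq, G for the metric and v for its area density; the last
    hypothesis is grad p = J grad q. Each weighted gradient becomes a quarter turn of the other
    differential, with no metric left on the right. *)
Lemma rotated_dual (F : fieldType) (G : 'M[F]_2) (v : F) (a b : 'rV[F]_2) :
  G \in unitmx -> v != 0 -> G *m Kmx F = v ^+ 2 *: (Kmx F *m invmx G) ->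
  a *m invmx G = b *m invmx G *m (v^-1 *: (G *m Kmx F)) ->
  v *: (a *m invmx G) = b *m Kmx F /\ v *: (b *m invmx G) = - (a *m Kmx F).
Proof.
move=> uG v0 GK E.
have E1 : v *: (a *m invmx G) = b *m Kmx F.
  by rewrite E -scalemxAr scalerA mulfV // scale1r mulmxA mulmxKV.
split=> //; apply: (scalerI v0).
have -> : b *m invmx G = - (b *m Kmx F *m (Kmx F *m invmx G)).
  by rewrite mulmxA -[b *m _ *m _]mulmxA Kmx_sqr mulmxN mulmx1 mulNmx opprK.
rewrite -E1 !scalerN scalerA -expr2; congr (- _).
by rewrite (scalemxAr (v ^+ 2)) -GK -scalemxAl mulmxA mulmxKV.
Qed.

Lemma derive_ln (R : realType) (V : normedModType R) (f : V -> R) x v :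
  differentiable f x -> 0 < f x ->
  'D_v (fun y => ln (f y)) x = (f x)^-1 * 'D_v f x.
Proof.
move=> df f0; have D := is_derive1_ln f0.
have dl : differentiable (@ln R) (f x) by apply/derivable1_diffP; case: D.
rewrite (derive_comp v df dl) (deriveE _ dl) -[X in 'd _ _ X]mulr1 linearZ /=.
by rewrite -(deriveE _ dl) (@derive_val _ _ _ _ _ _ _ D) mulrC.
Qed.

Section ArgumentForm.
Variables (R : realType) (O : set 'rV[R]_2) (P Q I : 'rV[R]_2 -> R[i]).
Hypothesis oO : open O.
Hypotheses (sP : csmooth_on O P) (sQ : csmooth_on O Q) (sI : csmooth_on O I).
Hypothesis hI : forall x, O x -> (P x ^+ 2 + Q x ^+ 2) * I x = 1.
Local Notation d i F := (cderive (bvec R i) F).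

Let dif F x : csmooth_on O F -> O x -> cdifferentiable F x.
Proof. exact: csmooth_on_differentiable. Qed.

Lemma cderive_commute F x (i j : 'I_2) : csmooth_on O F -> O x -> d i (d j F) x = d j (d i F) x.
Proof.
by move=> [f1 f2] Ox; apply: complexP => /=; exact: (partial_commute _ _ oO).
Qed.

Let dI i x : O x -> d i I x = - 2 * (P x * d i P x + Q x * d i Q x) * I x ^+ 2.
Proof.
move=> Ox.
have dP := dif sP Ox; have dQ := dif sQ Ox; have dI := dif sI Ox.
have E : \forall y \near x, (P y * P y + Q y * Q y) * I y = 1.
  near=> y; rewrite -!expr2; apply: hI; near: y; exact: open_nbhs_nbhs.
have := near_eq_cderive (bvec R i) E; rewrite cderive_cst.
rewrite cderiveM //; last by apply: cdifferentiableD; exact: cdifferentiableM.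
rewrite cderiveD; [|exact: cdifferentiableM..].
rewrite !cderiveM // => H; have := hI Ox.
move: (d i P x) (d i Q x) (d i I x) H => p q e.
move: (P x) (Q x) (I x) => a b w H h.
have -> : e = ((a * a + b * b) * e) * w.
  by rewrite mulrAC -!expr2 h mul1r.
have -> : (a * a + b * b) * e = - ((p * a + a * p + (q * b + b * q)) * w).
  by apply/eqP; rewrite -addr_eq0 addrC; apply/eqP.
ring.
Unshelve. all: by end_near. Qed.

Lemma cderive_opp_sumsq i x : O x ->
  d i (fun y => (-1) * (P y * P y + Q y * Q y)) x =
  - 2 * (P x * d i P x + Q x * d i Q x).
Proof.
move=> Ox; have dP := dif sP Ox; have dQ := dif sQ Ox.
have d1 : cdifferentiable (fun=> -1 : R[i]) x by apply: dif Ox; exact: csmooth_on_cst.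
have dPP := cdifferentiableM dP dP; have dQQ := cdifferentiableM dQ dQ.
rewrite (cderiveM _ d1 (cdifferentiableD dPP dQQ)) cderive_cst mul0r add0r.
rewrite (cderiveD _ dPP dQQ) (cderiveM _ dP dP) (cderiveM _ dQ dQ).
by move: (d i P x) (d i Q x) (P x) (Q x) => a b p q; ring.
Qed.

(** Differential of the polar angle of the pair (P, Q), with [I] as the reciprocal of P^2 + Q^2. The
    formula is single-valued even for complex P and Q, where an angle would need a branch of the
    logarithm. *)
Definition argument_form (j : 'I_2) x : R[i] :=
  (P x * d j Q x + (-1) * (Q x * d j P x)) * I x.

Lemma argument_form_smooth j : csmooth_on O (argument_form j).
Proof.
apply: csmooth_onM => //; apply: csmooth_onD => //.
  by apply: csmooth_onM => //; exact: csmooth_on_cderive.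
apply: csmooth_onM => //; first exact: csmooth_on_cst.
by apply: csmooth_onM => //; exact: csmooth_on_cderive.
Qed.

Lemma cderive_scale_argument_form (a : R[i]) i j x : O x ->
  d i (fun y => a * argument_form j y) x = a * d i (argument_form j) x.
Proof.
move=> Ox; have da : cdifferentiable (fun=> a) x by apply: dif Ox; exact: csmooth_on_cst.
by rewrite (cderiveM _ da (dif (argument_form_smooth j) Ox)) cderive_cst mul0r add0r.
Qed.

Lemma argument_form_closed x : O x ->
  d 1 (argument_form 0) x = d 0 (argument_form 1) x.
Proof.
move=> Ox; rewrite /argument_form.
have dP := dif sP Ox; have dQ := dif sQ Ox; have dI' := dif sI Ox.
have dp j : cdifferentiable (d j P) x by exact: dif (csmooth_on_cderive j sP) Ox.
have dq j : cdifferentiable (d j Q) x by exact: dif (csmooth_on_cderive j sQ) Ox.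
have d1 : cdifferentiable (fun=> -1 : R[i]) x.
  by apply: dif Ox; exact: csmooth_on_cst.
have E (k j : 'I_2) : d k (fun x => (P x * d j Q x + (-1) * (Q x * d j P x)) * I x) x =
    (d k P x * d j Q x + P x * d k (d j Q) x - (d k Q x * d j P x + Q x * d k (d j P) x)) * I x
    + (P x * d j Q x - Q x * d j P x) * (- 2 * (P x * d k P x + Q x * d k Q x) * I x ^+ 2).
  rewrite cderiveM //; last by apply: cdifferentiableD; [exact: cdifferentiableM|apply: cdifferentiableM => //; exact: cdifferentiableM].
  rewrite cderiveD; [|exact: cdifferentiableM|by apply: cdifferentiableM => //; exact: cdifferentiableM].
  rewrite (cderiveM _ dP (dq j)) (cderiveM _ d1 (cdifferentiableM dQ (dp j))).
  rewrite (cderiveM _ dQ (dp j)) cderive_cst dI //.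
  by rewrite mul0r add0r !mulN1r.
rewrite !E (cderive_commute 1 0 sQ Ox) (cderive_commute 1 0 sP Ox).
have := hI Ox.
move: (d 0 (d 1 Q) x) (d 0 (d 1 P) x) (d 0 P x) (d 1 P x) (d 0 Q x) (d 1 Q x) => qq pp p0 p1 q0 q1.
move: (P x) (Q x) (I x) => a b w h.
apply/eqP; rewrite -subr_eq0; apply/eqP.
(* After the mixed second derivatives are identified, the difference is a multiple of 1 - (P^2 +
   Q^2) I. *)
transitivity ((2 * (p1 * q0 - q1 * p0)) * w * (1 - (a ^+ 2 + b ^+ 2) * w)); first by ring.
by rewrite h subrr mulr0.
Qed.

End ArgumentForm.

Section LogLaplacian.
Variables (R : realType) (M : topologicalType) (X : oriented_manifold R 2 M).
Variable g : riemannian_metric X.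
Implicit Types (c : chart R 2 M) (m : M) (U V : set M).
Local Notation cmx := (map_mx (real_complex R)).

Lemma eq_laplacian c f f' m V : open V -> V m -> dom c m ->
  (forall m', dom c m' -> V m' -> f m' = f' m') ->
  laplacian g c f m = laplacian g c f' m.
Proof.
move=> oV Vm cm ff.
have dE m' v : dom c m' -> V m' -> dchart c v f m' = dchart c v f' m'.
  move=> cm' Vm'; apply: near_eq_derive; near=> x.
  have [m1 [cm1 Vm1] <-] : (coord c @` (dom c `&` V)) x by near: x; exact: near_coordV.
  by rewrite /= coordK // ff.
have gE m' : dom c m' -> V m' -> grad g c f m' = grad g c f' m'.
  by move=> cm' Vm'; rewrite /grad; congr (_ *m _); apply/rowP => i; rewrite !mxE dE.
rewrite /laplacian /divergence; apply: eq_bigr => i _; rewrite /nabla (gE m cm Vm).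
apply: (congr1 (fun T : 'rV[R]_2 =>
  (T + christoffel_term g c m (bvec R i) (grad g c f' m)) 0 i)).
apply/rowP => k; rewrite [LHS]mxE [RHS]mxE /dchart; apply: near_eq_derive; near=> x.
have [m1 [cm1 Vm1] <-] : (coord c @` (dom c `&` V)) x by near: x; exact: near_coordV.
by rewrite /= coordK // (gE m1).
Unshelve. all: by end_near. Qed.

(* With F = -(p^2 + q^2) and grad p = J grad q, the rotated gradient of log F
   is the closed form 2 (p dq - q dp) / (p^2 + q^2). *)
Lemma laplacian_ln_factor U (p q : M -> R[i]) (F : M -> R) c m :
  open U -> csmooth_fun X U p -> csmooth_fun X U q ->
  (forall m, U m -> p m ^+ 2 + q m ^+ 2 = - (F m)%:C) ->
  (forall m, U m -> 0 < F m) ->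
  (forall c m, atlas X c -> dom c m -> U m -> conjugate g c p q m) ->
  atlas X c -> dom c m -> U m -> laplacian g c (fun m => ln (F m)) m = 0.
Proof.
move=> oU sp sq pqF F0 pq Xc cm Um.
set O := coord c @` (dom c `&` U).
have oO : open O by exact: open_coord_image.
have Ox : O (coord c m) by exists m.
have sP := csmooth_on_chart sp Xc; have sQ := csmooth_on_chart sq Xc.
set P := p \o coordV c in sP; set Q := q \o coordV c in sQ.
have OU x : O x -> U (coordV c x) by move=> [m' [cm' Um'] <-]; rewrite coordK.
have FE m' : U m' -> F m' = - cRe (p m' ^+ 2 + q m' ^+ 2).
  by move=> Um'; rewrite pqF //= opprK.
have sF : smooth_fun X U F.
  move=> c' Xc'; have oO' : open (coord c' @` (dom c' `&` U)) by exact: open_coord_image.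
  have [s1 _] := csmooth_onD oO' (csmooth_onM oO' (csmooth_on_chart sp Xc') (csmooth_on_chart sp Xc'))
    (csmooth_onM oO' (csmooth_on_chart sq Xc') (csmooth_on_chart sq Xc')).
  apply: (eq_smooth_on oO' _ (smooth_onN oO' s1)) => _ [m' [cm' Um'] <-].
  by rewrite /= coordK // FE // !expr2.
have sln : smooth_fun X U (fun m => ln (F m)).
  move=> c' Xc'; have oO' : open (coord c' @` (dom c' `&` U)) by exact: open_coord_image.
  apply: (smooth_on_ln oO' (sF c' Xc')) => _ [m' [cm' Um'] <-].
  by rewrite /= coordK // F0.
pose I x : R[i] := (- (F (coordV c x))^-1)%:C.
have sI : csmooth_on O I.
  apply: csmooth_onC => //; apply: smooth_onN => //; apply: (smooth_onV oO (sF c Xc)).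
  by move=> x Hx; rewrite /= gt_eqF //; exact: F0 (OU _ Hx).
have hI x : O x -> (P x ^+ 2 + Q x ^+ 2) * I x = 1.
  move=> Hx; rewrite (pqF _ (OU _ Hx)) /I -rmorphN /= -rmorphM /= mulrNN mulfV ?rmorph1 //.
  by rewrite gt_eqF //; exact: F0 (OU _ Hx).
have closed := argument_form_closed oO sP sQ sI hI Ox.
(* Since dF = -2 (p dp + q dq), the flux of log F combines the weighted gradients of p and q; [E1]
   and [E2] turn them into rotated differentials of q and p, and [I] is -1/F. *)
have key x : O x -> (flux g c (fun m => ln (F m)) 0 x)%:C = (- 2) * argument_form P Q I 1 x /\ (flux g c (fun m => ln (F m)) 1 x)%:C = 2 * argument_form P Q I 0 x.
  move=> Hx; have Um' := OU _ Hx.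
  have [cm' xx] : dom c (coordV c x) /\ coord c (coordV c x) = x.
    by apply: coord_image; move: Hx => [m' [cm' _] E]; exists m'.
  set m' := coordV c x in Um' cm' xx.
  have uG := gmx_unit g Xc cm'; have v0 := vol_gt0 g Xc cm'.
  have vC : (vol g c m')%:C != 0 :> R[i].
    by apply/eqP => /(congr1 cRe) /= E; move: v0; rewrite E ltxx.
  have Kc : cmx (Kmx R) = Kmx R[i] by rewrite /Kmx raddfB /= !map_delta_mx.
  have uGc : cmx (gmx g c m') \in unitmx by rewrite map_unitmx.
  have gK : cmx (gmx g c m') *m Kmx R[i] =
      (vol g c m')%:C ^+ 2 *: (Kmx R[i] *m invmx (cmx (gmx g c m'))).
    have := congr1 (map_mx (real_complex R)) (gmx_Kmx g Xc cm').
    rewrite map_mxM map_mxZ map_mxM map_invmx Kc => ->.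
    by rewrite rmorphXn.
  have [E1 E2] : (vol g c m')%:C *: cgrad g c p m' = cdiff_row c q m' *m Kmx R[i] /\
      (vol g c m')%:C *: cgrad g c q m' = - (cdiff_row c p m' *m Kmx R[i]).
    have := pq c m' Xc cm' Um'; rewrite /conjugate !cgradE JmxE -/(vol g c m').
    rewrite map_mxZ map_mxM map_invmx Kc fmorphV; exact: rotated_dual.
  have dlnF : (diff_row c (fun m => ln (F m)) m' : 'rV[R]_2) = (F m')^-1 *: diff_row c F m'.
    apply/rowP => i; rewrite !mxE /dchart xx.
    have dF : differentiable (F \o coordV c) x by exact: (smooth_on_differentiable (sF c Xc)).
    exact: (derive_ln (bvec R i) dF (F0 m' Um')).
  have dFC : cmx (diff_row c F m') = - 2 *: (p m' *: cdiff_row c p m' + q m' *: cdiff_row c q m').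
    apply/rowP => i; rewrite !mxE.
    pose G y := (-1) * (P y * P y + Q y * Q y).
    have GE : \forall y \near x, G y = (F (coordV c y))%:C.
      have nO : \forall y \near x, O y by exact: (open_nbhs_nbhs (conj oO Hx)).
      apply: filterS nO => y Oy; rewrite /G mulN1r -!expr2.
      have -> : P y ^+ 2 + Q y ^+ 2 = - (F (coordV c y))%:C := pqF _ (OU _ Oy).
      by rewrite opprK.
    have H1 : dchart c (bvec R i) F m' = 'D_(bvec R i) (cRe \o G) x.
      rewrite /dchart xx; apply: near_eq_derive; apply: filterS GE => y yE.
      by rewrite /= yE.
    have H2 : 0 = 'D_(bvec R i) (cIm \o G) x.
      rewrite -(derive_cst (0 : R) x (bvec R i)); apply: near_eq_derive.
      by apply: filterS GE => y yE; rewrite /= yE.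
    have -> : (dchart c (bvec R i) F m')%:C = cderive (bvec R i) G x by apply: complexP.
    rewrite (cderive_opp_sumsq sP sQ i Hx) !cdchartE xx.
    by [].
  have fR : (vol g c m')%:C *: cmx (grad g c (fun m => ln (F m)) m') =
      (2 * I x) *: ((p m' *: cdiff_row c q m' - q m' *: cdiff_row c p m') *m Kmx R[i]).
    have -> : grad g c (fun m => ln (F m)) m' =
        (F m')^-1 *: (diff_row c F m' *m invmx (gmx g c m')).
      by rewrite /grad -/(diff_row c (fun m => ln (F m)) m') dlnF scalemxAl.
    rewrite map_mxZ map_mxM dFC -scalemxAl mulmxDl -!scalemxAl -!cgradE.
    rewrite mulmxBl -!scalemxAl -E1 -[cdiff_row c p m' *m _]opprK -E2 scalerN opprK.
    rewrite /I rmorphN /=; move: (cgrad g c p m') (cgrad g c q m') => A B.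
    move: ((F m')^-1)%:C ((vol g c m')%:C) => w v.
    apply/rowP => j; rewrite !mxE.
    by move: (A 0 j) (B 0 j) (p m') (q m') => a b u v'; ring.
  have fE i : (flux g c (fun m => ln (F m)) i x)%:C =
      ((vol g c m')%:C *: cmx (grad g c (fun m => ln (F m)) m')) 0 i.
    by rewrite /flux -/m' !mxE rmorphM.
  set w := p m' *: cdiff_row c q m' - q m' *: cdiff_row c p m' in fR.
  have wE j : w 0 j = P x * cderive (bvec R j) Q x + (-1) * (Q x * cderive (bvec R j) P x).
    by rewrite /w !mxE !cdchartE xx mulN1r.
  have [k0 k1] := mul_row_Kmx w.
  have sE (a : R[i]) (v : 'rV[R[i]]_2) i : (a *: v) 0 i = a * v 0 i by rewrite mxE.
  rewrite !fE !fR !sE k0 k1 !wE /argument_form.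
  move: (P x * _ + _) (P x * _ + _) (I x) => a b e.
  by split; ring.
have nO : \forall y \near coord c m, O y by exact: (open_nbhs_nbhs (conj oO Ox)).
have S0 := congr1 cRe (cderive_scale_argument_form oO sP sQ sI (-2) 0 1 Ox).
have S1 := congr1 cRe (cderive_scale_argument_form oO sP sQ sI 2 1 0 Ox).
have p0 : partial 0 (flux g c (fun m => ln (F m)) 0) (coord c m) =
    cRe ((- 2) * cderive (bvec R 0) (argument_form P Q I 1) (coord c m)).
  apply: etrans S0; apply: near_eq_derive.
  by apply: filterS nO => y Oy; exact: (congr1 cRe (key y Oy).1).
have p1 : partial 1 (flux g c (fun m => ln (F m)) 1) (coord c m) =
    cRe (2 * cderive (bvec R 1) (argument_form P Q I 0) (coord c m)).
  apply: etrans S1; apply: near_eq_derive.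
  by apply: filterS nO => y Oy; exact: (congr1 cRe (key y Oy).2).
have v0 := vol_gt0 g Xc cm.
(* The two flux derivatives are the real parts of -2 d_0 and 2 d_1 of the components 1 and 0 of a
   closed form. *)
have E : vol g c m * laplacian g c (fun m => ln (F m)) m = 0.
  rewrite (laplacian_flux g oU Xc sln cm Um) p0 p1 closed.
  move: (cderive (bvec R 0) _ (coord c m)) => [a b] /=; ring.
by move: E => /eqP; rewrite mulf_eq0 (gt_eqF v0) => /eqP.
Qed.

End LogLaplacian.

(** * The shape operator of an immersion in a flat space *)

Lemma derive_matrix_row (R : realType) m n (T : 'rV[R]_m -> 'rV[R]_n) x v :
  (forall j, differentiable (fun y => T y 0 j) x) ->
  \row_k 'D_v (fun y => T y 0 k) x = v *m \matrix_(i, k) partial i (fun y => T y 0 k) x.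
Proof.
move=> dT; apply/rowP => k; rewrite !mxE derive_partialE //.
by apply: eq_bigr => i _; rewrite mxE.
Qed.

Lemma mxtrace_square_conj (F : fieldType) n (A B J : 'M[F]_n) :
  J \in unitmx -> A *m J = J *m B -> \tr A = \tr B /\ \tr (A *m A) = \tr (B *m B).
Proof.
move=> uJ E; have -> : A = J *m B *m invmx J by rewrite -E mulmxK.
have tJ (C : 'M[F]_n) : \tr (J *m C *m invmx J) = \tr C.
  by rewrite mxtrace_mulC mulKmx.
by split; rewrite ?tJ // -!mulmxA mulKmx // -(tJ (B *m B)) -!mulmxA.
Qed.

Lemma row_mul2 (R : realType) m n p (A : 'M[R]_(m, n)) (B : 'M[R]_(n, p)) i :
  row i (A *m B) = bvec R i *m A *m B.
Proof. by rewrite rowE mulmxA. Qed.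

Lemma row_mul3 (R : realType) m n p q (A : 'M[R]_(m, n)) (B : 'M[R]_(n, p)) (C : 'M[R]_(p, q)) i :
  row i (A *m B *m C) = bvec R i *m A *m B *m C.
Proof. by rewrite row_mul2 mulmxA. Qed.

Section Immersion.
Variables (R : realType) (M N : topologicalType).
Variables (X : oriented_manifold R 2 M) (g : riemannian_metric X).
Variables (Y : oriented_manifold R 3 N) (h : riemannian_metric Y).
Variables (phi : M -> N) (xi : chart R 3 N -> M -> 'rV[R]_3).
Variable A : chart R 2 M -> M -> 'M[R]_2.
Hypotheses (hphi : isometric_immersion g h phi) (hxi : unit_normal X h phi xi).
Hypothesis hA : shape_operator X h phi xi A.
Implicit Types (c : chart R 2 M) (m : M).

Lemma christoffel_flat (c' : chart R 3 N) n i j k : dom c' n ->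
  (forall n', dom c' n' -> gmx h c' n' = 1%:M) -> christoffel h c' n i j k = 0.
Proof.
move=> cn fl; rewrite /christoffel big1 ?mulr0 // => l _.
have E (a b : 'I_3) v : dchart c' v (fun n' => gmx h c' n' a b) n = 0.
  rewrite -(derive_cst ((1%:M : 'M[R]_3) a b) (coord c' n) v); apply: near_eq_derive.
  near=> x; have [n' [cn' _] <-] : (coord c' @` (dom c' `&` setT)) x.
    by near: x; apply: near_coordV => //; exact: openT.
  by rewrite /= coordK // fl.
by rewrite !E addr0 subr0 mulr0.
Unshelve. all: by end_near. Qed.

Lemma open_preimage_dom (c' : chart R 3 N) : open (phi @^-1` dom c').
Proof. by have /continuousP := immersion_continuous hphi; apply; exact: dom_open. Qed.

Section InCharts.
Variables (c : chart R 2 M) (c' : chart R 3 N).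
Hypotheses (Xc : atlas X c) (Yc' : atlas Y c').

Let V := phi @^-1` dom c'.
Let O := coord c @` (dom c `&` V).

Let oO : open O.
Proof. by apply: open_coord_image; exact: open_preimage_dom. Qed.

Lemma local_rep_differentiable m : dom c m -> dom c' (phi m) ->
  differentiable (local_rep phi c c') (coord c m).
Proof.
move=> cm c'm; apply: differentiable_rowP => j.
by apply: (smooth_on_differentiable (immersion_smooth hphi j Xc Yc')); exists m.
Qed.

Lemma dmap_smooth : smooth_mx O (fun x => dmap phi c c' (coordV c x)).
Proof.
move=> i j; have sF := immersion_smooth hphi j Xc Yc'.
apply: (eq_smooth_on oO _ (smooth_on_partial i sF)) => _ [m [cm c'm] <-].
rewrite /dmap coordK // jacobianE //; exact: local_rep_differentiable.
Qed.

Lemma normal_smooth_on j : smooth_on O (fun x => xi c' (coordV c x) 0 j).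
Proof. exact: (normal_smooth hxi j Yc' Xc). Qed.

Hypothesis fl : forall n, dom c' n -> gmx h c' n = 1%:M.

Definition dnormal (x : 'rV[R]_2) : 'M[R]_(2, 3) :=
  \matrix_(i, k) partial i (fun y => xi c' (coordV c y) 0 k) x.

(** In a flat chart the ambient Christoffel symbols vanish, so the covariant derivative along [phi]
    is the componentwise one. *)
Lemma dnormalE m : dom c m -> dom c' (phi m) ->
  dnormal (coord c m) = - (A c m *m dmap phi c c' m).
Proof.
move=> cm c'm; have Ox : O (coord c m) by exists m.
have H (v : 'rV[R]_2) : v *m dnormal (coord c m) = v *m - (A c m *m dmap phi c c' m).
  have := hA v Xc Yc' cm c'm; rewrite mulmxN mulmxA => <-.
  rewrite /nabla_along (_ : christoffel_term _ _ _ _ _ = 0).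
    rewrite addr0 -derive_matrix_row // => j.
    exact: (smooth_on_differentiable (normal_smooth_on j) Ox).
  apply/rowP => k; rewrite !mxE big1 // => i _; rewrite big1 // => j _.
  by rewrite christoffel_flat // mulr0.
by apply/row_matrixP => i; rewrite !rowE H.
Qed.

Lemma gmx_flat m : dom c m -> dom c' (phi m) ->
  gmx g c m = dmap phi c c' m *m (dmap phi c c' m)^T.
Proof.
by move=> cm c'm; rewrite (immersion_isometric hphi Xc Yc' cm c'm) fl // mulmx1.
Qed.

Lemma shape_gmx m : dom c m -> dom c' (phi m) ->
  A c m *m gmx g c m = - (dnormal (coord c m) *m (dmap phi c c' m)^T).
Proof.
by move=> cm c'm; rewrite dnormalE // gmx_flat // mulmxA mulNmx opprK.
Qed.

(** [A] is known only as a solution of the Weingarten equation. Solving A g = - dxi dphi^T for [A]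
    writes it through smooth data. *)
Lemma shape_smooth_flat : smooth_mx O (fun x => A c (coordV c x)).
Proof.
have sub : O `<=` coord c @` dom c by move=> _ [m [cm _] <-]; exists m.
have sg : smooth_mx O (fun x => gmx g c (coordV c x)).
  by move=> i j; apply: smooth_on_sub (gmx_smooth_mx g Xc i j).
have sD : smooth_mx O dnormal.
  move=> i j; apply: (eq_smooth_on oO _ (smooth_on_partial i (normal_smooth_on j))).
  by move=> x _; rewrite mxE.
have uG x : O x -> gmx g c (coordV c x) \in unitmx.
  by move=> [m [cm _] <-]; rewrite coordK //; exact: gmx_unit.
have s := smooth_mxM oO (smooth_mxM oO (smooth_mxM oO (smooth_mx_cst (O := O) (- 1%:M : 'M[R]_2)) sD) (smooth_mx_tr oO dmap_smooth))
  (smooth_mx_inv oO sg uG).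
move=> i j; apply: (eq_smooth_on oO _ (s i j)) => _ [m [cm c'm] <-].
rewrite !coordK // !mulNmx mul1mx; congr (fun_of_matrix _ i j).
by rewrite -mulNmx -shape_gmx // mulmxK // gmx_unit.
Qed.

(** Differentiating the orthogonality of xi and d_j phi identifies the entries of A g with the
    products of xi and d_i d_j phi, symmetric because partial derivatives commute. *)
Lemma shape_gmx_sym_flat m : dom c m -> dom c' (phi m) ->
  (A c m *m gmx g c m)^T = A c m *m gmx g c m.
Proof.
move=> cm c'm; rewrite shape_gmx //; set x := coord c m.
have Ox : O x by exists m.
pose F k : 'rV[R]_2 -> R := fun y => local_rep phi c c' y 0 k.
pose Z k : 'rV[R]_2 -> R := fun y => xi c' (coordV c y) 0 k.
have sF k : smooth_on O (F k) := immersion_smooth hphi k Xc Yc'.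
have sZ k : smooth_on O (Z k) := normal_smooth_on k.
have DE m' j k : dom c m' -> dom c' (phi m') -> dmap phi c c' m' j k = partial j (F k) (coord c m').
  by move=> *; rewrite /dmap jacobianE //; exact: local_rep_differentiable.
have key i j : (dnormal x *m (dmap phi c c' m)^T) i j = - \sum_k Z k x * partial i (partial j (F k)) x.
  have E : \forall y \near x, \sum_k Z k y * partial j (F k) y = 0.
    have nO : \forall y \near x, O y by exact: (open_nbhs_nbhs (conj oO Ox)).
    apply: filterS nO => _ [m' [cm' c'm'] <-].
    have := congr1 (fun B : 'M[R]_(2, 1) => B j 0) (normal_orthogonal hxi Xc Yc' cm' c'm').
    rewrite fl // mulmx1 mxE => E; have z0 : (0 : 'M[R]_(2, 1)) j 0 = 0 by rewrite mxE.
    apply: (etrans _ (etrans E z0)).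
    by apply: eq_bigr => k _; rewrite [(xi _ _)^T _ _]mxE DE // /Z coordK // mulrC.
  have := near_eq_derive (bvec R i) E; rewrite derive_cst.
  have dZ k : differentiable (Z k) x by exact: (smooth_on_differentiable (sZ k) Ox).
  have dF k : differentiable (partial j (F k)) x.
    exact: (smooth_on_differentiable (smooth_on_partial j (sF k)) Ox).
  have dM k : differentiable (fun y => Z k y * partial j (F k) y) x.
    by apply: differentiableM; [exact: dZ|exact: dF].
  rewrite -fct_sumE derive_sum; last by move=> k; exact/diff_derivable.
  move=> H; rewrite mxE; apply/eqP; rewrite -addr_eq0 -big_split /= -[X in _ == X]H; apply/eqP.
  apply: eq_bigr => k _.
  rewrite (deriveM (diff_derivable (dZ k)) (diff_derivable (dF k))).
  rewrite mxE [_^T _ _]mxE DE //; rewrite /partial -/(partial i (Z k) x) /GRing.scale /=.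
  by rewrite addrC; congr (_ + _); rewrite mulrC.
have sT : (dnormal x *m (dmap phi c c' m)^T)^T = dnormal x *m (dmap phi c c' m)^T.
  apply/matrixP => i j; apply: etrans (mxE _ _ _ _) _; rewrite (key j i) (key i j).
  apply: (congr1 -%R); apply: eq_bigr => k _; apply: (congr1 ( *%R (Z k x))).
  exact: (partial_commute j i oO (sF k) Ox).
by move: (dnormal x *m _) sT => T sT; rewrite linearN /= sT.
Qed.

End InCharts.

Lemma dmap_change c1 c2 (c' : chart R 3 N) m : atlas X c1 -> atlas X c2 -> atlas Y c' ->
  dom c1 m -> dom c2 m -> dom c' (phi m) ->
  dmap phi c1 c' m = jacobian (transition c1 c2) (coord c1 m) *m dmap phi c2 c' m.
Proof.
move=> Xc1 Xc2 Yc' c1m c2m c'm.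
have dT := transition_differentiable Xc1 Xc2 c1m c2m.
have dF := local_rep_differentiable Xc2 Yc' c2m c'm.
rewrite -(transition_coord c2 c1m) in dF.
rewrite /dmap -(transition_coord c2 c1m) -(jacobian_comp dT dF).
apply/esym/near_eq_jacobian; first exact: (differentiable_comp dT dF).
near=> x; have [m' [c1m' c2m'] <-] : (coord c1 @` (dom c1 `&` dom c2)) x.
  by near: x; apply: near_coordV => //; exact: dom_open.
by rewrite /= /local_rep /= transition_coord // !coordK.
Unshelve. all: by end_near. Qed.

(** [shape_operator] imposes no transformation law. Both sides agree after composition with the
    differential of [phi], which is injective and can be cancelled. *)
Lemma shape_change c1 c2 m : atlas X c1 -> atlas X c2 -> dom c1 m -> dom c2 m ->
  A c1 m *m jacobian (transition c1 c2) (coord c1 m) =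
  jacobian (transition c1 c2) (coord c1 m) *m A c2 m.
Proof.
move=> Xc1 Xc2 c1m c2m; have [c' Yc' c'm] := atlas_cover Y (phi m).
have fr := immersion_injective hphi Xc2 Yc' c2m c'm.
have E := dmap_change Xc1 Xc2 Yc' c1m c2m c'm.
suff key : A c1 m *m dmap phi c1 c' m =
    jacobian (transition c1 c2) (coord c1 m) *m A c2 m *m dmap phi c2 c' m.
  by rewrite E mulmxA in key; exact: (row_free_inj fr key).
have L i := hA (bvec R i) Xc1 Yc' c1m c'm.
have L' i := hA (bvec R i *m jacobian (transition c1 c2) (coord c1 m)) Xc2 Yc' c2m c'm.
apply/row_matrixP => i; apply: (etrans (row_mul2 _ _ i) (etrans _ (esym (row_mul3 _ _ _ i)))).
apply: oppr_inj; apply: etrans (esym (L i)) (etrans _ (L' i)).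
apply: (congr2 (@GRing.add _)); last first.
  by apply: (congr1 (christoffel_term h c' (phi m) ^~ (xi c' m))); rewrite E mulmxA.
apply/rowP => k; apply: etrans (mxE _ _ _ _) (etrans _ (esym (mxE _ _ _ _))).
apply: (dchart_change _ Xc1 Xc2 c1m c2m _).2.
by apply: (smooth_on_differentiable (normal_smooth hxi k Yc' Xc2)); exists m.
Qed.

Lemma shape_invariants c1 c2 m : atlas X c1 -> atlas X c2 -> dom c1 m -> dom c2 m ->
  mean_curvature A c1 m = mean_curvature A c2 m /\
  shape_sqnorm A c1 m = shape_sqnorm A c2 m.
Proof.
move=> Xc1 Xc2 c1m c2m; rewrite /mean_curvature /shape_sqnorm.
by have [-> ->] := mxtrace_square_conj (jacobian_unit Xc1 Xc2 c1m c2m) (shape_change Xc1 Xc2 c1m c2m).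
Qed.

Hypothesis hflat : flat h.

Lemma shape_smooth c : atlas X c -> smooth_mx (coord c @` dom c) (fun x => A c (coordV c x)).
Proof.
move=> Xc i j s _ [m cm <-]; have [c' [Yc' c'm fl]] := hflat (phi m).
by apply: (shape_smooth_flat Xc Yc' fl); exists m.
Qed.

Lemma shape_gmx_sym c m : atlas X c -> dom c m ->
  (A c m *m gmx g c m)^T = A c m *m gmx g c m.
Proof.
move=> Xc cm; have [c' [Yc' c'm fl]] := hflat (phi m).
exact: (shape_gmx_sym_flat Xc Yc' fl).
Qed.

(* |A|^2 - H^2, read in a chart chosen at each point. *)
Definition shape_defect (m : M) : R :=
  let c := projT1 (cid2 (atlas_cover X m)) in
  shape_sqnorm A c m - mean_curvature A c m ^+ 2.

Lemma shape_defectE c m : atlas X c -> dom c m ->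
  shape_sqnorm A c m - mean_curvature A c m ^+ 2 = shape_defect m.
Proof.
move=> Xc cm; rewrite /shape_defect; case: cid2 => c0 Xc0 c0m /=.
by have [-> ->] := shape_invariants Xc Xc0 cm c0m.
Qed.

Lemma shape_defect_smooth U : smooth_fun X U shape_defect.
Proof.
move=> c Xc; have oO : open (coord c @` dom c) by exact: Defs.image_open.
apply: (smooth_on_sub (O := coord c @` dom c)); first by move=> _ [m [cm _] <-]; exists m.
have sA := shape_smooth Xc; have sAA := smooth_mxM oO sA sA.
have str (B : 'rV[R]_2 -> 'M[R]_2) : smooth_mx (coord c @` dom c) B ->
  smooth_on (coord c @` dom c) (fun x => \tr (B x)) by move=> sB; exact: smooth_on_sum.
have sH := smooth_onM oO (str _ sA) (smooth_on_cst (O := coord c @` dom c) 2^-1).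
apply: (eq_smooth_on oO _ (smooth_onB oO (str _ sAA) (smooth_onM oO sH sH))).
by move=> _ [m cm <-]; rewrite /= !coordK // -(shape_defectE Xc cm) expr2.
Qed.

(* In an orthonormal frame the shape operator is symmetric. *)
Lemma shape_defect_gt0 c m (E : 'M[R]_2) : atlas X c -> dom c m ->
  E *m gmx g c m *m E^T = 1%:M -> A c m != 0 -> 0 < shape_defect m.
Proof.
move=> Xc cm oE; rewrite -(shape_defectE Xc cm).
have [uE _] := mulmx1_unit (etrans (mulmxA _ _ _) oE).
(* The matrix of the shape operator in the frame [E]: traces are unchanged, and self-adjointness
   becomes equality with the transpose. *)
set B := E *m A c m *m invmx E.
have AB : B *m E = E *m A c m by rewrite mulmxKV.
have sB : B^T = B.
  have -> : B = E *m (A c m *m gmx g c m) *m E^T.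
    by rewrite -[LHS]mulmx1 -oE !mulmxA AB.
  by rewrite trmx_mul trmxK trmx_mul (shape_gmx_sym Xc cm) mulmxA.
have [t1 t2] := mxtrace_square_conj uE AB.
clearbody B; move=> A0; rewrite /shape_sqnorm /mean_curvature -t1 -t2.
have B0 : B != 0.
  by apply: contra_neq A0 => B0; rewrite -[A c m](mulKmx uE) -AB B0 mul0mx mulmx0.
have b10 : B 1 0 = B 0 1 by have := congr1 (fun C : 'M[R]_2 => C 0 1) sB; rewrite mxE.
rewrite /mxtrace !sum2 !mulmx2 b10.
(* A sum of squares that contains every entry of B with a positive coefficient, so it vanishes only
   for B = 0. *)
have -> : B 0 0 * B 0 0 + B 0 1 * B 0 1 + (B 0 1 * B 0 1 + B 1 1 * B 1 1) -
   ((B 0 0 + B 1 1) / 2) ^+ 2 = 2 * B 0 1 ^+ 2 + (B 0 0 - B 1 1) ^+ 2 / 4 + (B 0 0 ^+ 2 + B 1 1 ^+ 2) / 2.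
  by field.
have p0 := sqr_ge0 (B 0 0); have p1 := sqr_ge0 (B 1 1); have p2 := sqr_ge0 (B 0 1).
have p3 := sqr_ge0 (B 0 0 - B 1 1).
rewrite lt_neqAle; apply/andP; split; last by lra.
apply: contra_neq B0 => H.
have [z0 z1 z2] : [/\ B 0 0 ^+ 2 = 0, B 1 1 ^+ 2 = 0 & B 0 1 ^+ 2 = 0] by split; lra.
have sq (x : R) : x ^+ 2 = 0 -> x = 0 by move/eqP; rewrite sqrf_eq0 => /eqP.
by apply: matrix2P; rewrite [RHS]mxE ?b10; exact: sq.
Qed.

Lemma shape_defect0 c m : atlas X c -> dom c m -> A c m = 0 -> shape_defect m = 0.
Proof.
move=> Xc cm A0; rewrite -(shape_defectE Xc cm) /shape_sqnorm /mean_curvature A0.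
by rewrite mul0mx mxtrace0 mul0r expr0n subr0.
Qed.

End Immersion.

Local Notation lift := Defs.lift.

(** * The Dirac operator *)

Section CliffordAlgebra.
Variable R : realType.
Local Notation g1 := (gam1 R).
Local Notation g2 := (gam2 R).
Local Notation om := (omega R).

Let i2 : 'i%C * 'i%C = - 1 :> R[i].
Proof. by rewrite -expr2 sqr_i. Qed.

Lemma omegaE : [/\ om 0 0 = - 'i%C, om 0 1 = 0, om 1 0 = 0 & om 1 1 = 'i%C].
Proof.
by rewrite !mulmx2 !mxE /=; split; rewrite !(mulr0, mulr1, add0r, addr0, subr0, sub0r, oppr0, mul0r, mulN1r, mul1r, oppr0).
Qed.

Lemma gamE : [/\ g1 0 0 = 0, g1 0 1 = - 1, g1 1 0 = 1 & g1 1 1 = 0] /\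
  [/\ g2 0 0 = 0, g2 0 1 = 'i%C, g2 1 0 = 'i%C & g2 1 1 = 0].
Proof.
by rewrite !mxE /=; split; split; rewrite !(mulr0, mulr1, add0r, addr0, subr0, sub0r, oppr0, mul0r, mulN1r, mul1r, oppr0).
Qed.

Lemma gam1_omega : g1 *m om = - g2.
Proof.
have [w00 w01 w10 w11] := omegaE; have [[a00 a01 a10 a11] [b00 b01 b10 b11]] := gamE.
by apply: matrix2P; rewrite [RHS]mxE mulmx2 ?(w00, w01, w10, w11, a00, a01, a10, a11, b00, b01, b10, b11); ring.
Qed.

Lemma gam2_omega : g2 *m om = g1.
Proof.
have [w00 w01 w10 w11] := omegaE; have [[a00 a01 a10 a11] [b00 b01 b10 b11]] := gamE.
by apply: matrix2P; rewrite mulmx2 ?(w00, w01, w10, w11, a00, a01, a10, a11, b00, b01, b10, b11) ?mulrN ?i2; ring.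
Qed.

Lemma omega_gam1 : om *m g1 = g2.
Proof.
have [w00 w01 w10 w11] := omegaE; have [[a00 a01 a10 a11] [b00 b01 b10 b11]] := gamE.
by apply: matrix2P; rewrite mulmx2 ?(w00, w01, w10, w11, a00, a01, a10, a11, b00, b01, b10, b11); ring.
Qed.

Lemma omega_gam2 : om *m g2 = - g1.
Proof.
have [w00 w01 w10 w11] := omegaE; have [[a00 a01 a10 a11] [b00 b01 b10 b11]] := gamE.
by apply: matrix2P; rewrite [RHS]mxE mulmx2 ?(w00, w01, w10, w11, a00, a01, a10, a11, b00, b01, b10, b11) ?mulNr ?i2; ring.
Qed.

Lemma omega_sqr : om *m om = - 1%:M.
Proof. by rewrite {1}/omega -mulmxA gam2_omega; apply: matrix2P; have [[a00 a01 a10 a11] _] := gamE; rewrite mulmx2 !mxE !eqxx /= ?(a00, a01, a10, a11); ring. Qed.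

Lemma spin_repM (s t : R[i]) : spin_rep (s * t) = spin_rep s *m spin_rep t.
Proof.
rewrite /spin_rep ReM ImM mulmxDl !mulmxDr -!scalar_mxM -!scalemxAl -!scalemxAr omega_sqr.
rewrite mul_scalar_mx mul_mx_scalar !scalerA scalerN !rmorphB !rmorphD !rmorphM /=.
move: (cRe s)%:C (cIm s)%:C (cRe t)%:C (cIm t)%:C => a b c d.
move: (omega R) => o.
rewrite -!mulmxE -!scalar_mxM.
by apply: matrix2P; rewrite !mxE /= ?mulr1n ?mulr0n; ring.
Qed.

Lemma spin_rep1 : spin_rep 1 = 1%:M :> 'M[R[i]]_2.
Proof. by rewrite /spin_rep /= scale0r addr0. Qed.

(** The generators occupy the off-diagonal entries, the identity and omega the diagonal ones; each
    pair is independent. This is how coefficients of Clifford-valued identities get compared. *)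
Lemma clifford_free (x y z w : R[i]) :
  x *: g1 + y *: g2 + z%:M + w *: om = 0 -> [/\ x = 0, y = 0, z = 0 & w = 0].
Proof.
move=> H; have [w00 w01 w10 w11] := omegaE; have [[a00 a01 a10 a11] [b00 b01 b10 b11]] := gamE.
have E i j : (x *: g1 + y *: g2 + z%:M + w *: om) i j = 0 by rewrite H mxE.
have := E 0 0; have := E 0 1; have := E 1 0; have := E 1 1.
have mE i j : (x *: g1 + y *: g2 + z%:M + w *: om) i j = x * g1 i j + y * g2 i j + z *+ (i == j) + w * om i j.
  by move: (gam1 R) (gam2 R) (omega R) => a b o; rewrite !mxE.
rewrite !mE.
rewrite !(w00, w01, w10, w11, a00, a01, a10, a11, b00, b01, b10, b11) /= !(mulrN, mulr0, mulr1, mulr0n, mulr1n, addr0, add0r).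
move=> e11 e10 e01 e00.
have i0 : 'i%C != 0 :> R[i].
  by apply/eqP => i0; have := i2; rewrite i0 mul0r => /eqP; rewrite eq_sym oppr_eq0 oner_eq0.
have two : (2 : R[i]) != 0 by rewrite pnatr_eq0.
have z0 : z = 0.
  by apply: (mulfI two); rewrite mulr0 -[RHS](addr0 0) -{1}e00 -e11; ring.
have w0 : w = 0 by apply: (mulIf i0); rewrite mul0r -e11 z0 add0r.
have x0 : x = 0.
  by apply: (mulfI two); rewrite mulr0 -[RHS](subr0 0) -{1}e10 -e01; ring.
by split=> //; apply: (mulIf i0); rewrite mul0r -e10 x0 add0r.
Qed.

End CliffordAlgebra.

Local Notation dirac := Defs.dirac.

(** This and the next lemmas isolate the linear algebra of a first-order operator: u and v stand for
    derivatives along the frame, w for the spinor. Clifford relations enter only as anticommutation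
    hypotheses. *)
Lemma first_order_split (F : comNzRingType) n (A B C : 'M[F]_n) (u v w : 'cV[F]_n) x y :
  A *m (u + x *: (C *m w)) + B *m (v + y *: (C *m w)) =
  A *m u + B *m v + (x *: (A *m C) + y *: (B *m C)) *m w.
Proof. by rewrite !mulmxDr mulmxDl -!scalemxAr -!scalemxAl !mulmxA addrACA. Qed.

Lemma first_order_add (F : comNzRingType) n (A B C : 'M[F]_n) (u v w u' v' w' : 'cV[F]_n) :
  A *m (u + u') + B *m (v + v') + C *m (w + w') =
  A *m u + B *m v + C *m w + (A *m u' + B *m v' + C *m w').
Proof. by rewrite !mulmxDr (addrACA (A *m u)) (addrACA _ _ (C *m w)). Qed.

Lemma first_order_scale (F : comNzRingType) n (A B C : 'M[F]_n) (u v w : 'cV[F]_n) p x y :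
  A *m (x *: w + p *: u) + B *m (y *: w + p *: v) + C *m (p *: w) =
  p *: (A *m u + B *m v + C *m w) + (x *: A + y *: B) *m w.
Proof.
rewrite !mulmxDr mulmxDl !scalerDr -!scalemxAr -!scalemxAl addrACA.
by rewrite -[LHS]addrA [LHS]addrC.
Qed.

Lemma anticommute_mul (F : comNzRingType) n (A B C : 'M[F]_n) x y :
  A *m C = - (C *m A) -> B *m C = - (C *m B) ->
  (x *: (A *m C) + y *: (B *m C)) *m C = - (C *m (x *: (A *m C) + y *: (B *m C))).
Proof.
move=> AC BC; rewrite mulmxDl mulmxDr opprD -!scalemxAl -!scalemxAr !mulmxA.
by rewrite {1}AC {1}BC !mulNmx !scalerN.
Qed.

Lemma first_order_anticommute (F : comNzRingType) n (A B C D : 'M[F]_n) (u v w : 'cV[F]_n) :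
  A *m D = - (D *m A) -> B *m D = - (D *m B) -> C *m D = - (D *m C) ->
  A *m (D *m u) + B *m (D *m v) + C *m (D *m w) = - (D *m (A *m u + B *m v + C *m w)).
Proof.
by move=> AD BD CD; rewrite !mulmxA AD BD CD !mulNmx !mulmxDr !mulmxA !opprD.
Qed.

Lemma gam_omega_anticommute (R : realType) :
  gam1 R *m omega R = - (omega R *m gam1 R) /\ gam2 R *m omega R = - (omega R *m gam2 R).
Proof. by rewrite gam1_omega gam2_omega omega_gam1 omega_gam2 opprK. Qed.

Section Dirac.
Variables (R : realType) (M : topologicalType) (X : oriented_manifold R 2 M).
Variables (g : riemannian_metric X) (S : spin_structure g).
Implicit Types (c : chart R 2 M) (m : M) (U : set M) (psi : M -> 'cV[R[i]]_2).

Definition dcol c v psi m : 'cV[R[i]]_2 := \col_a cdchart c v (fun m' => psi m' a 0) m.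

Definition cdiff_col c psi m :=
  forall a, cdifferentiable ((fun m' => psi m' a 0) \o coordV c) (coord c m).

Lemma dcolD c v psi psi' m : cdiff_col c psi m -> cdiff_col c psi' m ->
  dcol c v (fun m => psi m + psi' m) m = dcol c v psi m + dcol c v psi' m /\
  cdiff_col c (fun m => psi m + psi' m) m.
Proof.
move=> d d'; have E a : (fun m' => (psi m' + psi' m') a 0) \o coordV c =
    fun x => psi (coordV c x) a 0 + psi' (coordV c x) a 0.
  by apply/funext => x /=; rewrite mxE.
split; last by move=> a; rewrite E; exact: cdifferentiableD (d a) (d' a).
apply/colP => a; rewrite mxE cdchartE E (cderiveD v (d a) (d' a)).
by rewrite !mxE.
Qed.

Lemma dcolZ c v (p : M -> R[i]) psi m : cdifferentiable (p \o coordV c) (coord c m) ->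
  cdiff_col c psi m -> dom c m ->
  dcol c v (fun m => p m *: psi m) m = cdchart c v p m *: psi m + p m *: dcol c v psi m /\
  cdiff_col c (fun m => p m *: psi m) m.
Proof.
move=> dp d cm; have E a : (fun m' => (p m' *: psi m') a 0) \o coordV c =
    fun x => p (coordV c x) * psi (coordV c x) a 0.
  by apply/funext => x /=; rewrite mxE.
split; last by move=> a; rewrite E; exact: cdifferentiableM dp (d a).
apply/colP => a; rewrite mxE cdchartE E (cderiveM v dp (d a)).
by rewrite !mxE /= coordK.
Qed.

Lemma dcolM c v (B : 'M[R[i]]_2) psi m : cdiff_col c psi m ->
  dcol c v (fun m => B *m psi m) m = B *m dcol c v psi m /\
  cdiff_col c (fun m => B *m psi m) m.
Proof.
move=> d; have E a : (fun m' => (B *m psi m') a 0) \o coordV c =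
    fun x => B a 0 * psi (coordV c x) 0 0 + B a 1 * psi (coordV c x) 1 0.
  by apply/funext => x /=; rewrite mulmx2.
have dB a b : cdifferentiable (fun=> B a b) (coord c m).
  by apply: (csmooth_on_differentiable (O := setT)) => //; exact: csmooth_on_cst.
have dM a b := cdifferentiableM (dB a b) (d b).
split; last by move=> a; rewrite E; exact: cdifferentiableD (dM a 0) (dM a 1).
apply/colP => a; rewrite mxE cdchartE E (cderiveD v (dM a 0) (dM a 1)).
rewrite (cderiveM v (dB a 0) (d 0)) (cderiveM v (dB a 1) (d 1)) !cderive_cst !mul0r !add0r.
by rewrite mulmx2 !mxE.
Qed.

Section Frame.
Variables (k : sidx S) (c : chart R 2 M).
Hypothesis Xc : atlas X c.
Local Notation E m := (frame k c m).

Definition spin_coef (i : 'I_2) m : R :=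
  (nabla g c (row i (E m)) (fun m' => row 0 (E m')) m *m gmx g c m
     *m (row 1 (E m))^T) 0 0.

(** The zero-order term of the Dirac operator in a spin frame; like the generators, it anticommutes
    with omega. *)
Definition spin_conn m : 'M[R[i]]_2 :=
  (spin_coef 0 m / 2)%:C *: (gam1 R *m omega R) + (spin_coef 1 m / 2)%:C *: (gam2 R *m omega R).

Lemma diracE psi m : dirac k c psi m =
  gam1 R *m dcol c (row 0 (E m)) psi m + gam2 R *m dcol c (row 1 (E m)) psi m
  + spin_conn m *m psi m.
Proof.
exact: first_order_split.
Qed.

Definition clifford_grad (p : M -> R[i]) m : 'M[R[i]]_2 :=
  cdchart c (row 0 (E m)) p m *: gam1 R + cdchart c (row 1 (E m)) p m *: gam2 R.

Lemma diracD psi psi' m : cdiff_col c psi m -> cdiff_col c psi' m ->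
  dirac k c (fun m => psi m + psi' m) m = dirac k c psi m + dirac k c psi' m.
Proof.
move=> d d'; rewrite !diracE (dcolD (row 0 (E m)) d d').1 (dcolD (row 1 (E m)) d d').1.
exact: first_order_add.
Qed.

Lemma diracZ (p : M -> R[i]) psi m : cdifferentiable (p \o coordV c) (coord c m) ->
  cdiff_col c psi m -> dom c m ->
  dirac k c (fun m => p m *: psi m) m =
  p m *: dirac k c psi m + clifford_grad p m *m psi m.
Proof.
move=> dp d cm; rewrite !diracE (dcolZ (row 0 (E m)) dp d cm).1 (dcolZ (row 1 (E m)) dp d cm).1.
exact: first_order_scale.
Qed.

Lemma spin_conn_omega m : spin_conn m *m omega R = - (omega R *m spin_conn m).
Proof.
by have [h1 h2] := gam_omega_anticommute R; exact: anticommute_mul.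
Qed.

Lemma dirac_omega psi m : cdiff_col c psi m ->
  dirac k c (fun m => omega R *m psi m) m = - (omega R *m dirac k c psi m).
Proof.
move=> d; rewrite !diracE (dcolM (row 0 (E m)) _ d).1 (dcolM (row 1 (E m)) _ d).1.
have [h1 h2] := gam_omega_anticommute R.
exact: first_order_anticommute h1 h2 (spin_conn_omega m).
Qed.

Let oS : open (scov k). Proof. exact: scov_open. Qed.

Lemma frame_smooth_mx : smooth_mx (coord c @` (dom c `&` scov k)) (fun x => E (coordV c x)).
Proof. by move=> i j; exact: frame_smooth. Qed.

Lemma spin_coef_smooth i :
  smooth_on (coord c @` (dom c `&` scov k)) (fun x => spin_coef i (coordV c x)).
Proof.
set O := coord c @` _; have oO : open O by exact: open_coord_image.
have sub : O `<=` coord c @` dom c by move=> _ [m [cm _] <-]; exists m.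
have sg : smooth_mx O (fun x => gmx g c (coordV c x)).
  by move=> a b; apply: smooth_on_sub (gmx_smooth_mx g Xc a b).
have sE : smooth_mx O (fun x => E (coordV c x)) := frame_smooth_mx.
have sdir (f : M -> R) (v : 'rV[R]_2 -> 'rV[R]_2) :
    smooth_on O (f \o coordV c) -> smooth_mx O v ->
    smooth_on O (fun x => dchart c (v x) f (coordV c x)).
  move=> sf sv; apply: (eq_smooth_on oO (f := fun x => \sum_j v x 0 j * partial j (f \o coordV c) x)).
    move=> x Ox; have [_ xx] := coord_image (sub _ Ox).
    by rewrite /dchart xx derive_partialE //; exact: (smooth_on_differentiable sf Ox).
  by apply: (smooth_on_sum oO) => j; apply: (smooth_onM oO) => //; exact: smooth_on_partial.
have sbv j : smooth_mx O (fun=> bvec R j : 'rV[R]_2) by exact: smooth_mx_cst.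
have sinv : smooth_mx O (fun x => invmx (gmx g c (coordV c x))).
  by apply: (smooth_mx_inv oO sg) => x /sub /coord_image [cx _]; exact: gmx_unit.
have sgf a b : smooth_on O ((fun m => gmx g c m a b) \o coordV c) := sg a b.
have sch a b e : smooth_on O (fun x => christoffel g c (coordV c x) a b e).
  apply: (smooth_onM oO); first exact: smooth_on_cst.
  apply: (smooth_on_sum oO) => l; apply: (smooth_onM oO); first exact: sinv.
  by apply: (smooth_onB oO); [apply: (smooth_onD oO)|]; exact: sdir.
have srow a : smooth_mx O (fun x => row a (E (coordV c x))).
  by move=> b e; apply: (eq_smooth_on oO _ (sE a e)) => x _; rewrite mxE.
have sfr a b : smooth_on O ((fun m => row a (E m) 0 b) \o coordV c) := srow a 0 b.
have snab : smooth_mx O (fun x => nabla g c (row i (E (coordV c x))) (fun m' => row 0 (E m')) (coordV c x)).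
  move=> a b; rewrite (ord1 a).
  have s1 := sdir _ _ (sfr 0 b) (srow i).
  have s2 : smooth_on O (fun x => \sum_(u < 2) \sum_(v < 2)
      row i (E (coordV c x)) 0 u * row 0 (E (coordV c x)) 0 v * christoffel g c (coordV c x) u v b).
    apply: (smooth_on_sum oO) => u; apply: (smooth_on_sum oO) => v.
    by apply: (smooth_onM oO); [apply: (smooth_onM oO); exact: srow|exact: sch].
  by apply: (eq_smooth_on oO _ (smooth_onD oO s1 s2)) => x _; rewrite !mxE.
exact: (smooth_mxM oO (smooth_mxM oO snab sg) (smooth_mx_tr oO (srow 1)) 0 0).
Qed.

(** The product rules are applied to D psi when the second factor acts, so D psi must be
    differentiable; this rests on the smoothness of the frame and of the connection coefficients. *)
Lemma dirac_smooth U psi : open U ->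
  (forall a, csmooth_fun X (scov k `&` U) (fun m => psi m a 0)) ->
  forall m, dom c m -> scov k m -> U m -> cdiff_col c (dirac k c psi) m.
Proof.
move=> oU spsi m cm km Um; set O := coord c @` (dom c `&` (scov k `&` U)).
have oO : open O by apply: open_coord_image; exact: openI.
have Ox : O (coord c m) by exists m.
have sub : O `<=` coord c @` (dom c `&` scov k) by move=> _ [m' [cm' [km' _]] <-]; exists m'.
have sP a : csmooth_on O ((fun m => psi m a 0) \o coordV c) := csmooth_on_chart (spsi a) Xc.
have sE i j : smooth_on O (fun x => E (coordV c x) i j).
  by apply: smooth_on_sub (frame_smooth_mx i j).
have sd i a : csmooth_on O (fun x => dcol c (row i (E (coordV c x))) psi (coordV c x) a 0).
  have s (j : 'I_2) := csmooth_onM oO (csmooth_onC (sE i j)) (csmooth_on_cderive j (sP a)).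
  apply: (eq_csmooth_on oO _ (csmooth_onD oO (s 0) (s 1))) => x Hx.
  have [m' [cm' _] mx] := Hx; rewrite mxE -mx coordK // cdchartE.
  have rE (B : 'M[R]_2) j : row i B 0 j = B i j by rewrite mxE.
  have Oy : O (coord c m') by rewrite mx.
  rewrite (cderiveE (row i (E m')) (csmooth_on_differentiable (sP a) Oy)) sum2.
  by rewrite !rE.
have sc i : csmooth_on O (fun x => (spin_coef i (coordV c x) / 2)%:C).
  apply: (csmooth_onC); apply: (smooth_onM oO); last exact: smooth_on_cst.
  by apply: smooth_on_sub (spin_coef_smooth i).
have sZ a b : csmooth_on O (fun x => spin_conn (coordV c x) a b).
  have s0 := csmooth_onM oO (sc 0) (csmooth_on_cst O ((gam1 R *m omega R) a b)).
  have s1 := csmooth_onM oO (sc 1) (csmooth_on_cst O ((gam2 R *m omega R) a b)).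
  apply: (eq_csmooth_on oO _ (csmooth_onD oO s0 s1)) => x _.
  by rewrite /spin_conn; move: (gam1 R *m _) (gam2 R *m _) => B C; rewrite !mxE.
have sM (B : 'rV[R]_2 -> 'M[R[i]]_2) (v : 'rV[R]_2 -> 'cV[R[i]]_2) :
   (forall a b, csmooth_on O (fun x => B x a b)) -> (forall a, csmooth_on O (fun x => v x a 0)) ->
   forall a, csmooth_on O (fun x => (B x *m v x) a 0).
  move=> sB sv a.
  apply: (eq_csmooth_on oO _ (csmooth_onD oO (csmooth_onM oO (sB a 0) (sv 0)) (csmooth_onM oO (sB a 1) (sv 1)))).
  by move=> x _; rewrite mulmx2.
have scst (B : 'M[R[i]]_2) a b : csmooth_on O (fun=> B a b) := csmooth_on_cst O _.
move=> a; apply: (csmooth_on_differentiable (O := O)) Ox.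
have s0 := sM _ _ (scst (gam1 R)) (sd 0); have s1 := sM _ _ (scst (gam2 R)) (sd 1).
have s2 := sM _ _ sZ sP.
apply: (eq_csmooth_on oO _ (csmooth_onD oO (csmooth_onD oO (s0 a) (s1 a)) (s2 a))) => x _.
by rewrite /= diracE [RHS]mxE [X in _ = X + _]mxE.
Qed.

(* Clifford multiplication by e_1, e_2 anticommutes with omega, so the
   first-order part of the product is (a + p) D + (b - q) omega D. *)
Lemma dirac_plus_comp U (a b p q : M -> R[i]) psi m : open U ->
  csmooth_fun X U p -> csmooth_fun X U q ->
  (forall a, csmooth_fun X (scov k `&` U) (fun m => psi m a 0)) ->
  dom c m -> scov k m -> U m ->
  dirac_plus k c a b (dirac_plus k c p q psi) m =
  dirac k c (dirac k c psi) m
  + (((a m + p m)%:M + (b m - q m) *: omega R) *m dirac k c psi m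
  + ((cdchart c (row 0 (E m)) p m + cdchart c (row 1 (E m)) q m) *: gam1 R
     + (cdchart c (row 1 (E m)) p m - cdchart c (row 0 (E m)) q m) *: gam2 R
     + (a m * p m - b m * q m)%:M + (a m * q m + b m * p m) *: omega R) *m psi m).
Proof.
move=> oU sp sq spsi cm km Um.
have Ox : (coord c @` (dom c `&` U)) (coord c m) by exists m.
have Ox' : (coord c @` (dom c `&` (scov k `&` U))) (coord c m) by exists m.
have dp := csmooth_on_differentiable (csmooth_on_chart sp Xc) Ox.
have dq := csmooth_on_differentiable (csmooth_on_chart sq Xc) Ox.
have dpsi : cdiff_col c psi m.
  by move=> i; exact: (csmooth_on_differentiable (csmooth_on_chart (spsi i) Xc) Ox').
have dD := dirac_smooth oU spsi cm km Um.
have [_ dom'] := dcolM 0 (omega R) dpsi.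
have [_ dpp] := dcolZ 0 dp dpsi cm; have [_ dqq] := dcolZ 0 dq dom' cm.
have [_ d1] := dcolD 0 dD dpp.
rewrite {1}/dirac_plus (diracD d1 dqq) (diracD dD dpp) (diracZ dp dpsi cm) (diracZ dq dom' cm).
rewrite (dirac_omega dpsi) /dirac_plus /clifford_grad.
move: (dirac k c (dirac k c psi) m) (dirac k c psi m) (psi m) => DD D P.
move: (cdchart _ _ p m) (cdchart _ _ p m) (cdchart _ _ q m) (cdchart _ _ q m) => p0 p1 q0 q1.
move: (a m) (b m) (p m) (q m) => a' b' p' q'.
move: (gam1 R) (gam2 R) (omega R) (gam1_omega R) (gam2_omega R) (omega_sqr R) => A B O AO BO OO.
rewrite !mulmxDr -!scalemxAr !mulmxA (mulmxDl _ _ O) -!scalemxAl AO BO OO.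
rewrite !mulmxDl !mul_scalar_mx -!scalemxAl !mulNmx mul1mx.
move: (O *m D) (O *m P) (A *m P) (B *m P) => OD OP AP BP.
by apply/colP => i; rewrite !mxE; ring.
Qed.

End Frame.
End Dirac.

(** * Test spinors and the coefficients of a factorization *)

Section Sections.
Variables (R : realType) (M : topologicalType) (X : oriented_manifold R 2 M).
Variables (g : riemannian_metric X) (S : spin_structure g).
Implicit Types (c : chart R 2 M) (m : M) (U V W K : set M).

Lemma lift_refl (k : sidx S) m : scov k m -> lift k k m = 1.
Proof.
move=> km; have := lift_cocycle km km km; have := lift_unit km km.
move: (lift k k m) => l l1 ll; have l0 : l != 0 by rewrite -normr_eq0 l1 oner_eq0.
by apply: (mulfI l0); rewrite ll mulr1.
Qed.

(** On [V] this is a product of smooth functions, off [K] it is 0, and these two open sets cover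
    everything because [K] lies in [V]. *)
Lemma csmooth_supported V K W (s : M -> R) (F : M -> R[i]) :
  open V -> closed K -> open W -> smooth_fun X V s ->
  (forall m, ~ K m -> s m = 0) -> K `<=` V -> csmooth_fun X (W `&` V) F ->
  csmooth_fun X W (fun m => (s m)%:C * F m).
Proof.
move=> oV cK oW ss s0 KV sF.
have H m : W m -> exists c V', [/\ atlas X c, open V', V' m, V' `<=` dom c &
    csmooth_on (coord c @` V') ((fun m => (s m)%:C * F m) \o coordV c)].
  move=> Wm; have [c Xc cm] := atlas_cover X m.
  have [Vm|nVm] := pselect (V m).
    exists c, (dom c `&` (W `&` V)).
    have oWV : open (W `&` V) by exact: openI.
    have oD : open (dom c `&` (W `&` V)) by apply: openI => //; exact: dom_open.
    suff H : csmooth_on (coord c @` (dom c `&` (W `&` V))) ((fun m => (s m)%:C * F m) \o coordV c).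
      by split=> //; move=> ? [].
    have oO : open (coord c @` (dom c `&` (W `&` V))) by exact: open_coord_image.
    apply: (csmooth_onM oO (F := fun x => (s (coordV c x))%:C)).
      apply: csmooth_onC; apply: smooth_on_sub (ss c Xc) => _ [m' [cm' [_ Vm']] <-].
      by exists m'.
    exact: (csmooth_on_chart sF Xc).
  have nKm : ~ K m by move=> /KV.
  exists c, (dom c `&` (W `&` ~` K)).
  have oWK : open (W `&` ~` K) by apply: openI => //; exact: closed_openC.
  have oD : open (dom c `&` (W `&` ~` K)) by apply: openI => //; exact: dom_open.
  suff H : csmooth_on (coord c @` (dom c `&` (W `&` ~` K))) ((fun m => (s m)%:C * F m) \o coordV c).
    by split=> //; move=> ? [].
  have oO : open (coord c @` (dom c `&` (W `&` ~` K))) by exact: open_coord_image.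
  apply: (eq_csmooth_on oO _ (csmooth_on_cst _ (0 : R[i]))) => _ [m' [cm' [_ nK]] <-].
  by rewrite /= coordK // s0 // mul0r.
split; apply: smooth_fun_local => m Wm; have [c [V' [Xc oV' Vm Vc [s1 s2]]]] := H m Wm;
  by exists c, V'.
Qed.

(** Prescribed in one spin frame, the spinor is carried to the others by the lifted transition
    functions and extended by zero; the cocycle condition yields compatibility. *)
Lemma test_section U (k0 : sidx S) c x0 r (sigma : 'rV[R]_2 -> R) (u : 'cV[R[i]]_2) :
  open U -> atlas X c -> 0 <= r -> smooth_on setT sigma ->
  (forall x, `|x - x0| <= r -> (coord c @` (dom c `&` (scov k0 `&` U))) x) ->
  (forall x, ~ `|x - x0| <= r -> sigma x = 0) ->
  exists2 psi : sidx S -> M -> 'cV[R[i]]_2, spinor_section U psi &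
    forall x, (coord c @` (dom c `&` (scov k0 `&` U))) x ->
      psi k0 (coordV c x) = (sigma x)%:C *: u.
Proof.
move=> oU Xc r0 ssig rV sig0; set V := dom c `&` (scov k0 `&` U) in rV *.
have oV : open V.
  by apply: openI; [exact: dom_open|apply: openI => //; exact: scov_open].
have oO : open (coord c @` V) by apply: open_coord_image; apply: openI => //; exact: scov_open.
pose s m := if pselect (V m) then sigma (coord c m) else 0.
pose K := coordV c @` [set x | `|x - x0| <= r].
have KV : K `<=` V.
  by move=> _ [x xr <-]; have [m Vm <-] := rV x xr; rewrite coordK //; case: Vm.
(* A continuous image of a closed cube is compact, hence closed in the Hausdorff space [M]. *)
have cK : closed K.
  apply: compact_closed; first exact: manifold_hausdorff X.
  apply: continuous_compact; last exact: closed_cube_compact.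
  apply: continuous_in_subspaceT => x; rewrite inE => /rV [m [cm _] mx].
  by apply: coordV_continuous; exists m.
have sK m : ~ K m -> s m = 0.
  move=> nK; rewrite /s; case: pselect => // Vm; apply: sig0 => xr; apply: nK.
  by exists (coord c m) => //; rewrite coordK //; case: Vm.
have ss : smooth_fun X V s.
  apply: smooth_fun_local => m Vm; exists c, V; split=> //; first by move=> ? [].
  apply: (eq_smooth_on oO _ (smooth_on_sub _ ssig)) => // _ [m' Vm' <-].
  by rewrite /= /s coordK; [case: pselect|case: Vm'].
exists (fun k m => (s m)%:C *: (spin_rep (lift k k0 m) *m u)); last first.
  move=> _ [m Vm <-]; have [cm [km _]] := Vm; rewrite coordK // lift_refl // spin_rep1 mul1mx.
  by rewrite /s; case: pselect.
split=> [k a|k l m km lm Um]; last first.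
  have [Vm|nVm] := pselect (V m); last first.
    by rewrite sK ?scale0r ?mulmx0 // => /KV.
  have [_ [k0m _]] := Vm; rewrite -scalemxAr; congr (_ *: _); apply: etrans (esym (mulmxA _ _ _)).
  by rewrite -(spin_repM (lift k l m) (lift l k0 m)) (lift_cocycle km lm k0m).
have oW : open (scov k `&` U) by apply: openI => //; exact: scov_open.
suff sF : csmooth_fun X ((scov k `&` U) `&` V) (fun m => (spin_rep (lift k k0 m) *m u) a 0).
  have [s1 s2] := csmooth_supported oV cK oW ss sK KV sF.
  split=> c' Xc'; [have := s1 c' Xc'|have := s2 c' Xc'];
    by congr (smooth_on _ _); apply/funext => x /=; rewrite [in RHS]mxE.
apply: csmooth_funP => c' Xc'.
have oO' : open (coord c' @` (dom c' `&` ((scov k `&` U) `&` V))).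
  by apply: open_coord_image; exact: openI.
have [l1 l2] := lift_smooth (s := S) k k0.
have sub : coord c' @` (dom c' `&` ((scov k `&` U) `&` V)) `<=` coord c' @` (dom c' `&` (scov k `&` scov k0)).
  by move=> _ [m [cm [[km _] [_ [k0m _]]]] <-]; exists m.
have sre := csmooth_onC (smooth_on_sub sub (l1 c' Xc')).
have sim := csmooth_onC (smooth_on_sub sub (l2 c' Xc')).
have cst b := csmooth_on_cst (coord c' @` (dom c' `&` ((scov k `&` U) `&` V))) b.
apply: (eq_csmooth_on oO' _ (csmooth_onD oO' (csmooth_onM oO' sre (cst (u a 0)))
  (csmooth_onM oO' sim (cst ((omega R *m u) a 0))))) => x _.
rewrite /= /spin_rep mulmxDl mul_scalar_mx -scalemxAl.
by move: (omega R *m u) => v; rewrite !mxE.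
Qed.

Section Factorization.
Variables (A : chart R 2 M -> M -> 'M[R]_2) (U : set M).
Hypothesis oU : open U.
Local Notation sdef c m := (shape_sqnorm A c m - mean_curvature A c m ^+ 2).

Lemma factorization_suff (p q : M -> R[i]) :
  csmooth_fun X U p -> csmooth_fun X U q ->
  (forall c m, atlas X c -> dom c m -> U m -> conjugate g c p q m) ->
  (forall c m, atlas X c -> dom c m -> U m -> p m ^+ 2 + q m ^+ 2 = - (sdef c m)%:C) ->
  factorization S A U (fun m => - p m) q p q.
Proof.
move=> sp sq pq pq2.
have snp : csmooth_fun X U (fun m => - p m).
  apply: csmooth_funP => c Xc; have oO : open (coord c @` (dom c `&` U)) by exact: open_coord_image.
  have sx := csmooth_on_chart sp Xc.
  apply: (eq_csmooth_on oO _ (csmooth_onM oO (csmooth_on_cst _ (- 1 : R[i])) sx)) => x _.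
  by rewrite mulN1r.
split=> // psi [spsi _] k c m Xc km cm Um.
rewrite (dirac_plus_comp Xc _ _ oU sp sq (spsi k) cm km Um) /B0; congr (_ + _).
have Ox : (coord c @` (dom c `&` U)) (coord c m) by exists m.
have dp := csmooth_on_differentiable (csmooth_on_chart sp Xc) Ox.
have dq := csmooth_on_differentiable (csmooth_on_chart sq Xc) Ox.
have oE := frame_orthonormal Xc km cm; have dE := frame_oriented Xc km cm.
have [-> ->] := (conjugate_frame Xc cm oE dE dp dq).1 (pq c m Xc cm Um).
rewrite !addNr !subrr scale0r addr0 raddf0 mul0mx add0r !scale0r !add0r.
rewrite (_ : - p m * q m + q m * p m = 0); last by ring.
rewrite scale0r addr0 mul_scalar_mx; congr (_ *: _).
by rewrite -[LHS]opprK -(pq2 c m Xc cm Um); ring.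
Qed.

Lemma mulmx_col_eq0 (T : 'M[R[i]]_2) : (forall u : 'cV_2, T *m u = 0) -> T = 0.
Proof.
by move=> H; apply/matrixP => i j; have := H (delta_mx j 0); rewrite -colE => /colP /(_ i); rewrite !mxE.
Qed.

Lemma shift_scalar_mulmx (B C W : 'M[R[i]]_2) z s (u : 'cV_2) :
  (B + C + (z - s)%:M + W) *m u = (B + C + z%:M + W) *m u - s *: u.
Proof.
rewrite !mulmxDl !mul_scalar_mx; move: (B *m u) (C *m u) (W *m u) => b c w.
by apply/colP => i; rewrite !mxE; ring.
Qed.

(** A test function vanishing at the point isolates the first-order coefficients. Once these are
    zero, a bump function not vanishing there isolates the terms of order zero. *)
Lemma factorization_nec (a b p q : M -> R[i]) c m : factorization S A U a b p q ->
  atlas X c -> dom c m -> U m ->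
  [/\ a m = - p m, b m = q m, conjugate g c p q m & p m ^+ 2 + q m ^+ 2 = - (sdef c m)%:C].
Proof.
move=> [sa sb sp sq fac] Xc cm Um; have [k km] := scov_cover S m.
set x0 := coord c m; set V := scov k `&` U.
have oV : open V by apply: openI => //; exact: scov_open.
have [r r0 Br] := chart_ball oV cm (conj km Um).
have r20 : 0 < r / 2 by rewrite divr_gt0.
have rV x : `|x - x0| <= r / 2 -> (coord c @` (dom c `&` V)) x.
  move=> xr; apply: Br; rewrite -ball_normE /= distrC; apply: le_lt_trans xr _.
  by rewrite ltr_pdivrMr // ltr_pMr // ltr1n.
have Ox : (coord c @` (dom c `&` V)) x0 by exists m.
have oO : open (coord c @` (dom c `&` V)) by exact: open_coord_image.
have [f [sf f0] fr] := exists_bump x0 r20.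
have oE := frame_orthonormal Xc km cm; have dE := frame_oriented Xc km cm.
set E := frame k c m in oE dE.
have uE : E \in unitmx by rewrite unitmxE unitfE gt_eqF.
have fC : (f x0)%:C != 0 by apply/eqP => /(congr1 cRe) /= e; move: f0; rewrite e eqxx.
(* The common term D^2 psi is cancelled by [addrI]; the rest involves only the value and the first
   derivatives of sigma at the point. *)
have key (sigma : 'rV[R]_2 -> R) (u : 'cV[R[i]]_2) : smooth_on setT sigma ->
    (forall x, ~ `|x - x0| <= r / 2 -> sigma x = 0) ->
    exists D, [/\ D = gam1 R *m (('D_(row 0 E) sigma x0)%:C *: u)
        + gam2 R *m (('D_(row 1 E) sigma x0)%:C *: u) + spin_conn k c m *m ((sigma x0)%:C *: u) &
     (sdef c m)%:C *: ((sigma x0)%:C *: u) =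
     ((a m + p m)%:M + (b m - q m) *: omega R) *m D
     + ((cdchart c (row 0 E) p m + cdchart c (row 1 E) q m) *: gam1 R
     + (cdchart c (row 1 E) p m - cdchart c (row 0 E) q m) *: gam2 R
     + (a m * p m - b m * q m)%:M + (a m * q m + b m * p m) *: omega R) *m ((sigma x0)%:C *: u)].
  move=> ss sig0; have [psi [spsi tpsi] psiE] := test_section u oU Xc (ltW r20) ss rV sig0.
  have := fac psi (conj spsi tpsi) k c m Xc km cm Um.
  rewrite (dirac_plus_comp Xc _ _ oU sp sq (spsi k) cm km Um) /B0 => /addrI.
  have -> : psi k m = (sigma x0)%:C *: u by rewrite -psiE // coordK.
  have dE' v : dcol c v (psi k) m = ('D_v sigma x0)%:C *: u.
    apply/colP => i; rewrite !mxE cdchartE.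
    have E1 : \forall x \near x0, (u i 0) * (sigma x)%:C = ((fun m' => psi k m' i 0) \o coordV c) x.
      have nO : \forall x \near x0, (coord c @` (dom c `&` V)) x by exact: (open_nbhs_nbhs (conj oO Ox)).
      by apply: filterS nO => x Hx; rewrite /= psiE // mxE mulrC.
    rewrite -(near_eq_cderive v E1).
    have d1 : cdifferentiable (fun=> u i 0) x0.
      by apply: (csmooth_on_differentiable (O := setT)) => //; exact: csmooth_on_cst.
    have d2 : cdifferentiable (fun x => (sigma x)%:C) x0.
      by apply: (csmooth_on_differentiable (O := setT)) => //; exact: csmooth_onC.
    rewrite (cderiveM v d1 d2) cderive_cst mul0r add0r mulrC; congr (_ * _).
    by apply: complexP => //=; exact: derive_cst.
  have pm : psi k m = (sigma x0)%:C *: u by rewrite -psiE // coordK.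
  have DE := diracE k c (psi k) m; rewrite !dE' pm in DE.
  by move=> H; exists (dirac k c (psi k) m); split; [exact: DE|exact: H].
have [h1 h2] : a m + p m = 0 /\ b m - q m = 0.
  (* A covector of the dual frame: the affine function L has derivative 1 along e_1 and 0 along e_2,
     so for f L the spinor D psi equals f(x0) gamma_1 u at the point. *)
  pose l : 'cV[R]_2 := invmx E *m delta_mx 0 0.
  pose L (x : 'rV[R]_2) : R := (x 0 0 - x0 0 0) * l 0 0 + (x 0 1 - x0 0 1) * l 1 0.
  have oT : open (setT : set 'rV[R]_2) by exact: openT.
  have sL : smooth_on setT L.
    apply: (smooth_onD oT); apply: (smooth_onM oT); try exact: smooth_on_cst;
      by apply: (smooth_onB oT); [exact: smooth_on_coord|exact: smooth_on_cst].
  have sfL := smooth_onM oT sf sL.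
  have L0 : L x0 = 0 by rewrite /L !subrr !mul0r addr0.
  have Ll : L = fun x => ((x - x0) *m l) 0 0.
    by apply/funext => x; move: l @L sL sfL L0 => l' *; rewrite mulmx2 !mxE.
  have DL (v : 'rV[R]_2) : 'D_v (fun x => f x * L x) x0 = f x0 * (v *m l) 0 0.
    have dfx := smooth_on_differentiable sf (x := x0) I.
    have dLx := smooth_on_differentiable sL (x := x0) I.
    rewrite (deriveM (diff_derivable dfx) (diff_derivable dLx)) L0 /GRing.scale /= mul0r addr0.
    congr (_ * _); rewrite (derive_partialE v dLx) sum2 mulmx2.
    have pE j : partial j L x0 = l j 0.
      have dB (e : 'I_2) : derivable (fun x : 'rV[R]_2 => x 0 e - x0 0 e) x0 (bvec R j).
        have sB := smooth_onB oT (smooth_on_coord (O := setT) e) (smooth_on_cst (O := setT) (x0 0 e)).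
        exact: diff_derivable (smooth_on_differentiable sB (x := x0) I).
      have dC (b' : R) : derivable (fun=> b') x0 (bvec R j) by exact: derivable_cst.
      apply: etrans (derive_mulD (dB 0) (dB 1) (dC (l 0 0)) (dC (l 1 0))) _.
      rewrite !derive_coordB !derive_cst !mulr0 !addr0; move: (l) => l'.
      by move: j {dB dC}; apply: ord2P; rewrite !mxE /= ?mul1r ?mul0r ?addr0 ?add0r.
    by rewrite !pE.
  have rl i : (row i E *m l) 0 0 = (i == 0)%:R.
    rewrite /l mulmxA -row_mul mulmxV // row1 -[delta_mx 0 i]/(bvec R i).
    by rewrite mul_delta_mx_cond mulmxnE mxE.
  have sfr x : ~ `|x - x0| <= r / 2 -> f x * L x = 0 by move=> /fr ->; rewrite mul0r.
  (* One direction is enough: omega gamma_1 = gamma_2, so both first-order coefficients appear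
     against independent matrices. *)
  have T0 : (a m + p m) *: gam1 R + (b m - q m) *: gam2 R = 0.
    apply: mulmx_col_eq0 => u; have [D []] := key _ u sfL sfr.
    rewrite L0 !DL !rl /= mulr1 !mulr0 !scale0r !mulmx0 !addr0 => -> /esym.
    rewrite scaler0 -!scalemxAr mulmxA => H; apply: (scalerI fC); rewrite scaler0 -[RHS]H.
    congr (_ *: (_ *m _)).
    by rewrite mulmxDl mul_scalar_mx -scalemxAl omega_gam1.
  have [] := @clifford_free R (a m + p m) (b m - q m) 0 0; last by [].
  by rewrite raddf0 scale0r !addr0.
have [D [_ _]] := key f 0 sf fr.
have am : a m = - p m by apply/eqP; rewrite -addr_eq0 h1.
have bm : b m = q m by apply/eqP; rewrite -subr_eq0 h2.
have [z1 z2 z3 _] : [/\ cdchart c (row 0 E) p m + cdchart c (row 1 E) q m = 0,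
    cdchart c (row 1 E) p m - cdchart c (row 0 E) q m = 0,
    a m * p m - b m * q m - (sdef c m)%:C = 0 & a m * q m + b m * p m = 0].
  apply: (@clifford_free R); apply: mulmx_col_eq0 => u.
  have [D' [_]] := key f u sf fr; rewrite h1 h2 scale0r addr0 raddf0 mul0mx add0r => H.
  by rewrite shift_scalar_mulmx; apply: (scalerI fC); rewrite scaler0 scalerBr scalemxAr -H !scalerA mulrC subrr.
have oE' : (coord c @` (dom c `&` U)) x0 by exists m.
have dp := csmooth_on_differentiable (csmooth_on_chart sp Xc) oE'.
have dq := csmooth_on_differentiable (csmooth_on_chart sq Xc) oE'.
split=> //.
  apply: (conjugate_frame Xc cm oE dE dp dq).2; split.
    by apply/eqP; rewrite -addr_eq0 z1.
  by apply/eqP; rewrite -subr_eq0 z2.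
by rewrite -[LHS]addr0 -z3 am bm; ring.
Qed.

End Factorization.
End Sections.

(** * Conformal charts where A = 0 *)

Section NewChart.
Variables (R : realType) (n : nat) (M : topologicalType) (X : oriented_manifold R n M).
Variables (c : chart R n M) (G K : 'rV[R]_n -> 'rV[R]_n) (W : set 'rV[R]_n).
Hypotheses (Xc : atlas X c) (oW : open W) (Wc : W `<=` coord c @` dom c).
Hypothesis sG : forall j, smooth_on W (fun x => G x 0 j).
Hypotheses (oGW : open (G @` W)) (GK : forall x, W x -> K (G x) = x).
Hypothesis sK : forall j, smooth_on (G @` W) (fun y => K y 0 j).
Hypothesis dG : forall x, W x -> 0 < \det (jacobian G x).

Let D := coordV c @` W.

Let DW m : D m -> [/\ dom c m, W (coord c m) & coordV c (coord c m) = m].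
Proof. by move=> [x Wx <-]; have [cx xx] := coord_image (Wc Wx); rewrite xx. Qed.

Let difG x : W x -> differentiable G x.
Proof. by move=> Wx; apply: differentiable_rowP => j; exact: (smooth_on_differentiable (sG j) Wx). Qed.

Let difK y : (G @` W) y -> differentiable K y.
Proof. by move=> Wy; apply: differentiable_rowP => j; exact: (smooth_on_differentiable (sK j) Wy). Qed.

Let image_new : (G \o coord c) @` D = G @` W.
Proof.
apply/seteqP; split => [_ [m Dm <-]|_ [x Wx <-]].
  by have [_ Wx _] := DW Dm; exists (coord c m).
exists (coordV c x); first by exists x.
by have [_ xx] := coord_image (Wc Wx); rewrite /= xx.
Qed.

Let new_image_open : open ((G \o coord c) @` D).
Proof. by rewrite image_new. Qed.

Let new_coordK m : D m -> (coordV c \o K) ((G \o coord c) m) = m.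
Proof. by move=> /DW [_ Wx mE]; rewrite /= GK. Qed.

Let new_coord_continuous m : D m -> {for m, continuous (G \o coord c)}.
Proof.
move=> /DW [cm Wx _]; apply: continuous_comp; first exact: Defs.coord_continuous.
exact: differentiable_continuous (difG Wx).
Qed.

Let new_coordV_continuous y : ((G \o coord c) @` D) y -> {for y, continuous (coordV c \o K)}.
Proof.
rewrite image_new => Gy; apply: continuous_comp; first exact: differentiable_continuous (difK Gy).
by move: Gy => [x Wx <-]; rewrite GK //; apply: coordV_continuous; exact: Wc.
Qed.

Definition new_chart := Chart (open_coord_preimage oW Wc) new_image_open new_coordK
  new_coord_continuous new_coordV_continuous.

Let jacGK x : W x -> jacobian G x *m jacobian K (G x) = 1%:M.
Proof.
move=> Wx; have dk : differentiable K (G x) by apply: difK; exists x.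
rewrite -(jacobian_comp (difG Wx) dk).
have did : differentiable (@id 'rV[R]_n) x by [].
have <- : jacobian id x = 1%:M.
  by apply/row_matrixP => i; apply: (etrans (row_jacobian i did)); rewrite derive_id row1.
apply/esym/near_eq_jacobian => //.
have nW : \forall y \near x, W y by exact: (open_nbhs_nbhs (conj oW Wx)).
by apply: filterS nW => y Wy; rewrite /= GK.
Qed.

Let detK x : W x -> 0 < \det (jacobian K (G x)).
Proof.
move=> Wx; have := congr1 determinant (jacGK Wx); rewrite det_mulmx det1 => H.
by rewrite -(pmulr_rgt0 _ (dG Wx)) H ltr01.
Qed.

(** By maximality only compatibility matters, and every transition map is one of [c] composed with
    [G] or [K]. The jacobian of [K] has positive determinant because its product with that of [G] is
    the identity. *)
Lemma new_chart_atlas : atlas X new_chart.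
Proof.
apply: atlas_maximal => c' Xc'; split.
  have oO : open (coord new_chart @` (dom new_chart `&` dom c')).
    by apply: open_coord_image; exact: dom_open.
  have OK y : (coord new_chart @` (dom new_chart `&` dom c')) y ->
      (G @` W) y /\ (coord c @` (dom c `&` dom c')) (K y).
    move=> [m [Dm c'm] <-]; have [cm Wx mE] := DW Dm; split; first by exists (coord c m).
    by rewrite /= GK //; exists m.
  split=> [j|y Oy].
    apply: (smooth_on_comp oO (T := K) (O' := coord c @` (dom c `&` dom c'))
      (h := fun x => transition c c' x 0 j)).
    - by move=> i; apply: smooth_on_sub (sK i) => y /OK [].
    - by move=> y /OK [].
    - exact: (transition_smooth j Xc Xc').
  have [Gy [m [cm c'm] mK]] := OK y Oy; have dk := difK Gy.
  have dT : differentiable (transition c c') (K y).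
    by rewrite -mK; exact: (transition_differentiable Xc Xc').
  have -> : transition new_chart c' = transition c c' \o K by [].
  rewrite (jacobian_comp dk dT) det_mulmx mulr_gt0 //.
    by move: Gy => [x Wx <-]; exact: detK.
  by rewrite -mK; exact: (jacobian_det_gt0 Xc Xc').
have oD : open D by exact: open_coord_preimage.
have oO : open (coord c' @` (dom c' `&` dom new_chart)) by exact: open_coord_image.
have OT y : (coord c' @` (dom c' `&` dom new_chart)) y ->
    exists m, [/\ dom c m, dom c' m, y = coord c' m, W (coord c m) & transition c' c y = coord c m].
  move=> [m [c'm Dm] <-]; have [cm Wx mE] := DW Dm; exists m; split=> //.
  exact: transition_coord.
split=> [j|y Oy].
  apply: (smooth_on_comp oO (T := transition c' c) (O' := W) (h := fun x => G x 0 j)) => //.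
    move=> i; apply: smooth_on_sub (transition_smooth i Xc' Xc) => y /OT [m [cm c'm -> _ _]].
    by exists m.
  by move=> y /OT [m [_ _ _ Wm ->]].
have [m [cm c'm yE Wm TE]] := OT y Oy.
have dT : differentiable (transition c' c) y by rewrite yE; exact: (transition_differentiable Xc' Xc).
have dg : differentiable G (transition c' c y) by rewrite TE; exact: difG.
have -> : transition c' new_chart = G \o transition c' c by [].
rewrite (jacobian_comp dT dg) det_mulmx mulr_gt0 //; last by rewrite TE; exact: dG.
by rewrite yE; exact: (jacobian_det_gt0 Xc' Xc).
Qed.

Lemma new_chart_jacobian m : dom new_chart m ->
  dom c m /\ jacobian (transition c new_chart) (coord c m) = jacobian G (coord c m).
Proof.
move=> Dm; have [cm Wx _] := DW Dm; split; first exact: cm.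
apply/esym/near_eq_jacobian; first exact: difG.
have nW : \forall y \near coord c m, W y by exact: (open_nbhs_nbhs (conj oW Wx)).
apply: filterS nW => y Wy; have [_ yy] := coord_image (Wc Wy).
by rewrite /transition /= yy.
Qed.

End NewChart.

(** Stacking P and nu gives a square matrix Q with Q Q^T = 1, hence Q^T Q = 1. So P^T P is the
    projection orthogonal to nu. *)
Lemma mulmx_tr_complete (R : fieldType) (P : 'M[R]_(2, 3)) (nu : 'rV[R]_3) :
  P *m P^T = 1%:M -> P *m nu^T = 0 -> nu *m nu^T = 1%:M ->
  P^T *m P + nu^T *m nu = 1%:M.
Proof.
move=> PP Pn nn; pose Q : 'M[R]_(2 + 1, 3) := col_mx P nu.
have nP : nu *m P^T = 0 by apply: trmx_inj; rewrite trmx_mul trmxK Pn trmx0.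
have QQ : Q *m Q^T = 1%:M by rewrite tr_col_mx mul_col_row PP Pn nP nn -scalar_mx_block.
by have := mulmx1C QQ; rewrite tr_col_mx mul_row_col.
Qed.

Lemma det_gt0_unit (R : realFieldType) n (B : 'M[R]_n) : 0 < \det B -> B \in unitmx.
Proof. by move=> d; rewrite unitmxE unitfE gt_eqF. Qed.

Lemma congruence_cancel (F : fieldType) n (J G : 'M[F]_n) : J \in unitmx ->
  J *m J^T = J *m G *m J^T -> G = 1%:M.
Proof.
move=> uJ H; have uJt : J^T \in unitmx by rewrite unitmx_tr.
by apply: (can_inj (mulKmx uJ)); apply: (can_inj (mulmxK uJt)); rewrite mulmx1.
Qed.

Section Isothermal.
Variables (R : realType) (M N : topologicalType).
Variables (X : oriented_manifold R 2 M) (g : riemannian_metric X).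
Variables (Y : oriented_manifold R 3 N) (h : riemannian_metric Y).
Variables (phi : M -> N) (xi : chart R 3 N -> M -> 'rV[R]_3).
Variable A : chart R 2 M -> M -> 'M[R]_2.
Hypotheses (hphi : isometric_immersion g h phi) (hxi : unit_normal X h phi xi).
Hypotheses (hA : shape_operator X h phi xi A) (hflat : flat h).

(* Where A = 0 the normal is constant in a flat chart, so orthogonal projection
   along it is a local isometry onto a plane. *)
Lemma isothermal_chart (S : spin_structure g) U m0 : open U -> U m0 ->
  (forall c m, atlas X c -> dom c m -> U m -> A c m = 0) ->
  exists2 c, conformal g c & dom c m0.
Proof.
move=> oU Um0 A0; have [c Xc cm0] := atlas_cover X m0.
have [k km0] := scov_cover S m0; have [c' [Yc' c'm0 fl]] := hflat (phi m0).
set x0 := coord c m0; set V := phi @^-1` dom c' `&` U.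
have oP : open (phi @^-1` dom c') by exact: (open_preimage_dom hphi).
have oV : open V by exact: openI.
have [r r0 Br] := chart_ball oV cm0 (conj c'm0 Um0).
set F := local_rep phi c c'; set B := ball x0 r.
have Bsub x : B x -> exists m, [/\ dom c m, dom c' (phi m), U m & coord c m = x].
  by move=> /Br [m [cm [c'm Um]] mx]; exists m.
have oB : open B by exact: ball_open.
have Bx0 : B x0 by exact: ballxx.
have BO : B `<=` coord c @` (dom c `&` phi @^-1` dom c').
  by move=> x /Bsub [m [cm c'm _ <-]]; exists m.
pose nu := xi c' m0.
have xi_cst x : B x -> xi c' (coordV c x) = nu.
  move=> Bx; apply/rowP => j.
  have sZ := smooth_on_sub BO (normal_smooth_on hxi Xc Yc' j).
  rewrite /nu -[in RHS](coordK cm0).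
  apply: (derive0_ball_cst (f := fun x => xi c' (coordV c x) 0 j) _ _ Bx).
    by move=> y By; exact: (smooth_on_differentiable sZ By).
  move=> y i /Bsub [m [cm c'm Um <-]].
  have := congr1 (fun T : 'M[R]_(2, 3) => T i j) (dnormalE hxi hA Xc Yc' fl cm c'm).
  by rewrite A0 // mul0mx oppr0 mxE [in RHS]mxE.
have nn : nu *m nu^T = 1%:M.
  by have := normal_unit hxi Yc' c'm0; rewrite fl // mulmx1.
have Dn m : dom c m -> dom c' (phi m) -> U m -> B (coord c m) -> dmap phi c c' m *m nu^T = 0.
  move=> cm c'm Um Bm; have := normal_orthogonal hxi Xc Yc' cm c'm.
  by rewrite fl // mulmx1 -(coordK cm) xi_cst // coordK.
set E := frame k c m0; have oE := frame_orthonormal Xc km0 cm0; have dE := frame_oriented Xc km0 cm0.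
rewrite -/E in oE dE.
(* The rows of P are the images of e_1 and e_2 at m0, an orthonormal basis of the plane orthogonal
   to nu. The frame is oriented, so projecting onto this basis preserves orientation. *)
have [P PE] : exists P, P = E *m dmap phi c c' m0 by exists (E *m dmap phi c c' m0).
have PP : P *m P^T = 1%:M.
  rewrite PE trmx_mul -mulmxA (mulmxA (dmap _ _ _ _)) -(gmx_flat hphi Xc Yc' fl cm0 c'm0).
  by rewrite mulmxA.
have Pn : P *m nu^T = 0 by rewrite PE -mulmxA Dn // mulmx0.
have PPn := mulmx_tr_complete PP Pn nn.
pose G x := F x *m P^T.
have dF x : B x -> differentiable F x.
  by move=> /Bsub [m [cm c'm _ <-]]; exact: (local_rep_differentiable hphi Xc Yc').
have GE x j : G x 0 j = \sum_i F x 0 i * P j i.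
  by rewrite mxE; apply: eq_bigr => i _; rewrite mxE.
have sG j : smooth_on B (fun x => G x 0 j).
  apply: (eq_smooth_on oB (f := fun x => \sum_i F x 0 i * P j i)); first by move=> x _; rewrite GE.
  apply: (smooth_on_sum oB) => i; apply: (smooth_onM oB); last exact: smooth_on_cst.
  by apply: smooth_on_sub (immersion_smooth hphi i Xc Yc').
have dG x : B x -> differentiable G x.
  by move=> Bx; apply: differentiable_rowP => j; exact: (smooth_on_differentiable (sG j) Bx).
have jacG x : B x -> jacobian G x = jacobian F x *m P^T.
  move=> Bx; apply/matrixP => i j; rewrite (jacobianE _ _ (dG x Bx)) mxE.
  have dFi e := smooth_on_differentiable (smooth_on_sub BO (immersion_smooth hphi e Xc Yc')) Bx.
  have dC (b : R) : differentiable (fun=> b) x by exact: differentiable_cst.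
  have -> : (fun y => G y 0 j) = \sum_e (fun y => F y 0 e * P j e).
    by apply/funext => y; rewrite fct_sumE GE.
  rewrite /partial derive_sum; last first.
    by move=> e; apply: diff_derivable; exact: (differentiableM (dFi e) (dC _)).
  apply: eq_bigr => e _.
  rewrite (deriveM (diff_derivable (dFi e)) (diff_derivable (dC (P j e)))) derive_cst.
  rewrite /GRing.scale /= mulr0 add0r mulrC; apply: congr2; last by rewrite [RHS]mxE.
  by rewrite (jacobianE _ _ (dF x Bx)).
(* All tangent planes over the ball are orthogonal to the same nu, so P^T P acts on them as the
   identity and the metric is preserved at every point, not only at x0. *)
have jacGG x : B x -> jacobian G x *m (jacobian G x)^T = gmx g c (coordV c x).
  move=> Bx; have [m [cm c'm Um mx]] := Bsub x Bx.
  rewrite jacG // -mx coordK // (gmx_flat hphi Xc Yc' fl cm c'm) -/(dmap phi c c' m).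
  rewrite trmx_mul trmxK -mulmxA (mulmxA P^T).
  have -> : P^T *m P = 1%:M - nu^T *m nu by rewrite -PPn addrK.
  rewrite mulmxBl mul1mx mulmxBr -(mulmxA nu^T) (mulmxA _ nu^T) Dn // ?mx //.
  by rewrite mul0mx subr0.
(* At x0 the jacobian is g E^T, whose determinant is the inverse of det E since E g E^T = 1. *)
have dG0 : 0 < \det (jacobian G x0).
  rewrite jacG // PE trmx_mul -/(dmap phi c c' m0) mulmxA -(gmx_flat hphi Xc Yc' fl cm0 c'm0).
  have := congr1 determinant oE; rewrite -mulmxA det_mulmx det1 => H.
  by rewrite -(pmulr_rgt0 _ dE) H ltr01.
pose O := B `&` [set x | 0 < \det (jacobian G x)].
have sdet : smooth_on B (fun x => \det (jacobian G x)).
  apply: (smooth_on_det oB) => i j.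
  apply: (eq_smooth_on oB _ (smooth_on_partial i (sG j))) => x Bx.
  by rewrite (jacobianE _ _ (dG x Bx)).
have oO : open O.
  rewrite openE => x [Bx dx]; apply: filterI; first by apply: open_nbhs_nbhs.
  have cx := differentiable_continuous (smooth_on_differentiable sdet Bx).
  exact: (cx _ (open_nbhs_nbhs (conj (@open_gt R 0) dx))).
have OB : O `<=` B by move=> x [].
have uG : jacobian G x0 \in unitmx by rewrite unitmxE unitfE gt_eqF.
have [W [K [oW Wx0 WO oGW [GK sK]]]] := inverse_function oO (conj Bx0 dG0)
  (fun j => smooth_on_sub OB (sG j)) uG.
have Wc : W `<=` coord c @` dom c.
  by move=> x /WO [/Bsub [m [cm _ _ <-]] _]; exists m.
have sGW j := smooth_on_sub (subset_trans WO OB) (sG j).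
have sKW j : smooth_on (G @` W) (fun y => K y 0 j) := sK _ (smooth_on_coord (O := W) j).
have dGW x : W x -> 0 < \det (jacobian G x) by move=> /WO [].
pose c1 := new_chart oW Wc sGW oGW GK sKW.
have Xc1 : atlas X c1 by exact: new_chart_atlas.
have dom1 m : dom c1 m -> dom c m /\ gmx g c1 m = 1%:M.
  move=> Dm; have [cm jac] : dom c m /\ jacobian (transition c c1) (coord c m) = jacobian G (coord c m).
    exact: new_chart_jacobian.
  split; first exact: cm.
  have Bm : B (coord c m).
    by move: Dm => [x Wx <-]; have [_ ->] := coord_image (Wc x Wx); exact: OB (WO _ Wx).
  have := gmx_change g Xc Xc1 cm Dm; rewrite jac -[in LHS](coordK cm) -(jacGG _ Bm).
  have uJ : jacobian G (coord c m) \in unitmx.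
    apply: det_gt0_unit; apply: dGW.
    by move: Dm => [x Wx <-]; have [_ ->] := coord_image (Wc x Wx).
  exact: congruence_cancel uJ.
exists c1; last by exists x0 => //; exact: coordK.
split; first exact: Xc1.
move=> m Dm; have [cm g1] := dom1 m Dm; split; first by exists 1 => //; exact: g1.
rewrite /Jmx g1.
rewrite det1 sqrtr1 invr1 scale1r mul1mx mulmxBr !mul_delta_mx_cond /=.
by rewrite mulr1n mulr0n subr0.
Qed.

End Isothermal.

(** * Holomorphic functions and the identity theorem *)

Section Linear.
Variables (R : realType) (n : nat).
Implicit Types (P Q F : 'rV[R]_n -> R[i]).

Lemma cdifferentiable_cst (a : R[i]) x : cdifferentiable (fun=> a : R[i]) (x : 'rV[R]_n).
Proof. by apply: (csmooth_on_differentiable (O := setT)) => //; exact: csmooth_on_cst. Qed.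

Lemma cderive_linear (a b : R[i]) P Q x v : cdifferentiable P x -> cdifferentiable Q x ->
  cderive v (fun y => a * P y + b * Q y) x = a * cderive v P x + b * cderive v Q x.
Proof.
move=> dP dQ; have da := cdifferentiable_cst a x; have db := cdifferentiable_cst b x.
rewrite (cderiveD v (cdifferentiableM da dP) (cdifferentiableM db dQ)).
by rewrite (cderiveM v da dP) (cderiveM v db dQ) !cderive_cst !mul0r !add0r.
Qed.

Lemma cderive_conj F x v : cdifferentiable F x ->
  cderive v (fun y => (F y)^*) x = (cderive v F x)^*.
Proof.
move=> [d1 d2]; rewrite /cderive.
have -> : cRe \o (fun y => (F y)^*) = cRe \o F by apply/funext => y /=; case: (F y).
have -> : cIm \o (fun y => (F y)^*) = - (cIm \o F).
  by apply/funext => y; transitivity (- cIm (F y)) => //=; case: (F y).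
by rewrite (deriveN (diff_derivable d2)).
Qed.

End Linear.

Section Holomorphic.
Variables (R : realType) (M : topologicalType) (X : oriented_manifold R 2 M).
Variable g : riemannian_metric X.
Implicit Types (c : chart R 2 M) (m : M) (U V : set M) (f p q : M -> R[i]).

Lemma csmooth_fun_linear U (a b : R[i]) p q : open U -> csmooth_fun X U p ->
  csmooth_fun X U q -> csmooth_fun X U (fun m => a * p m + b * q m).
Proof.
move=> oU sp sq; apply: csmooth_funP => c Xc.
have oO : open (coord c @` (dom c `&` U)) by exact: open_coord_image.
exact: (csmooth_onD oO (csmooth_onM oO (csmooth_on_cst _ a) (csmooth_on_chart sp Xc))
  (csmooth_onM oO (csmooth_on_cst _ b) (csmooth_on_chart sq Xc))).
Qed.

Lemma csmooth_fun_conj U f : open U -> csmooth_fun X U f -> csmooth_fun X U (fun m => (f m)^*).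
Proof.
move=> oU sf; apply: csmooth_funP => c Xc.
have oO : open (coord c @` (dom c `&` U)) by exact: open_coord_image.
exact: (csmooth_on_conj oO (csmooth_on_chart sf Xc)).
Qed.

Lemma csmooth_fun_cdifferentiable U f c m : csmooth_fun X U f -> atlas X c -> dom c m ->
  U m -> cdifferentiable (f \o coordV c) (coord c m).
Proof.
by move=> sf Xc cm Um; apply: (csmooth_on_differentiable (csmooth_on_chart sf Xc)); exists m.
Qed.

Lemma holomorphic_dbar U f : csmooth_fun X U f -> (holomorphic_on g U f <->
  forall c m, conformal g c -> dom c m -> U m -> dbar (f \o coordV c) (coord c m) = 0).
Proof.
move=> sf; split=> [[_ H] c m cc cm Um|H]; last split=> // c m cc cm Um.
  have df := csmooth_fun_cdifferentiable sf (proj1 cc) cm Um.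
  exact: (dbar_of_derivable df (H c m cc cm Um)).
have df := csmooth_fun_cdifferentiable sf (proj1 cc) cm Um.
exact: (derivable_of_dbar df (H c m cc cm Um)).
Qed.

Lemma conjugate_holomorphic U p q : open U -> csmooth_fun X U p -> csmooth_fun X U q ->
  (forall c m, atlas X c -> dom c m -> U m -> conjugate g c p q m) ->
  holomorphic_on g U (fun m => p m - 'i%C * q m) /\
  antiholomorphic_on g U (fun m => p m + 'i%C * q m).
Proof.
move=> oU sp sq pq.
have rE : (fun m => p m - 'i%C * q m) = fun m => 1 * p m + (- 'i%C) * q m.
  by apply/funext => m; rewrite mul1r mulNr.
have tE : (fun m => p m + 'i%C * q m) = fun m => 1 * p m + 'i%C * q m.
  by apply/funext => m; rewrite mul1r.
have key c m : conformal g c -> dom c m -> U m ->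
    [/\ cdifferentiable (p \o coordV c) (coord c m), cdifferentiable (q \o coordV c) (coord c m),
      cderive (bvec R 0) (p \o coordV c) (coord c m) = - cderive (bvec R 1) (q \o coordV c) (coord c m) &
      cderive (bvec R 1) (p \o coordV c) (coord c m) = cderive (bvec R 0) (q \o coordV c) (coord c m)].
  move=> cc cm Um; have Xc := proj1 cc.
  have dp := csmooth_fun_cdifferentiable sp Xc cm Um.
  have dq := csmooth_fun_cdifferentiable sq Xc cm Um.
  by have [h1 h2] := (conformal_conjugate cc cm dp dq).1 (pq c m Xc cm Um).
have i2 : 'i%C * 'i%C = - 1 :> R[i] by rewrite -expr2 sqr_i.
split.
  rewrite rE; apply/(holomorphic_dbar (csmooth_fun_linear _ _ oU sp sq)) => c m cc cm Um.
  have [dp dq h1 h2] := key c m cc cm Um.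
  rewrite /dbar (cderive_linear _ _ _ dp dq) (cderive_linear _ _ _ dp dq) h1 h2.
  move: (cderive _ _ _) (cderive _ _ _) => a b.
  transitivity (- b * (1 + 'i%C * 'i%C)); first by ring.
  by rewrite i2 subrr mulr0.
rewrite tE /antiholomorphic_on.
apply/(holomorphic_dbar (csmooth_fun_conj oU (csmooth_fun_linear _ _ oU sp sq))) => c m cc cm Um.
have [dp dq h1 h2] := key c m cc cm Um.
have dl : cdifferentiable (fun x => 1 * p (coordV c x) + 'i%C * q (coordV c x)) (coord c m).
  exact: (csmooth_fun_cdifferentiable (csmooth_fun_linear 1 'i%C oU sp sq) (proj1 cc) cm Um).
rewrite /dbar (cderive_conj _ dl) (cderive_conj _ dl) (cderive_linear _ _ _ dp dq) (cderive_linear _ _ _ dp dq) h1 h2.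
move: (cderive _ _ _) (cderive _ _ _) => [a1 a2] [b1 b2].
by apply: complexP; simpc => /=; ring.
Qed.

(* The pair (r / 2, i r / 2) is the solution of p - i q = r, p + i q = 0. *)
Lemma holomorphic_conjugate U r : open U -> holomorphic_on g U r ->
  (forall m, U m -> exists2 c, conformal g c & dom c m) ->
  forall c m, atlas X c -> dom c m -> U m ->
    conjugate g c (fun m => 2^-1 * r m) (fun m => ('i%C / 2) * r m) m.
Proof.
move=> oU hr conf c m Xc cm Um; have sr := hr.1; have [c1 cc1 c1m] := conf m Um.
have sZ a : csmooth_fun X U (fun m => a * r m).
  have := csmooth_fun_linear a 0 oU sr sr.
  by congr (csmooth_fun _ _ _); apply/funext => m'; rewrite mul0r addr0.
have d1 a : cdifferentiable ((fun m => a * r m) \o coordV c1) (coord c1 m).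
  exact: csmooth_fun_cdifferentiable (sZ a) (proj1 cc1) c1m Um.
have d2 a := csmooth_fun_cdifferentiable (sZ a) Xc cm Um.
apply: (conjugate_change (proj1 cc1) Xc c1m cm (d2 _) (d2 _)).
apply/(conformal_conjugate cc1 c1m (d1 _) (d1 _)); rewrite !cdchartE.
have dr := csmooth_fun_cdifferentiable sr (proj1 cc1) c1m Um.
have dC a := cdifferentiable_cst a (coord c1 m).
have cE a v : cderive v ((fun m => a * r m) \o coordV c1) (coord c1 m) = a * cderive v (r \o coordV c1) (coord c1 m).
  by apply: etrans (cderiveM v (dC a) dr) _; rewrite cderive_cst mul0r add0r.
have := (holomorphic_dbar sr).1 hr c1 m cc1 c1m Um; rewrite /dbar !cE.
move: (cderive _ _ _) (cderive _ _ _) => a b /eqP; rewrite addr_eq0 => /eqP ->.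
have i2 : 'i%C * 'i%C = - 1 :> R[i] by rewrite -expr2 sqr_i.
split; first by ring.
transitivity (- ('i%C * 'i%C) / 2 * a); last by ring.
by rewrite i2; ring.
Qed.

(** The pair (t/2, -i t/2) solves p - i q = 0, p + i q = t. The equation is verified in a conformal
    chart, the only kind where the hypothesis on t gives information, and then transported. *)
Lemma antiholomorphic_conjugate U t : open U -> antiholomorphic_on g U t ->
  (forall m, U m -> exists2 c, conformal g c & dom c m) ->
  forall c m, atlas X c -> dom c m -> U m ->
    conjugate g c (fun m => 2^-1 * t m) (fun m => (- 'i%C / 2) * t m) m.
Proof.
move=> oU ht conf c m Xc cm Um; have [c1 cc1 c1m] := conf m Um.
have st : csmooth_fun X U t.
  have := csmooth_fun_conj oU ht.1; congr (csmooth_fun _ _ _).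
  by apply/funext => m'; rewrite conjcK.
have sZ a : csmooth_fun X U (fun m => a * t m).
  have := csmooth_fun_linear a 0 oU st st.
  by congr (csmooth_fun _ _ _); apply/funext => m'; rewrite mul0r addr0.
have d1 a : cdifferentiable ((fun m => a * t m) \o coordV c1) (coord c1 m).
  exact: csmooth_fun_cdifferentiable (sZ a) (proj1 cc1) c1m Um.
have d2 a := csmooth_fun_cdifferentiable (sZ a) Xc cm Um.
apply: (conjugate_change (proj1 cc1) Xc c1m cm (d2 _) (d2 _)).
apply/(conformal_conjugate cc1 c1m (d1 _) (d1 _)); rewrite !cdchartE.
have dt := csmooth_fun_cdifferentiable st (proj1 cc1) c1m Um.
have dC a := cdifferentiable_cst a (coord c1 m).
have cE a v : cderive v ((fun m => a * t m) \o coordV c1) (coord c1 m) = a * cderive v (t \o coordV c1) (coord c1 m).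
  by apply: etrans (cderiveM v (dC a) dt) _; rewrite cderive_cst mul0r add0r.
have := (holomorphic_dbar ht.1).1 ht c1 m cc1 c1m Um; rewrite /dbar !cE.
rewrite -[(_ \o _)]/(fun x => ((t \o coordV c1) x)^*) !(cderive_conj _ dt).
move: (cderive (bvec R 0) (t \o _) _) (cderive (bvec R 1) (t \o _) _) => a b H.
have -> : a = 'i%C * b.
  move/(congr1 (@conjc R)): H; move: a b => [a1 a2] [b1 b2]; simpc => -[h1 h2].
  by apply: complexP => /=; lra.
have i2 : 'i%C * 'i%C = - 1 :> R[i] by rewrite -expr2 sqr_i.
split; first by ring.
transitivity (- ('i%C * 'i%C) / 2 * b); last by ring.
by rewrite i2; ring.
Qed.

(** The interior of the zero set is open; it is closed in [U] because [CR_vanish_cube] spreads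
    vanishing from a nearby point over a cube whose size does not depend on that point. *)
Lemma identity_theorem U f m0 : open U -> connected U -> holomorphic_on g U f ->
  (forall m, U m -> exists2 c, conformal g c & dom c m) ->
  U m0 -> (\forall m \near m0, f m = 0) -> forall m, U m -> f m = 0.
Proof.
move=> oU cU hf conf Um0 f0.
pose Z := [set m | U m /\ \forall m' \near m, f m' = 0].
suff ZU : Z = U by move=> m; rewrite -ZU => -[_ /nbhs_singleton].
apply: cU; first by exists m0.
  exists [set m | \forall m' \near m, f m' = 0]; last by [].
  by rewrite openE => m /= /nbhs_interior.
exists (closure Z); first exact: closed_closure.
apply/seteqP; split => [m [Um Zm]|m [Um cZm]]; first by split=> //; apply: subset_closure.
split=> //; have [c cc cm] := conf m Um; have Xc := proj1 cc.
have [r r0 Br] := chart_ball oU cm Um; set x := coord c m in Br.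
have oB : open (ball x r) by exact: ball_open.
have r2 : 0 < r / 2 by rewrite divr_gt0.
(* With x' within r/8 of x, the closed cube of radius r/2 around x' stays in the ball of radius r,
   and the points within r/8 of x are within r/4 of x', where [CR_vanish_cube] applies. *)
have r8 : 0 < r / 8 by rewrite divr_gt0.
have nb : \forall m' \near m, dom c m' /\ ball x (r / 8) (coord c m').
  have n1 := near_dom cm; have n2 := near_coord cm (nbhsx_ballx x (r / 8) r8).
  by apply: filterI n1 n2.
have [m' [[Um' nf] [cm' bm']]] := cZm _ nb; set x' := coord c m' in bm'.
have [e e0 Be] : exists2 e : R, 0 < e & forall y, ball x' e y -> f (coordV c y) = 0.
  have : \forall y \near x', f (coordV c y) = 0.
    have cV : {for x', continuous (coordV c)} by apply: coordV_continuous; exists m'.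
    have nf' : nbhs (coordV c x') [set z | f z = 0] by rewrite coordK.
    exact: (cV _ nf').
  by move=> /nbhs_ballP [e /= e0 He]; exists e.
have sub y : `|y - x'| <= r / 2 -> ball x r y.
  move=> yx; rewrite -ball_normE /=; move: bm'; rewrite -ball_normE /= => bm'.
  rewrite -(subrK x' x) -addrA; apply: le_lt_trans (ler_normD _ _) _; rewrite [`|x' - y|]distrC.
  by lra.
have CRF : CR (ball x r) (f \o coordV c).
  split.
    have [s1 s2] := csmooth_on_chart hf.1 Xc.
    by split; apply: smooth_on_sub; eassumption.
  by move=> y /Br [m1 [cm1 Um1] <-]; exact: ((holomorphic_dbar hf.1).1 hf).
have V := CR_vanish_cube oB CRF r2 e0 sub Be.
have : \forall m1 \near m, dom c m1 /\ ball x (r / 8) (coord c m1).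
  exact: nb.
apply: filterS => m1 [cm1 b1]; rewrite -(coordK cm1); apply: V.
move: b1 bm'; rewrite -!ball_normE /= => b1 bm'.
rewrite -(subrK x (coord c m1)) -addrA; apply: le_lt_trans (ler_normD _ _) _.
by rewrite [`|coord c m1 - x|]distrC; lra.
Qed.

Lemma csmooth_near_neq0 U f m : csmooth_fun X U f -> U m -> f m != 0 ->
  \forall m' \near m, f m' != 0.
Proof.
move=> sf Um fm; have [c Xc cm] := atlas_cover X m.
have [d1 d2] := csmooth_fun_cdifferentiable sf Xc cm Um.
have c1 := differentiable_continuous d1; have c2 := differentiable_continuous d2.
have nz : (cRe \o f \o coordV c) (coord c m) != 0 \/ (cIm \o f \o coordV c) (coord c m) != 0.
  rewrite /= coordK //; apply/orP; rewrite -negb_and; apply: contraNN fm => /andP[/eqP a /eqP b].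
  by apply/eqP; exact: complexP.
have : \forall x \near coord c m, f (coordV c x) != 0.
  case: nz => nz.
    have H : nbhs (coord c m) [set x | (cRe \o f \o coordV c) x != 0].
      exact: (c1 _ (open_nbhs_nbhs (conj (@open_neq R 0) nz))).
    by apply: filterS H => x /=; apply: contra_neq => ->.
  have H : nbhs (coord c m) [set x | (cIm \o f \o coordV c) x != 0].
    exact: (c2 _ (open_nbhs_nbhs (conj (@open_neq R 0) nz))).
  by apply: filterS H => x /=; apply: contra_neq => ->.
move=> /(near_coord cm) H; have D := near_dom cm.
by apply: filterS2 D H => m' cm'; rewrite coordK.
Qed.

End Holomorphic.

(** * Factorizations from harmonic functions *)

Section Polar.
Variables (R : realType) (V : normedModType R).
Implicit Types (a b f : V -> R).

Lemma derive_comp_real f (h : R -> R) (l : R) x v : differentiable f x ->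
  is_derive (f x) 1 h l ->
  'D_v (fun y => h (f y)) x = l * 'D_v f x /\ derivable (fun y => h (f y)) x v.
Proof.
move=> df D; have dh : differentiable h (f x) by apply/derivable1_diffP; case: D.
split; last by apply: diff_derivable; exact: (differentiable_comp df dh).
rewrite (derive_comp v df dh) (deriveE _ dh) -[X in 'd _ _ X]mulr1 linearZ /=.
by rewrite -(deriveE _ dh) (@derive_val _ _ _ _ _ _ _ D) mulrC.
Qed.

(** Q + i P is exp((a + i b)/2); the formulas are the imaginary and real parts of its derivative. *)
Lemma derive_polar a b x v : differentiable a x -> differentiable b x ->
  let P y := expR (2^-1 * a y) * sin (2^-1 * b y) in
  let Q y := expR (2^-1 * a y) * cos (2^-1 * b y) in
  'D_v P x = 2^-1 * (P x * 'D_v a x + Q x * 'D_v b x) /\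
  'D_v Q x = 2^-1 * (Q x * 'D_v a x - P x * 'D_v b x).
Proof.
move=> da db P Q.
have dc : differentiable (fun=> 2^-1 : R) x by exact: differentiable_cst.
have half f : differentiable f x -> differentiable (fun y => 2^-1 * f y) x /\
    'D_v (fun y => 2^-1 * f y) x = 2^-1 * 'D_v f x.
  move=> df; split; first exact: (differentiableM dc df).
  rewrite (deriveM (diff_derivable dc) (diff_derivable df)) derive_cst.
  by rewrite /GRing.scale /= mulr0 addr0.
have [da2 Da] := half a da; have [db2 Db] := half b db.
have [De de] := derive_comp_real v da2 (is_derive_expR (2^-1 * a x)).
have [Ds ds] := derive_comp_real v db2 (is_derive_sin (2^-1 * b x)).
have [Dc dcs] := derive_comp_real v db2 (is_derive_cos (2^-1 * b x)).
rewrite /P /Q (deriveM de ds) (deriveM de dcs) De Ds Dc Da Db /GRing.scale /=.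
by split; ring.
Qed.

End Polar.

Section HarmonicFactor.
Variables (R : realType) (M : topologicalType) (X : oriented_manifold R 2 M).
Variable g : riemannian_metric X.
Implicit Types (c : chart R 2 M) (m : M) (U : set M).

Lemma Jmx_sqr c m : atlas X c -> dom c m -> Jmx g c m *m Jmx g c m = - 1%:M.
Proof.
move=> Xc cm; rewrite !JmxE -/(vol g c m); have v0 := vol_gt0 g Xc cm.
have H := trmx_Kmx (gmx g c m); rewrite gmx_sym // -(vol_sqr g Xc cm) in H.
rewrite -scalemxAl -scalemxAr scalerA mulmxA H -scalemxAl Kmx_sqr scalerA.
by rewrite -invfM mulVf ?scale1r // mulf_neq0 // gt_eqF.
Qed.

Lemma cgrad_imaginary c (P : M -> R) m :
  cgrad g c (fun m => 'i%C * (P m)%:C) m = 'i%C *: map_mx (real_complex R) (grad g c P m).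
Proof.
rewrite /cgrad.
have -> : cRe \o (fun m => 'i%C * (P m)%:C) = fun=> 0.
  by apply/funext => m' /=; rewrite !(mul0r, mulr0, subrr).
have -> : cIm \o (fun m => 'i%C * (P m)%:C) = P.
  by apply/funext => m' /=; rewrite !(mul0r, mulr0, add0r, mul1r).
rewrite (_ : grad g c (fun=> 0) m = 0) ?map_mx0 ?add0r //.
rewrite /grad (_ : \row_i _ = 0) ?mul0mx //; apply/rowP => i; rewrite !mxE /dchart.
exact: derive_cst.
Qed.

(** The factor i produces the minus sign in p^2 + q^2 = -F, and the halves make exp(u/2), with u =
    log F, the square root of F. *)
Lemma harmonic_factor U (F : M -> R) : open U -> simply_connected R U ->
  smooth_fun X U F -> (forall m, U m -> 0 < F m) ->
  (forall c m, atlas X c -> dom c m -> U m -> laplacian g c (fun m => ln (F m)) m = 0) ->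
  exists p q : M -> R[i], [/\ csmooth_fun X U p, csmooth_fun X U q,
    forall c m, atlas X c -> dom c m -> U m -> conjugate g c p q m &
    forall m, U m -> p m ^+ 2 + q m ^+ 2 = - (F m)%:C].
Proof.
move=> oU scU sF F0 L0.
have sln : smooth_fun X U (fun m => ln (F m)).
  move=> c Xc; have oO : open (coord c @` (dom c `&` U)) by exact: open_coord_image.
  apply: (smooth_on_ln oO (sF c Xc)) => _ [m' [cm' Um'] <-].
  by rewrite /= coordK // F0.
have [th sth gth] := harmonic_conjugate oU sln scU L0.
pose P m := expR (2^-1 * ln (F m)) * sin (2^-1 * th m).
pose Q m := expR (2^-1 * ln (F m)) * cos (2^-1 * th m).
have sPQ : smooth_fun X U P /\ smooth_fun X U Q.
  split=> c Xc; have oO : open (coord c @` (dom c `&` U)) by exact: open_coord_image.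
    apply: (smooth_onM oO); [apply: (smooth_on_expR oO)|apply: (smooth_on_sin oO)];
      by apply: (smooth_onM oO); [exact: smooth_on_cst|exact: (sln c Xc)||exact: (sth c Xc)].
  apply: (smooth_onM oO); [apply: (smooth_on_expR oO)|apply: (smooth_on_cos oO)];
    by apply: (smooth_onM oO); [exact: smooth_on_cst|exact: (sln c Xc)||exact: (sth c Xc)].
have [sP sQ] := sPQ.
have simag (f : M -> R) : smooth_fun X U f -> csmooth_fun X U (fun m => 'i%C * (f m)%:C).
  move=> sf; apply: csmooth_funP => c Xc.
  have oO : open (coord c @` (dom c `&` U)) by exact: open_coord_image.
  exact: (csmooth_onM oO (csmooth_on_cst _ _) (csmooth_onC (sf c Xc))).
exists (fun m => 'i%C * (P m)%:C), (fun m => 'i%C * (Q m)%:C); split; try exact: simag.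
  move=> c m Xc cm Um; rewrite /conjugate !cgrad_imaginary -scalemxAl -map_mxM; congr (_ *: map_mx _ _).
  have da := smooth_fun_differentiable sln Xc cm Um.
  have db := smooth_fun_differentiable sth Xc cm Um.
  have gPQ : grad g c P m = 2^-1 *: (P m *: grad g c (fun m => ln (F m)) m + Q m *: grad g c th m) /\
      grad g c Q m = 2^-1 *: (Q m *: grad g c (fun m => ln (F m)) m - P m *: grad g c th m).
    rewrite /grad !scalemxAl -mulmxDl -mulmxBl !scalemxAl; split; congr (_ *m _);
      apply/rowP => i; rewrite !mxE /dchart; have [DP DQ] := derive_polar (bvec R i) da db.
      by apply: etrans DP _; rewrite /= coordK.
    by apply: etrans DQ _; rewrite /= coordK.
  (* Since grad th = J grad u and J^2 = -1, applying J to Q grad u - P J grad u gives P grad u + Q J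
     grad u. *)
  have [-> ->] := gPQ; rewrite (gth c m Xc cm Um).
  move: (grad g c _ m) (Jmx_sqr Xc cm) => w JJ; rewrite -!scalemxAl mulmxBl -!scalemxAl.
  rewrite -mulmxA JJ mulmxN mulmx1 scalerN opprK.
  by rewrite addrC.
move=> m Um; rewrite !exprMn sqr_i !mulN1r -opprD -!rmorphXn -rmorphD /=; congr (- _%:C).
rewrite /P /Q !exprMn -mulrDr [sin _ ^+ 2 + _]addrC cos2Dsin2 mulr1 expr2 -expRD.
have -> : 2^-1 * ln (F m) + 2^-1 * ln (F m) = ln (F m) by field.
by rewrite lnK ?posrE ?F0.
Qed.

End HarmonicFactor.

(** * Scalar-chiral factorizations *)

Section Main.
Variables (R : realType) (M N : topologicalType).
Variables (X : oriented_manifold R 2 M) (g : riemannian_metric X).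
Variables (Y : oriented_manifold R 3 N) (h : riemannian_metric Y).
Variables (phi : M -> N) (xi : chart R 3 N -> M -> 'rV[R]_3).
Variables (A : chart R 2 M -> M -> 'M[R]_2) (S : spin_structure g).
Hypotheses (hflat : flat h) (hphi : isometric_immersion g h phi).
Hypotheses (hxi : unit_normal X h phi xi) (hA : shape_operator X h phi xi A).
Implicit Types (U : set M) (a b p q r t : M -> R[i]).

Let sdefE c m : atlas X c -> dom c m ->
  shape_sqnorm A c m - mean_curvature A c m ^+ 2 = shape_defect X A m.
Proof. exact: (shape_defectE hphi hxi hA). Qed.

Lemma factorization_shape U a b p q : open U -> factorization S A U a b p q ->
  [/\ csmooth_fun X U p, csmooth_fun X U q,
    forall m, U m -> a m = - p m /\ b m = q m,
    forall c m, atlas X c -> dom c m -> U m -> conjugate g c p q m &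
    forall m, U m -> p m ^+ 2 + q m ^+ 2 = - (shape_defect X A m)%:C].
Proof.
move=> oU fac; have [_ _ sp sq _] := fac; split=> // [m Um|c m Xc cm Um|m Um].
- by have [c Xc cm] := atlas_cover X m; have [] := factorization_nec oU fac Xc cm Um.
- by have [] := factorization_nec oU fac Xc cm Um.
- have [c Xc cm] := atlas_cover X m; rewrite -(sdefE Xc cm).
  by have [] := factorization_nec oU fac Xc cm Um.
Qed.

Lemma factorization_exists U p q : open U -> csmooth_fun X U p -> csmooth_fun X U q ->
  (forall c m, atlas X c -> dom c m -> U m -> conjugate g c p q m) ->
  (forall m, U m -> p m ^+ 2 + q m ^+ 2 = - (shape_defect X A m)%:C) ->
  factorization S A U (fun m => - p m) q p q.
Proof.
move=> oU sp sq pq pq2; apply: factorization_suff => // c m Xc cm Um.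
by rewrite (sdefE Xc cm) pq2.
Qed.

Lemma mul_sum_diff (x y : R[i]) : (x - 'i%C * y) * (x + 'i%C * y) = x ^+ 2 + y ^+ 2.
Proof. by rewrite -subr_sqr exprMn sqr_i mulN1r opprK. Qed.

Lemma factorization_properties U a b p q : open U -> factorization S A U a b p q ->
  [/\ forall m, U m -> a m = - p m /\ b m = q m,
      forall c m, atlas X c -> dom c m -> U m ->
        cgrad g c p m = cgrad g c q m *m map_mx (real_complex R) (Jmx g c m)
        /\ p m ^+ 2 + q m ^+ 2
           = (mean_curvature A c m ^+ 2 - shape_sqnorm A c m)%:C,
      holomorphic_on g U (fun m => p m - 'i%C * q m),
      antiholomorphic_on g U (fun m => p m + 'i%C * q m) &
      forall c m, atlas X c -> dom c m -> U m ->
        (p m - 'i%C * q m) * (p m + 'i%C * q m)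
        = (mean_curvature A c m ^+ 2 - shape_sqnorm A c m)%:C].
Proof.
move=> oU fac; have [sp sq ab pq pq2] := factorization_shape oU fac.
have [hol ahol] := conjugate_holomorphic oU sp sq pq.
have pq2' c m : atlas X c -> dom c m -> U m -> p m ^+ 2 + q m ^+ 2 =
    (mean_curvature A c m ^+ 2 - shape_sqnorm A c m)%:C.
  by move=> Xc cm Um; rewrite pq2 // -(sdefE Xc cm) -rmorphN opprB.
split=> // c m Xc cm Um; last by rewrite mul_sum_diff; exact: pq2'.
by split; [exact: pq|exact: pq2'].
Qed.

Lemma factorization_log_harmonic U : open U -> simply_connected R U ->
  (forall c m, atlas X c -> dom c m -> U m -> A c m != 0) ->
  (exists a b p q, factorization S A U a b p q) <->
  (forall c m, atlas X c -> dom c m -> U m ->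
     laplacian g c (fun m' => ln (shape_sqnorm A c m' - mean_curvature A c m' ^+ 2)) m = 0).
Proof.
move=> oU scU A0.
have F0 m : U m -> 0 < shape_defect X A m.
  move=> Um; have [c Xc cm] := atlas_cover X m; have [k km] := scov_cover S m.
  have oE := frame_orthonormal Xc km cm.
  exact: (shape_defect_gt0 hphi hxi hA hflat Xc cm oE (A0 c m Xc cm Um)).
have sF : smooth_fun X U (shape_defect X A) := shape_defect_smooth hphi hxi hA hflat (U := U).
have lapE c m : atlas X c -> dom c m -> U m ->
    laplacian g c (fun m' => ln (shape_sqnorm A c m' - mean_curvature A c m' ^+ 2)) m =
    laplacian g c (fun m' => ln (shape_defect X A m')) m.
  move=> Xc cm Um; apply: (eq_laplacian g oU Um cm) => m' cm' _.
  by rewrite (sdefE Xc cm').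
split=> [[a [b [p [q fac]]]] c m Xc cm Um|L0].
  have [sp sq _ pq pq2] := factorization_shape oU fac.
  by rewrite lapE //; exact: (laplacian_ln_factor oU sp sq pq2 F0 pq).
have [|p [q [sp sq pq pq2]]] := harmonic_factor oU scU sF F0 (g := g).
  by move=> c m Xc cm Um; rewrite -lapE //; exact: L0.
by exists (fun m => - p m), q, p, q; exact: factorization_exists.
Qed.

Section Planar.
Variable U : set M.
Hypotheses (oU : open U) (A0 : forall c m, atlas X c -> dom c m -> U m -> A c m = 0).

Let defect0 m : U m -> shape_defect X A m = 0.
Proof.
move=> Um; have [c Xc cm] := atlas_cover X m.
exact: (shape_defect0 hphi hxi hA Xc cm (A0 Xc cm Um)).
Qed.

Let conf m : U m -> exists2 c, conformal g c & dom c m.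
Proof. by move=> Um; exact: (isothermal_chart hphi hxi hA hflat S oU Um A0). Qed.

(** If r is nonzero at one point it is nonzero nearby, and r t = 0 makes t vanish on that
    neighbourhood. The identity theorem is applied to the conjugate of t, which is the holomorphic
    one. *)
Lemma planar_dichotomy a b p q : connected U -> factorization S A U a b p q ->
  ((forall m, U m -> p m + 'i%C * q m = 0) /\
   holomorphic_on g U (fun m => p m - 'i%C * q m)) \/
  ((forall m, U m -> p m - 'i%C * q m = 0) /\
   antiholomorphic_on g U (fun m => p m + 'i%C * q m)).
Proof.
move=> cU fac; have [sp sq _ pq pq2] := factorization_shape oU fac.
have [hol ahol] := conjugate_holomorphic oU sp sq pq.
have rt m : U m -> (p m - 'i%C * q m) * (p m + 'i%C * q m) = 0.
  by move=> Um; rewrite mul_sum_diff pq2 // defect0 // oppr0.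
have [[m0 [Um0 r0]]|nr] := pselect (exists m, U m /\ p m - 'i%C * q m != 0); last first.
  right; split=> // m Um; apply/eqP/negP => /negP r0; apply: nr; by exists m.
left; split=> // m Um; apply: (can_inj (@conjcK R)); rewrite conjc0.
apply: (identity_theorem oU cU ahol conf Um0) Um.
have nU : \forall m' \near m0, U m' by exact: (open_nbhs_nbhs (conj oU Um0)).
apply: filterS2 nU (csmooth_near_neq0 hol.1 Um0 r0) => m' Um' r1.
by have /eqP := rt m' Um'; rewrite mulf_eq0 (negPf r1) => /eqP ->; rewrite conjc0.
Qed.

Let smooth_scale a (x : R[i]) : csmooth_fun X U a -> csmooth_fun X U (fun m => x * a m).
Proof.
move=> sa; have := csmooth_fun_linear x 0 oU sa sa.
by congr (csmooth_fun _ _ _); apply/funext => m; rewrite mul0r addr0.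
Qed.

Let i2 : 'i%C * 'i%C = - 1 :> R[i]. Proof. by rewrite -expr2 sqr_i. Qed.

Lemma planar_holomorphic r : holomorphic_on g U r ->
  exists a b p q, factorization S A U a b p q /\
    forall m, U m -> p m - 'i%C * q m = r m /\ p m + 'i%C * q m = 0.
Proof.
move=> hr; have pq := holomorphic_conjugate oU hr conf.
exists (fun m => - (2^-1 * r m)), (fun m => ('i%C / 2) * r m),
  (fun m => 2^-1 * r m), (fun m => ('i%C / 2) * r m); split.
  apply: factorization_exists => //; try exact: smooth_scale hr.1.
  move=> m Um; rewrite defect0 // oppr0.
  transitivity ((1 + 'i%C * 'i%C) / 4 * r m ^+ 2); first by field.
  by rewrite i2 subrr !mul0r.
move=> m _; split.
  transitivity ((1 - 'i%C * 'i%C) / 2 * r m); first by field.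
  by rewrite i2; field.
transitivity ((1 + 'i%C * 'i%C) / 2 * r m); first by field.
by rewrite i2 subrr !mul0r.
Qed.

Lemma planar_antiholomorphic t : antiholomorphic_on g U t ->
  exists a b p q, factorization S A U a b p q /\
    forall m, U m -> p m - 'i%C * q m = 0 /\ p m + 'i%C * q m = t m.
Proof.
move=> ht; have pq := antiholomorphic_conjugate oU ht conf.
have st : csmooth_fun X U t.
  have := csmooth_fun_conj oU ht.1; congr (csmooth_fun _ _ _).
  by apply/funext => m'; rewrite conjcK.
exists (fun m => - (2^-1 * t m)), (fun m => (- 'i%C / 2) * t m),
  (fun m => 2^-1 * t m), (fun m => (- 'i%C / 2) * t m); split.
  apply: factorization_exists => //; try exact: smooth_scale st.
  move=> m Um; rewrite defect0 // oppr0.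
  transitivity ((1 + 'i%C * 'i%C) / 4 * t m ^+ 2); first by field.
  by rewrite i2 subrr !mul0r.
move=> m _; split.
  transitivity ((1 + 'i%C * 'i%C) / 2 * t m); first by field.
  by rewrite i2 subrr !mul0r.
transitivity ((1 - 'i%C * 'i%C) / 2 * t m); first by field.
by rewrite i2; field.
Qed.

End Planar.
End Main.

Theorem proposition7p4 (R : realType) (M N : topologicalType)
  (X : oriented_manifold R 2 M) (g : riemannian_metric X)
  (Y : oriented_manifold R 3 N) (h : riemannian_metric Y) (hflat : flat h)
  (phi : M -> N) (hphi : isometric_immersion g h phi)
  (xi : chart R 3 N -> M -> 'rV[R]_3) (hxi : unit_normal X h phi xi)
  (A : chart R 2 M -> M -> 'M[R]_2) (hA : shape_operator X h phi xi A)
  (S : spin_structure g) :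
  (forall (U : set M) (a b p q : M -> R[i]),
    open U -> factorization S A U a b p q ->
    [/\ forall m, U m -> a m = - p m /\ b m = q m,
        forall c m, atlas X c -> dom c m -> U m ->
          cgrad g c p m = cgrad g c q m *m map_mx (real_complex R) (Jmx g c m)
          /\ p m ^+ 2 + q m ^+ 2
             = (mean_curvature A c m ^+ 2 - shape_sqnorm A c m)%:C,
        holomorphic_on g U (fun m => p m - 'i%C * q m),
        antiholomorphic_on g U (fun m => p m + 'i%C * q m) &
        forall c m, atlas X c -> dom c m -> U m ->
          (p m - 'i%C * q m) * (p m + 'i%C * q m)
          = (mean_curvature A c m ^+ 2 - shape_sqnorm A c m)%:C])
  /\
  (forall U : set M,
    open U -> connected U -> simply_connected R U ->
    (forall c m, atlas X c -> dom c m -> U m -> A c m != 0) ->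
    ((exists a b p q : M -> R[i], factorization S A U a b p q) <->
     (forall c m, atlas X c -> dom c m -> U m ->
        laplacian g c
          (fun m' => ln (shape_sqnorm A c m' - mean_curvature A c m' ^+ 2)) m
        = 0)))
  /\
  (forall U : set M,
    open U -> connected U ->
    (forall c m, atlas X c -> dom c m -> U m -> A c m = 0) ->
    [/\ forall a b p q : M -> R[i], factorization S A U a b p q ->
          ((forall m, U m -> p m + 'i%C * q m = 0) /\
           holomorphic_on g U (fun m => p m - 'i%C * q m)) \/
          ((forall m, U m -> p m - 'i%C * q m = 0) /\
           antiholomorphic_on g U (fun m => p m + 'i%C * q m)),
        forall r : M -> R[i], holomorphic_on g U r ->
          exists a b p q : M -> R[i], factorization S A U a b p q /\
            forall m, U m -> p m - 'i%C * q m = r m /\ p m + 'i%C * q m = 0 &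
        forall t : M -> R[i], antiholomorphic_on g U t ->
          exists a b p q : M -> R[i], factorization S A U a b p q /\
            forall m, U m -> p m - 'i%C * q m = 0 /\ p m + 'i%C * q m = t m]).
Proof.
split; [|split].
- by move=> U a b p q; exact: (factorization_properties hphi hxi hA).
- by move=> U oU _ scU A0; exact: (factorization_log_harmonic S hflat hphi hxi hA oU scU A0).
move=> U oU cU A0; split=> [a b p q|r|t].
- exact: (planar_dichotomy hflat hphi hxi hA oU A0 cU).
- exact: (planar_holomorphic S hflat hphi hxi hA oU A0).
- exact: (planar_antiholomorphic S hflat hphi hxi hA oU A0).
Qed.
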